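(* Let $Y(u)$ be the solution (unique up to translation in $u$) of $\frac{dY_i}{du}=-Y_iF_i(Y)$, $1\le i\le m$, lying in $\Omega_+\setminus\{0,\xi\}$ with $\lim_{u\to-\infty}Y(u)=\xi$, and let $g_{a,\vec b}(\tau)$, $\tau\in(-T_1,\infty)$, be the corresponding ancient solution of the Ricci flow on the circle bundle $P_Q$, where $-T_1=\lim_{u\to-\infty}\tau(u)$ is finite. Then: (i) $$\lim_{\tau\to-T_1^+}a(\tau)=0,\quad\lim_{\tau\to-T_1^+}b_i(\tau)=0,\quad\lim_{\tau\to-T_1^+}\frac{a(\tau)}{b_i(\tau)}=\xi_i,\quad\lim_{\tau\to-T_1^+}\frac{a(\tau)}{T_1+\tau}=E(\xi).$$ Geometrically, as $\tau\to-T_1^+$, the circle bundle $P_Q$, equipped with the metric $g_{a,\vec b}(\tau)$, collapses to a point in the Gromov–Hausdorff topology. (ii) The solution $g_{a,\vec b}(\tau)$ is of type I as $\tau\to-T_1^+$, i.e., there is a positive constant $C<\infty$ such that for $\tau\in(-T_1,0]$ $$(T_1+\tau)\cdot\sup_{x\in P_Q}|\mathrm{Rm}_{g_{a,\vec b}(\tau)}(x)|_{g_{a,\vec b}(\tau)}\le C.$$ (iii) As $\tau\to-T_1^+$ the rescaled metric $(T_1+\tau)^{-1}g_{a,\vec b}(\tau)$ on $P_Q$ converges to the Einstein metric $E(\xi)\,g_{1,(\xi_1^{-1},\dots,\xi_m^{-1})}$, where $g_{1,(\xi_1^{-1},\dots,\xi_m^{-1})}=\sigma\otimes\sigma+\sum_i\xi_i^{-1}g_i$.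 The metric $g_{1,(\xi_1^{-1},\dots,\xi_m^{-1})}$ has Ricci tensor $\mathrm{Rc}=\frac{E(\xi)}{2}\,g_{1,(\xi_1^{-1},\dots,\xi_m^{-1})}$ and scalar curvature $R=2\sum_{i=1}^mn_ip_i\xi_i-\frac12E(\xi)$.
   Context: For $1\le i\le m$, $(M_i,g_i)$ is a compact Kähler–Einstein manifold of complex dimension $n_i$, $\mathrm{Rc}(g_i)=p_ig_i$ with $p_i$ a positive integer, with Kähler form $\omega_i$, scaled so that $\frac1{2\pi}[\omega_i]$ is integral and represents a torsion-free indivisible class in $H^2(M_i,\mathbb{Z})$. Let $q_1,\dots,q_m$ be nonzero integers and $P_Q\to M_1\times\cdots\times M_m$ the principal circle bundle with Euler class $\frac1{2\pi}\sum_iq_i[\omega_i]$, with principal connection $\sigma$ of curvature form $d\sigma=\sum_iq_i\omega_i$. Consider metrics $g_{a,\vec b}(\tau)=a(\tau)\,\sigma\otimes\sigma+\sum_ib_i(\tau)g_i$, $a,b_i>0$ ($g_i$ pulled back). With $\tau=-t$ the backwards Ricci flow for $g_{a,\vec b}(\tau)$ is $$\frac{da}{d\tau}=\sum_{i}n_iq_i^2\frac{a^2}{b_i^2},\qquad \frac{db_i}{d\tau}=2p_i-q_i^2\frac{a}{b_i}.$$ An ancient solution is one existing for all $t\in(-\infty,T)$ for some finite $T$. Put $Y_i=a/b_i$, $u=\int_0^\tau\frac{d\zeta}{a(\zeta)}$, $E(Y)=\sum_in_iq_i^2Y_i^2$, $F_i(Y)=2p_iY_i-q_i^2Y_i^2-E(Y)$.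 Then the flow becomes $\frac{d\ln a}{du}=E(Y)$, $\frac{dY_i}{du}=-Y_iF_i(Y)$. Conversely, a solution $Y(u)\in\mathbb{R}^m_{>0}$ and a choice of $a(0)>0$ determine the corresponding $g_{a,\vec b}(\tau)$ by $a(u)=a(0)\exp\int_0^uE(Y(\zeta))d\zeta$, $\tau(u)=\int_0^ua(\zeta)d\zeta$, $b_i=a/Y_i$. $\xi\in\mathbb{R}^m_{>0}$ is the unique point with $\xi_i>0$ and $F_i(\xi)=0$ for all $i$. $\Omega_+=\{Y\in\mathbb{R}^m_{\ge0}:F_i(Y)\ge0\text{ for all }i\}$. It is known that, up to translation in $u$, exactly one solution $Y(u)$ lies in $\Omega_+\setminus\{0,\xi\}$ and tends to $\xi$ as $u\to-\infty$, that it exists for all $u\in\mathbb{R}$, has positive components, and that $\lim_{u\to-\infty}\tau(u)=-T_1$ is finite. *)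

(* Defs.v *)
From HB Require Import structures.
From mathcomp Require Import all_boot all_order all_algebra.
From mathcomp Require Import all_classical all_reals all_analysis.

Set Implicit Arguments.
Unset Strict Implicit.
Unset Printing Implicit Defensive.

Import Order.TTheory GRing.Theory Num.Theory.
Import numFieldNormedType.Exports.

Local Open Scope classical_set_scope.
Local Open Scope ring_scope.

(* Vectors are rows: the Jacobian 'J f x of the library acts on the right,
   v *m 'J f x, and a bilinear form h is evaluated as v *m h *m w^T. *)

Section Calculus.
Context {R : realType} {n : nat}.

Definition pder (i : 'I_n) (f : 'rV[R]_n -> R) : 'rV[R]_n -> R :=
  fun x => 'D_(delta_mx 0 i) f x.

Definition pders (s : seq 'I_n) (f : 'rV[R]_n -> R) : 'rV[R]_n -> R :=
  foldr pder f s.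

Definition smooth_germ (f : 'rV[R]_n -> R) (x : 'rV[R]_n) : Prop :=
  \forall y \near x, forall s : seq 'I_n,
    {for y, continuous (pders s f)} /\
    forall i : 'I_n, derivable (pders s f) y (delta_mx 0 i).

End Calculus.

Section Manifolds.
Context {R : realType}.

(* [chart_coord] matters on [chart_dom] only, and its inverse [chart_param]
   on the image of [chart_dom] only. *)
Record chart (n : nat) (T : Type) := Chart {
  chart_dom : set T;
  chart_coord : T -> 'rV[R]_n;
  chart_param : 'rV[R]_n -> T }.

Record atlas (n : nat) (T : Type) := Atlas {
  charts : set (chart n T);
  chart_at : T -> chart n T }.

Definition smooth_at {n k : nat} {T S : Type} (A : atlas n T) (B : atlas k S)
    (f : T -> S) (x : T) : Prop :=
  forall c d, charts A c -> charts B d -> chart_dom c x -> chart_dom d (f x) ->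
    (\forall v \near chart_coord c x, chart_dom d (f (chart_param c v))) /\
    forall j : 'I_k,
      smooth_germ (fun v => chart_coord d (f (chart_param c v)) 0 j)
        (chart_coord c x).

Definition smooth_fun_at {n : nat} {T : Type} (A : atlas n T) (f : T -> R)
    (x : T) : Prop :=
  forall c, charts A c -> chart_dom c x ->
    smooth_germ (fun v => f (chart_param c v)) (chart_coord c x).

Record smooth_manifold {n : nat} {T : topologicalType} (A : atlas n T) : Prop := {
  manifold_hausdorff : hausdorff_space T;
  manifold_second_countable : @second_countable T;
  chart_at_mem : forall x, charts A (chart_at A x) /\ chart_dom (chart_at A x) x;
  chart_dom_open : forall c, charts A c -> open (chart_dom c);
  chart_image_open : forall c, charts A c -> open (chart_coord c @` chart_dom c);
  chart_coordK : forall c x, charts A c -> chart_dom c x ->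
    chart_param c (chart_coord c x) = x;
  chart_coord_continuous : forall c x, charts A c -> chart_dom c x ->
    {for x, continuous (chart_coord c)};
  chart_param_continuous : forall c x, charts A c -> chart_dom c x ->
    {for chart_coord c x, continuous (chart_param c)};
  transition_smooth : forall x, smooth_at A A id x }.

Definition euclid_chart (n : nat) : chart n 'rV[R]_n := Chart setT id id.

Definition euclid_atlas (n : nat) : atlas n 'rV[R]_n :=
  Atlas [set euclid_chart n] (fun=> euclid_chart n).

Definition cylinder_chart {n : nat} {T : Type} (c : chart n T) :
    chart (1 + n) (R * T) :=
  Chart [set z | chart_dom c z.2]
        (fun z => row_mx (const_mx z.1) (chart_coord c z.2))
        (fun v => (lsubmx v 0 0, chart_param c (rsubmx v))).

Definition cylinder_atlas {n : nat} {T : Type} (A : atlas n T) :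
    atlas (1 + n) (R * T) :=
  Atlas (cylinder_chart @` charts A) (fun z => cylinder_chart (chart_at A z.2)).

Section Product.
Context {m : nat} {d : 'I_m -> nat} {T : 'I_m -> topologicalType}.

Definition product_chart (c : forall i, chart (d i) (T i)) :
    chart (\sum_i d i) (prod_topology T) :=
  Chart [set x : prod_topology T | forall i, chart_dom (c i) (x i)]
        (fun x => mxrow (fun i => chart_coord (c i) (x i)))
        (fun v i => chart_param (c i) (submxrow v i)).

Definition product_atlas (A : forall i, atlas (d i) (T i)) :
    atlas (\sum_i d i) (prod_topology T) :=
  Atlas [set product_chart c | c in [set c | forall i, charts (A i) (c i)]]
        (fun x => product_chart (fun i => chart_at (A i) (x i))).

End Product.

(* A tensor field is given by its components in every chart, as functions of
   the coordinates; only charts of the atlas and their images matter. *)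
Definition tensor1 (n : nat) (T : Type) := chart n T -> 'rV[R]_n -> 'rV[R]_n.
Definition tensor2 (n : nat) (T : Type) := chart n T -> 'rV[R]_n -> 'M[R]_n.

Definition one_form {n : nat} {T : Type} (A : atlas n T) (s : tensor1 n T) :
    Prop :=
  (forall c x j, charts A c -> chart_dom c x ->
     smooth_germ (fun v => s c v 0 j) (chart_coord c x)) /\
  (forall c d x, charts A c -> charts A d -> chart_dom c x -> chart_dom d x ->
     s c (chart_coord c x) =
     s d (chart_coord d x) *m
       ('J (chart_coord d \o chart_param c) (chart_coord c x))^T).

Definition covariant2 {n : nat} {T : Type} (A : atlas n T) (h : tensor2 n T) :
    Prop :=
  (forall c x j k, charts A c -> chart_dom c x ->
     smooth_germ (fun v => h c v j k) (chart_coord c x)) /\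
  (forall c d x, charts A c -> charts A d -> chart_dom c x -> chart_dom d x ->
     let J := 'J (chart_coord d \o chart_param c) (chart_coord c x) in
     h c (chart_coord c x) = J *m h d (chart_coord d x) *m J^T).

Definition pullback {n k : nat} {T S : Type} (B : atlas k S) (f : T -> S)
    (h : tensor2 k S) : tensor2 n T :=
  fun c v =>
    let y := f (chart_param c v) in
    let d := chart_at B y in
    let J := 'J (fun w => chart_coord d (f (chart_param c w))) v in
    J *m h d (chart_coord d y) *m J^T.

Definition exterior_d1 {n : nat} {T : Type} (s : tensor1 n T) : tensor2 n T :=
  fun c v => \matrix_(i, j)
    (pder i (fun w => s c w 0 j) v - pder j (fun w => s c w 0 i) v).

Definition closed2 {n : nat} {T : Type} (A : atlas n T) (w : tensor2 n T) :
    Prop :=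
  forall c x i j k, charts A c -> chart_dom c x ->
    pder i (fun v => w c v j k) (chart_coord c x) +
    pder j (fun v => w c v k i) (chart_coord c x) +
    pder k (fun v => w c v i j) (chart_coord c x) = 0.

Record riemannian_metric {n : nat} {T : Type} (A : atlas n T)
    (g : tensor2 n T) : Prop := {
  metric_covariant : covariant2 A g;
  metric_sym : forall c x, charts A c -> chart_dom c x ->
    (g c (chart_coord c x))^T = g c (chart_coord c x);
  metric_pos : forall c x (v : 'rV[R]_n), charts A c -> chart_dom c x -> v != 0 ->
    0 < (v *m g c (chart_coord c x) *m v^T) 0 0 }.

Section Curvature.
Context {n : nat} (G : 'rV[R]_n -> 'M[R]_n).

(* \Gamma^k_{ij} *)
Definition christoffel (k i j : 'I_n) : 'rV[R]_n -> R := fun x =>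
  2^-1 * \sum_l invmx (G x) k l *
    (pder i (fun y => G y j l) x + pder j (fun y => G y i l) x
     - pder l (fun y => G y i j) x).

(* The component R^l_{ijk} in R(e_i, e_j) e_k = \sum_l R^l_{ijk} e_l, where
   R(X, Y) = [\nabla_X, \nabla_Y] - \nabla_[X, Y]. *)
Definition riemann (l i j k : 'I_n) : 'rV[R]_n -> R := fun x =>
  pder i (christoffel l j k) x - pder j (christoffel l i k) x
  + \sum_h (christoffel l i h x * christoffel h j k x
            - christoffel l j h x * christoffel h i k x).

Definition ricci (x : 'rV[R]_n) : 'M[R]_n :=
  \matrix_(j, k) \sum_i riemann i i j k x.

Definition scalar_curvature (x : 'rV[R]_n) : R := \tr (invmx (G x) *m ricci x).

Definition riemann_low (i j k l : 'I_n) (x : 'rV[R]_n) : R :=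
  \sum_h riemann h i j k x * G x h l.

Definition riemann_norm (x : 'rV[R]_n) : R :=
  let H := invmx (G x) in
  Num.sqrt (\sum_i \sum_j \sum_k \sum_l \sum_a \sum_b \sum_c \sum_d
    H i a * H j b * H k c * H l d *
    riemann_low i j k l x * riemann_low a b c d x).

End Curvature.

Definition Rm_norm {n : nat} {T : Type} (A : atlas n T) (g : tensor2 n T)
    (x : T) : R :=
  riemann_norm (g (chart_at A x)) (chart_coord (chart_at A x) x).

Definition einstein {n : nat} {T : Type} (A : atlas n T) (g : tensor2 n T)
    (lambda : R) : Prop :=
  forall c x, charts A c -> chart_dom c x ->
    ricci (g c) (chart_coord c x) = lambda *: g c (chart_coord c x).

(* C^\infty convergence, uniform on compact subsets of every chart. *)
Definition smooth_cvg {n : nat} {T : Type} (A : atlas n T)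
    (F : set_system R) (h : R -> tensor2 n T) (h0 : tensor2 n T) : Prop :=
  forall c (K : set 'rV[R]_n) (s : seq 'I_n) (i j : 'I_n) (e : R),
    charts A c -> compact K -> K `<=` chart_coord c @` chart_dom c -> 0 < e ->
    \forall t \near F, forall v, K v ->
      `|pders s (fun w => h t c w i j) v
        - pders s (fun w => h0 c w i j) v| < e.

Section RiemannianDistance.
Context {n : nat} {T : Type} (A : atlas n T) (g : tensor2 n T).

Definition C1_at (y : R -> T) (t : R) : Prop :=
  forall c, charts A c -> chart_dom c (y t) ->
    forall j : 'I_n, let y_ := fun s : R => chart_coord c (y s) 0 j in
      (\forall s \near t, chart_dom c (y s) /\ derivable y_ s 1) /\
      {for t, continuous (derive1 y_)}.

Definition speed (y : R -> T) (t : R) : R :=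
  let c := chart_at A (y t) in
  let v := \row_j derive1 (fun s : R => chart_coord c (y s) 0 j) t in
  Num.sqrt ((v *m g c (chart_coord c (y t)) *m v^T) 0 0).

Definition curve_length (y : R -> T) : R :=
  Rintegral lebesgue_measure `[0, 1] (speed y).

(* [joined x z L]: some piecewise C^1 curve from x to z has length L. *)
Inductive joined : T -> T -> R -> Prop :=
| joined_refl x : joined x x 0
| joined_cons (y : R -> T) (z : T) (L : R) :
    (forall t, 0 <= t <= 1 -> C1_at y t) -> joined (y 1) z L ->
    joined (y 0) z (curve_length y + L).

Definition riemannian_dist (x z : T) : \bar R :=
  ereal_inf [set L%:E | L in joined x z].

End RiemannianDistance.

(* Gromov-Hausdorff distance: infimum of the Hausdorff distance of X and Y
   over the pseudometrics on X + Y that extend the two given distances. *)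
Definition GH_admissible {X Y : Type} (dX : X -> X -> \bar R)
    (dY : Y -> Y -> \bar R) (D : X + Y -> X + Y -> R) : Prop :=
  [/\ forall a, D a a = 0,
      forall a b, D a b = D b a,
      forall a b c, D a c <= D a b + D b c,
      forall x x', (D (inl x) (inl x'))%:E = dX x x'
    & forall y y', (D (inr y) (inr y'))%:E = dY y y'].

Definition GH_dist {X Y : Type} (dX : X -> X -> \bar R)
    (dY : Y -> Y -> \bar R) : \bar R :=
  ereal_inf [set r%:E | r in [set r | 0 <= r /\ exists D,
    [/\ GH_admissible dX dY D,
        forall x, exists y, D (inl x) (inr y) <= r
      & forall y, exists x, D (inl x) (inr y) <= r]]].

Definition point_dist (_ _ : unit) : \bar R := 0%:E.

(* Singular cochains. A singular simplex is represented by a map on the whole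
   space of which only the restriction to the standard simplex counts. *)
Section SingularCohomology.
Context {T : topologicalType}.

Definition std_simplex (k : nat) : set 'rV[R]_k.+1 :=
  [set v | (forall i, 0 <= v 0 i) /\ \sum_i v 0 i = 1].

Definition face (k : nat) (i : 'I_k.+2) (v : 'rV[R]_k.+1) : 'rV[R]_k.+2 :=
  \row_j (if unlift i j is Some j' then v 0 j' else 0).

Definition cochain (G : Type) (k : nat) := ('rV[R]_k.+1 -> T) -> G.

Definition cochain_ext (G : Type) (k : nat) (c : cochain G k) : Prop :=
  forall f f', (forall v, @std_simplex k v -> f v = f' v) -> c f = c f'.

Definition coboundary (G : pzRingType) (k : nat) (c : cochain G k) :
    cochain G k.+1 :=
  fun f => \sum_(i < k.+2) (-1) ^+ i * c (f \o face i).

Definition cocycle (G : pzRingType) (k : nat) (c : cochain G k) : Prop :=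
  cochain_ext c /\
  forall f, {within @std_simplex k.+1, continuous f} -> coboundary c f = 0.

Definition cohomologous (G : pzRingType) (k : nat) (c c' : cochain G k.+1) :
    Prop :=
  exists2 b : cochain G k, cochain_ext b &
    forall f, {within @std_simplex k.+1, continuous f} ->
      c f - c' f = coboundary b f.

Definition simplex2_integral {n : nat} (A : atlas n T) (w : tensor2 n T)
    (f : 'rV[R]_3 -> T) : R :=
  let e (i : 'I_3) : 'rV[R]_3 := delta_mx 0 i in
  let e0 := e ord0 in
  let e1 := e (inord 1) in
  let e2 := e (inord 2) in
  Rintegral lebesgue_measure `[0, 1] (fun s =>
    Rintegral lebesgue_measure `[0, 1 - s] (fun t =>
      ((e1 - e0)
       *m pullback A f w (euclid_chart 3)
            (e0 + s *: (e1 - e0) + t *: (e2 - e0))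
       *m (e2 - e0)^T) 0 0)).

(* The closed form w and the integral cocycle c have the same class in
   H^2(T; R), compared on smooth singular simplices. *)
Definition de_rham_class {n : nat} (A : atlas n T) (w : tensor2 n T)
    (c : cochain int 2) : Prop :=
  exists2 b : cochain R 1, cochain_ext b &
    forall f, (forall v, @std_simplex 2 v -> smooth_at (euclid_atlas 3) A f v) ->
      (c f)%:~R - simplex2_integral A w f = coboundary b f.

Definition integral_indivisible {n : nat} (A : atlas n T) (w : tensor2 n T) :
    Prop :=
  exists c : cochain int 2,
    [/\ cocycle c, de_rham_class A w c,
        forall k : int, k != 0 -> ~ cohomologous (fun f => k * c f) (fun=> 0)
      & forall (k : int) (c' : cochain int 2), cocycle c' ->
          cohomologous c (fun f => k * c' f) -> `|k| = 1].

End SingularCohomology.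

(* C^n is R^(n + n) with coordinates (x, y), z = x + i y. *)
Definition std_J (n : nat) : 'M[R]_(n + n) :=
  block_mx 0 1%:M (- 1%:M) 0.

Definition holomorphic_atlas {n : nat} {T : Type} (A : atlas (n + n) T) : Prop :=
  forall c d x, charts A c -> charts A d -> chart_dom c x -> chart_dom d x ->
    let D := 'J (chart_coord d \o chart_param c) (chart_coord c x) in
    std_J n *m D = D *m std_J n.

(* omega(v, w) = g(J v, w) *)
Definition kahler_form {n : nat} {T : Type} (g : tensor2 (n + n) T) :
    tensor2 (n + n) T := fun c v => std_J n *m g c v.

Record kahler_einstein {n : nat} {T : topologicalType} (A : atlas (n + n) T)
    (g : tensor2 (n + n) T) (lambda : R) : Prop := {
  ke_manifold : smooth_manifold A;
  ke_compact : compact [set: T];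
  ke_connected : connected [set: T];
  ke_holomorphic : holomorphic_atlas A;
  ke_metric : riemannian_metric A g;
  ke_hermitian : forall c x, charts A c -> chart_dom c x ->
    std_J n *m g c (chart_coord c x) *m (std_J n)^T = g c (chart_coord c x);
  ke_closed : closed2 A (kahler_form g);
  ke_einstein : einstein A g lambda }.

(* The circle is R / 2 pi Z. A local trivialization over U is a smooth section
   s together with the smooth fibre coordinate cs + i * sn on the preimage of
   U, which takes the value e^(i t) at the translate of s y by t. *)
Record principal_circle_bundle {N k : nat} {P X : topologicalType}
    (A : atlas N P) (B : atlas k X) (act : R -> P -> P) (proj : P -> X) :
    Prop := {
  pcb_manifold : smooth_manifold A;
  pcb_act0 : forall x, act 0 x = x;
  pcb_actD : forall s t x, act (s + t) x = act s (act t x);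
  pcb_free : forall t x,
    act t x = x <-> exists l : int, t = l%:~R * (2 * pi);
  pcb_act_smooth : forall z,
    smooth_at (cylinder_atlas A) A (fun z => act z.1 z.2) z;
  pcb_proj_smooth : forall x, smooth_at A B proj x;
  pcb_fibre : forall x y, proj x = proj y <-> exists t, y = act t x;
  pcb_trivial : forall b : X, exists2 U : set X, open U /\ U b &
    exists (s : X -> P) (cs sn : P -> R),
    [/\ forall y, U y -> smooth_at B A s y /\ proj (s y) = y,
        forall x, U (proj x) -> smooth_fun_at A cs x /\ smooth_fun_at A sn x
      & forall y t, U y ->
          cs (act t (s y)) = cos t /\ sn (act t (s y)) = sin t] }.

Record principal_connection {N : nat} {P : Type} (A : atlas N P)
    (act : R -> P -> P) (sigma : tensor1 N P) : Prop := {
  conn_form : one_form A sigma;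
  conn_invariant : forall t c d x, charts A c -> charts A d ->
    chart_dom c x -> chart_dom d (act t x) ->
    sigma c (chart_coord c x) =
    sigma d (chart_coord d (act t x)) *m
      ('J (fun v => chart_coord d (act t (chart_param c v)))
         (chart_coord c x))^T;
  conn_vertical : forall c x, charts A c -> chart_dom c x ->
    \sum_j sigma c (chart_coord c x) 0 j *
      derive1 (fun t : R => chart_coord c (act t x) 0 j) 0 = 1 }.

End Manifolds.

Section CircleBundleMetrics.
Context {R : realType} {m : nat} {n : 'I_m -> nat} {M : 'I_m -> topologicalType}.
Variable A : forall i, atlas (R := R) (n i + n i) (M i).
Context {N : nat} {P : Type}.
Variable proj : P -> prod_topology M.

Definition connection_curvature (q : 'I_m -> int)
    (g : forall i, tensor2 (R := R) (n i + n i) (M i)) (AP : atlas N P)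
    (sigma : tensor1 N P) : Prop :=
  forall c x, charts AP c -> chart_dom c x ->
    exterior_d1 sigma c (chart_coord c x) =
    \sum_i (q i)%:~R *:
      pullback (A i) (fun y => proj y i) (kahler_form (g i)) c (chart_coord c x).

Definition bundle_metric (g : forall i, tensor2 (R := R) (n i + n i) (M i))
    (sigma : tensor1 N P) (a : R) (b : 'I_m -> R) : tensor2 N P :=
  fun c v => a *: ((sigma c v)^T *m sigma c v) +
    \sum_i b i *: pullback (A i) (fun y => proj y i) (g i) c v.

End CircleBundleMetrics.

Section ReducedFlow.
Context {R : realType} {m : nat}.
Variables (n p : 'I_m -> nat) (q : 'I_m -> int).

Definition flowE (y : 'rV[R]_m) : R :=
  \sum_i (n i)%:R * (q i)%:~R ^+ 2 * y 0 i ^+ 2.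

Definition flowF (i : 'I_m) (y : 'rV[R]_m) : R :=
  2 * (p i)%:R * y 0 i - (q i)%:~R ^+ 2 * y 0 i ^+ 2 - flowE y.

Definition Omega_plus (y : 'rV[R]_m) : Prop :=
  forall i, 0 <= y 0 i /\ 0 <= flowF i y.

Definition oriented_integral (f : R -> R) (u : R) : R :=
  if 0 <= u then Rintegral lebesgue_measure `[0, u] f
  else - Rintegral lebesgue_measure `[u, 0] f.

Definition a_of (a0 : R) (Y : R -> 'rV[R]_m) (u : R) : R :=
  a0 * expR (oriented_integral (fun z => flowE (Y z)) u).

Definition tau_of (a0 : R) (Y : R -> 'rV[R]_m) (u : R) : R :=
  oriented_integral (a_of a0 Y) u.

End ReducedFlow.

(* Main.v *)
(* The curvature of g = a sigma^2 + sum_i b_i g_i is computed in the coordinates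
   (r, z) -> e^(ir) s(z) given by a local section s, in which sigma = dr + A(z) dz with
   dA = sum_i q_i omega_i. With phi = sum_i q_i xi_i J_i, which is parallel because
   Kaehler complex structures are, the Ricci tensor of g_xi is -tr(phi^2)/4 on the
   fibre and Rc(h) + phi^2 h/2 on the base, where h = sum_i g_i / xi_i; the equations
   F_i(xi) = 0 say exactly that both are E(xi)/2 times the metric.

   Along the solution each Y_i decreases in u from xi_i and stays positive. Since
   da/dtau = E(Y) and E(Y) increases to E(xi) as u -> -oo, a - E(xi) tau and a - c tau
   (c < E(xi)) are monotone near -oo, which gives a / (T_1 + tau) -> E(xi).

   Writing g_{a,b} = a g_{1,b/a}, the curvature norm is 1/a times that of a metric from
   a compact family on a compact manifold, which gives type I. Finally
   g_{a,b} <= (a + sum_i b_i) g_{1,1} and g_{1,1} has finite diameter, because the bundle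
   is compact and connected; hence the collapse. *)
Require Import Defs.
From HB Require Import structures.
From mathcomp Require Import all_boot all_order all_algebra.
From mathcomp Require Import all_classical all_reals all_analysis.
From mathcomp Require Import ring lra.

Set Implicit Arguments.
Unset Strict Implicit.
Unset Printing Implicit Defensive.

Import Order.TTheory GRing.Theory Num.Theory.
Import numFieldNormedType.Exports.

Local Open Scope classical_set_scope.
Local Open Scope ring_scope.

(** * Smooth functions of several variables *)
Section Calculus.
Context {R : realType}.

(** Tensors are only component functions in charts and curvature is an explicit sum of derivatives
    of them, so even independence of the chart has to be proved. What keeps this tractable is to
    read Christoffel symbols as connection matrices: a change of frame acts by a gauge
    transformation, and uniqueness of the Levi-Civita connection allows a connection to be guessed
    and checked rather than computed. One lemma, [frame_curv], then yields both the invariance of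
    curvature under coordinate changes (the frame is the Jacobian) and the curvature of the bundle
    (the frame consists of the vertical vector and horizontal lifts).

    The second obstacle is that [pullback], [speed] and [Rm_norm] use the chart chosen at each
    point, which jumps from point to point; covariance must move them to one fixed chart before
    anything is differentiated or estimated.

    Two facts that look like data are derived: [E(Y 0) > 0] comes from the finiteness of [T1], and
    the existence of points from the nontriviality of the cohomology classes. *)

Lemma near_fin (T : topologicalType) (I : finType) (x : T) (P : I -> T -> Prop) :
  (forall i, \forall y \near x, P i y) -> \forall y \near x, forall i, P i y.
Proof. by move=> H; apply: filter_forall. Qed.

Lemma near_ex_open (T : topologicalType) (x : T) (P : T -> Prop) :
  (\forall y \near x, P y) -> exists U, [/\ open U, U x & forall y, U y -> P y].
Proof.
move=> xP; have : nbhs x P by [].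
by rewrite nbhsE => -[U [oU Ux] UP]; exists U.
Qed.

Lemma near_and (T : topologicalType) (x : T) (P Q : T -> Prop) :
  (\forall y \near x, P y) -> (\forall y \near x, Q y) ->
  \forall y \near x, P y /\ Q y.
Proof. by move=> ? ?; apply: filterI. Qed.

Lemma cvg_bigsum (I : Type) (T : Type) (F : set_system T) (FF : Filter F)
    (r : seq I) (f : I -> T -> R) (l : I -> R) :
  (forall i, f i t @[t --> F] --> l i) ->
  \sum_(i <- r) f i t @[t --> F] --> \sum_(i <- r) l i.
Proof.
move=> fl; elim: r => [|i r IH].
  under eq_fun do rewrite big_nil; rewrite big_nil; exact: cvg_cst.
by under eq_fun do rewrite big_cons; rewrite big_cons; apply: cvgD.
Qed.

Section Cont.
Context {T : topologicalType}.
Implicit Types (f g : T -> R) (x : T).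

Lemma cont_cst (c : R) x : {for x, continuous (fun=> c)}.
Proof. exact: cvg_cst. Qed.

Lemma contD f g x : {for x, continuous f} -> {for x, continuous g} ->
  {for x, continuous (fun y => f y + g y)}.
Proof. by move=> cf cg; apply: (@cvgD _ _ _ (nbhs x)). Qed.

Lemma contM f g x : {for x, continuous f} -> {for x, continuous g} ->
  {for x, continuous (fun y => f y * g y)}.
Proof. by move=> cf cg; apply: (@cvgM _ _ (nbhs x)). Qed.

Lemma contV f x : f x != 0 -> {for x, continuous f} ->
  {for x, continuous (fun y => (f y)^-1)}.
Proof. by move=> f0 cf; apply: (@cvgV _ _ (nbhs x)). Qed.

Lemma cont_eq (S : topologicalType) (f g : T -> S) x :
  (\forall y \near x, f y = g y) -> {for x, continuous f} ->
  {for x, continuous g}.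
Proof.
move=> fg cf; rewrite /prop_for /continuous_at -(nbhs_singleton fg).
by apply: cvg_trans cf; apply: near_eq_cvg.
Qed.

Lemma cont_sum (I : Type) (r : seq I) (f : I -> T -> R) x :
  (forall i, {for x, continuous (f i)}) ->
  {for x, continuous (fun y => \sum_(i <- r) f i y)}.
Proof. by move=> cf; apply: (@cvg_bigsum _ _ (nbhs x)). Qed.

Lemma cont_dist f x (e : R) : 0 < e -> {for x, continuous f} ->
  \forall y \near x, `|f x - f y| < e.
Proof. by move=> e0 /cvgrPdist_lt; apply. Qed.

End Cont.

Lemma derive_lineP n (f : 'rV[R]_n -> R) (z e : 'rV[R]_n) (t : R) :
  derivable f (z + t *: e) e ->
  is_derive t (1 : R) (fun s => f (z + s *: e)) ('D_e f (z + t *: e)).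
Proof.
have E : (fun h : R => h^-1 *: (f (z + (h *: (1 : R) + t) *: e) - f (z + t *: e)))
    = (fun h => h^-1 *: (f (h *: e + (z + t *: e)) - f (z + t *: e))).
  apply/funext => h; congr (_ *: (f _ - _)).
  by rewrite scalerDl [h *: 1]mulr1 addrCA.
move=> df; apply: DeriveDef; last by rewrite /derive /= E.
by move: df; rewrite /derivable /= E.
Qed.

Lemma line_MVT n (f : 'rV[R]_n -> R) (z e : 'rV[R]_n) (c : R) :
  (forall t, `|t| <= `|c| -> derivable f (z + t *: e) e) ->
  exists2 t, `|t| <= `|c| & f (z + c *: e) - f z = c * 'D_e f (z + t *: e).
Proof.
move=> df; pose g s := f (z + s *: e); pose dg s := 'D_e f (z + s *: e).
have dgP t : `|t| <= `|c| -> is_derive t (1 : R) g (dg t).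
  by move=> /df; exact: derive_lineP.
have cg (a b : R) : (forall t, a <= t <= b -> `|t| <= `|c|) ->
    {within `[a, b], continuous g}.
  move=> h; apply: derivable_within_continuous => t; rewrite in_itv /= => /h tc.
  by have [] := dgP t tc.
have [c0|c0] := leP 0 c.
  have h t : 0 <= t <= c -> `|t| <= `|c|.
    by move=> /andP[? ?]; rewrite !ger0_norm.
  have [t tI E] := @MVT_segment _ g dg 0 c c0
    (fun x xI => dgP x (h x (subset_itv_oo_cc xI))) (cg _ _ h).
  exists t; first by apply: h; rewrite in_itv in tI.
  by move: E; rewrite /g /dg scale0r addr0 subr0 => ->; rewrite mulrC.
have h t : c <= t <= 0 -> `|t| <= `|c|.
  by move=> /andP[? ?]; rewrite !ler0_norm ?lerN2 // ltW.
have [t tI E] := @MVT_segment _ g dg c 0 (ltW c0)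
  (fun x xI => dgP x (h x (subset_itv_oo_cc xI))) (cg _ _ h).
exists t; first by apply: h; rewrite in_itv in tI.
move: E; rewrite /g /dg scale0r addr0 sub0r mulrN => /eqP.
by rewrite -subr_eq0 opprK addrAC addrC -opprB => /eqP E; rewrite mulrC; lra.
Qed.

Lemma shift_derive n (f : 'rV[R]_n -> R) (a z v : 'rV[R]_n) :
  (derivable (fun x => f (x + a)) z v <-> derivable f (z + a) v) /\
  'D_v (fun x => f (x + a)) z = 'D_v f (z + a).
Proof.
have E : (fun h : R => h^-1 *: (f (h *: v + z + a) - f (z + a))) =
   (fun h => h^-1 *: (f (h *: v + (z + a)) - f (z + a))).
  by apply/funext => h; rewrite addrA.
by rewrite /derivable /derive /= E.
Qed.

Lemma row_sum_delta' n (h : 'rV[R]_n) :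
  h = \sum_(i <- index_enum 'I_n) h 0 i *: delta_mx 0 i.
Proof. exact: row_sum_delta. Qed.

Lemma coord_le_norm p n (h : 'M[R]_(p, n)) i j : `|h i j| <= `|h|.
Proof.
rewrite [leRHS]/Num.Def.normr /= mx_normrE.
exact: (le_bigmax _ (fun ij : 'I_p * 'I_n => `|h ij.1 ij.2|) (i, j)).
Qed.

Lemma norm_delta_le n (i : 'I_n) : `|delta_mx 0 i : 'rV[R]_n| <= 1.
Proof.
rewrite /Num.Def.normr /= mx_normrE; apply: bigmax_le => // -[a b] _ /=.
by rewrite mxE; case: (_ && _); rewrite ?normr1 ?normr0.
Qed.

Lemma nbhs_rVP n (x : 'rV[R]_n) (P : set 'rV[R]_n) :
  (\forall y \near x, P y) <->
  exists2 d : R, 0 < d & forall h, `|h| < d -> P (x + h).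
Proof.
split.
  move=> /nbhs_ballP[d d0 dP]; exists d => // h hd; apply: dP.
  by rewrite mx_norm_ball /ball_ /= opprD addrA subrr sub0r normrN.
move=> [d d0 dP]; apply/nbhs_ballP; exists d => // y.
rewrite mx_norm_ball /ball_ /= => yd.
by rewrite -(subrK x y) addrC; apply: dP; rewrite distrC.
Qed.

(** Going from [x] to [x + h] one coordinate at a time, the mean value theorem turns each increment
    into a partial derivative at a point near [x], and continuity replaces it by the one at [x]. *)
Lemma C1_differentiable n (f : 'rV[R]_n -> R) (x : 'rV[R]_n) :
  (forall i, (\forall y \near x, derivable f y (delta_mx 0 i)) /\
     {for x, continuous (pder i f)}) -> differentiable f x.
Proof.
move=> H; pose L (h : 'rV[R]_n) : R := \sum_i h 0 i * pder i f x.
have L_lin : linear L.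
  move=> a u v; rewrite /L scaler_sumr -big_split /=; apply: eq_bigr => i _.
  by rewrite !mxE mulrDl scalerA.
pose LM := GRing.isLinear.Build _ _ _ _ _ L_lin.
pose LL : {linear _ -> _} := HB.pack L LM.
have Lc : continuous LL.
  move=> u; apply: cont_sum => i; apply: contM; last exact: cont_cst.
  exact: coord_continuous.
suff B e : 0 < e -> \forall h \near (0 : 'rV[R]_n),
    `|(f \o shift x - (cst (f x) + LL)) h| <= e * `|h|.
  have dE : 'd f x = LL :> ('rV[R]_n -> R).
    by apply: (diff_unique Lc); apply/eqaddoP.
  by apply/diff_locallyP; rewrite dE; split=> //; apply/eqaddoP.
move=> e0.
(* There are [n] errors to add, and the intermediate points lie within [n] times the norm of [h];
   hence both the error and, below, the radius are divided by [n.+1], which is nonzero also for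
   [n = 0]. *)
have en0 : 0 < e / n.+1%:R by rewrite divr_gt0.
have : \forall y \near x, forall i, derivable f y (delta_mx 0 i) /\
    `|pder i f x - pder i f y| < e / n.+1%:R.
  apply: near_fin => i; apply: near_and; first exact: (H i).1.
  by apply: cont_dist en0 _; exact: (H i).2.
move=> /nbhs_rVP[d d0 dH].
apply/nbhs_rVP; exists (d / n.+1%:R); first by rewrite divr_gt0.
move=> h; rewrite add0r ltr_pdivlMr // => hd.
rewrite !fctE /= addrC.
pose V (s : seq 'I_n) := \sum_(i <- s) h 0 i *: (delta_mx 0 i : 'rV[R]_n).
have VN s : `|V s| <= `|h| * (size s)%:R.
  rewrite /V; elim: s => [|i s IH]; first by rewrite big_nil normr0 mulr0.
  rewrite big_cons (le_trans (ler_normD _ _))//= -natr1 mulrDr mulr1 addrC lerD//.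
  rewrite normrZ -[leRHS]mulr1 ler_pM//; first exact: coord_le_norm.
  exact: norm_delta_le.
have Vb s : (size s <= n)%N ->
  `|f (x + V s) - f x - \sum_(i <- s) h 0 i * pder i f x|
    <= (size s)%:R * (e / n.+1%:R * `|h|).
  elim: s => [_|i s IH sn].
    by rewrite /V !big_nil addr0 !subr0 subrr normr0 mul0r.
  have Vs t : `|t| <= `|h 0 i| -> `|V s + t *: delta_mx 0 i| < d.
    move=> th; apply: le_lt_trans hd.
    rewrite (le_trans (ler_normD _ _))//.
    apply: (@le_trans _ _ (`|h| * (size s)%:R + `|h|)).
      rewrite lerD ?VN // normrZ -[leRHS]mulr1 ler_pM //.
        exact: (le_trans th (coord_le_norm _ _ _)).
      exact: norm_delta_le.
    rewrite -[X in _ + X]mulr1 -mulrDr natr1 ler_wpM2l // ler_nat.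
    exact: leqW.
  have [t th E] := @line_MVT n f (x + V s) (delta_mx 0 i) (h 0 i)
    (fun t th => ltac:(rewrite -addrA; exact: (dH _ (Vs t th) i).1)).
  rewrite /V !big_cons -/(V s) [_ *: _ + _]addrC addrA.
  rewrite (_ : _ - _ - _ = (f (x + V s) - f x - \sum_(i <- s) h 0 i * pder i f x)
     + h 0 i * ('D_(delta_mx 0 i) f (x + V s + t *: delta_mx 0 i) - pder i f x)).
    rewrite (le_trans (ler_normD _ _))//.
    rewrite (_ : (size (i :: s))%:R = (size s)%:R + 1 :> R); last by rewrite natr1.
    rewrite mulrDl mul1r lerD//.
      by apply: IH; apply: ltnW.
    rewrite normrM mulrC ler_pM // ?coord_le_norm //.
    by rewrite distrC -addrA ltW//; exact: (dH _ (Vs t th) i).2.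
  by rewrite mulrBr -E; lra.
have := Vb (index_enum 'I_n); rewrite /V -row_sum_delta'.
have -> : size (index_enum 'I_n) = n by rewrite /index_enum -enumT size_enum_ord.
move=> /(_ (leqnn _)); rewrite [h + x]addrC [- _ + _]addrC -/(L h).
rewrite -[f _ - f x - L h]addrA -opprD => /le_trans; apply.
rewrite mulrA ler_wpM2r // mulrCA -[leRHS]mulr1 ler_wpM2l ?ltW//.
by rewrite ltr_pdivrMr // mul1r ltr_nat.
Qed.

Lemma derivable_subr n (f g : 'rV[R]_n -> R) x v :
  derivable f x v -> derivable g x v ->
  derivable (fun y => f y - g y) x v /\
  'D_v (fun y => f y - g y) x = 'D_v f x - 'D_v g x.
Proof. by move=> df dg; split; [exact: derivableB|exact: deriveB]. Qed.

Lemma schwarz n (f : 'rV[R]_n -> R) (x : 'rV[R]_n) (i j : 'I_n) :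
  (\forall y \near x, forall k, derivable f y (delta_mx 0 k)) ->
  (\forall y \near x, forall k l, derivable (pder k f) y (delta_mx 0 l)) ->
  (forall k l, {for x, continuous (pder k (pder l f))}) ->
  pder i (pder j f) x = pder j (pder i f) x.
Proof.
move=> df ddf cf.
(* the second difference of f equals c^2 times either mixed derivative at a
   point within 2c of x *)
have key (i0 j0 : 'I_n) (d : R) : 0 < d ->
    (forall h, `|h| < d -> (forall k, derivable f (x + h) (delta_mx 0 k)) /\
      (forall k l, derivable (pder k f) (x + h) (delta_mx 0 l))) ->
  forall c : R, 0 < c -> c + c < d ->
  exists2 h, `|h| <= c + c &
   f (x + c *: delta_mx 0 i0 + c *: delta_mx 0 j0) - f (x + c *: delta_mx 0 i0)
   - (f (x + c *: delta_mx 0 j0) - f x) = c * c * pder j0 (pder i0 f) (x + h).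
  move=> d0 dH c c0 cd.
  pose F y := f (y + c *: delta_mx 0 j0) - f y.
  have small (a b : R) : `|a| <= `|c| -> `|b| <= `|c| ->
      `|a *: (delta_mx 0 i0 : 'rV[R]_n) + b *: delta_mx 0 j0| <= c + c.
    rewrite (ger0_norm (ltW c0)) => ac bc.
    rewrite (le_trans (ler_normD _ _))// lerD// normrZ -[leRHS]mulr1;
      by rewrite ler_pM// norm_delta_le.
  have dF t : `|t| <= `|c| -> derivable F (x + t *: delta_mx 0 i0) (delta_mx 0 i0) /\
     'D_(delta_mx 0 i0) F (x + t *: delta_mx 0 i0) =
      pder i0 f (x + t *: delta_mx 0 i0 + c *: delta_mx 0 j0)
      - pder i0 f (x + t *: delta_mx 0 i0).
    move=> tc.
    have [s1 s2] := shift_derive f (c *: delta_mx 0 j0)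
       (x + t *: delta_mx 0 i0) (delta_mx 0 i0).
    rewrite /pder -s2; apply: derivable_subr.
      apply/s1; rewrite -addrA; apply: (dH _ _).1.
      by rewrite (le_lt_trans _ cd)// small.
    apply: (dH _ _).1.
    have := @small t 0 tc; rewrite normr0 scale0r addr0 => /(_ (normr_ge0 _)).
    by move=> /le_lt_trans; apply.
  have [t tc Et] := line_MVT (fun t tc => (dF t tc).1).
  rewrite (dF t tc).2 in Et.
  have [s sc Es] := @line_MVT n (pder i0 f) (x + t *: delta_mx 0 i0)
    (delta_mx 0 j0) c (fun s sc => ltac:(rewrite -addrA; exact: ((dH _
    (le_lt_trans (small t s tc sc) cd)).2 i0 j0))).
  exists (t *: delta_mx 0 i0 + s *: delta_mx 0 j0); first exact: small.
  by rewrite -/(F (x + c *: delta_mx 0 i0)) -/(F x) Et Es addrA mulrA.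
apply/eqP; rewrite -subr_eq0 -normr_le0; apply/ler_addgt0Pl => e e0; rewrite addr0.
have e20 : 0 < e / 2 by rewrite divr_gt0.
have := near_and (near_and df ddf) (near_and
  (cont_dist e20 (cf i j)) (cont_dist e20 (cf j i))).
move=> /nbhs_rVP[d d0 dH].
have c0 : 0 < d / 4 by rewrite divr_gt0.
have cd : d / 4 + d / 4 < d by lra.
have [h hc Eh] := key i j d d0 (fun h hd => (dH h hd).1) _ c0 cd.
have [k kc Ek] := key j i d d0 (fun h hd => (dH h hd).1) _ c0 cd.
have xE : x + (d / 4) *: delta_mx 0 j + (d / 4) *: delta_mx 0 i =
  x + (d / 4) *: delta_mx 0 i + (d / 4) *: delta_mx 0 j by exact: addrAC.
have := (dH h (le_lt_trans hc cd)).2.2; have := (dH k (le_lt_trans kc cd)).2.1.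
rewrite xE in Ek; move: Eh Ek => {key xE dH df ddf cf hc kc}.
move: (f _) (f _) (f _) (f _) (pder _ _ _) (pder _ _ _) (pder _ _ _) (pder _ _ _).
move=> {f h k x} f1 f2 f3 f4 u v w w' Eh Ek h1 h2.
have vu : w' = w.
  have cc : (d / 4) * (d / 4) != 0 by rewrite mulf_neq0 // gt_eqF.
  apply: (mulfI cc); rewrite -Eh -Ek; lra.
rewrite (le_trans (ler_distD w v u))// [`|w - u|]distrC -vu.
by move: h1 h2; rewrite -vu; lra.
Qed.

(** Indexing by the order rather than by words of derivatives provides the induction for the Leibniz
    and chain rules: one derivative is spent, and the factors are reused at the lower order. *)
Fixpoint Ck (k : nat) n (U : set 'rV[R]_n) (f : 'rV[R]_n -> R) : Prop :=
  (forall y, U y -> {for y, continuous f}) /\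
  if k is k'.+1 then
    forall i, (forall y, U y -> derivable f y (delta_mx 0 i)) /\
              Ck k' U (pder i f)
  else True.

Section Ck.
Context {n : nat} (U : set 'rV[R]_n) (oU : open U).

Lemma near_open y (P : 'rV[R]_n -> Prop) :
  U y -> (forall z, U z -> P z) -> \forall z \near y, P z.
Proof. by move=> Uy PU; apply: filterS PU _; exact: open_nbhs_nbhs. Qed.

Lemma Ck_eq k f g : (forall y, U y -> f y = g y) -> Ck k U f -> Ck k U g.
Proof.
have cg (h h' : 'rV[R]_n -> R) y : (forall y, U y -> h y = h' y) -> U y ->
    {for y, continuous h} -> {for y, continuous h'}.
  by move=> hh' Uy; apply: cont_eq; exact: near_open.
elim: k f g => [|k IH] f g fg [cf df].
  by split=> // y Uy; apply: cg fg Uy (cf _ Uy).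
split=> [y Uy|]; first exact: cg fg Uy (cf _ Uy).
move=> i; have [d1 d2] := df i; split=> [y Uy|].
  by apply: near_eq_derivable (d1 _ Uy); exact: near_open.
by apply: IH d2 => y Uy; apply: near_eq_derive; exact: near_open.
Qed.

Lemma CkW k f : Ck k.+1 U f -> Ck k U f.
Proof.
elim: k f => [|k IH] f [cf df]; first by split.
by split=> // i; have [d1 /IH] := df i.
Qed.

Lemma Ck_cst k c : Ck k U (fun=> c).
Proof.
elim: k c => [|k IH] c.
  by split=> // y _; exact: cont_cst.
split=> [y _|i]; first exact: cont_cst.
split=> [y _|]; first exact: derivable_cst.
by rewrite /pder; under eq_fun do rewrite derive_cst; exact: IH.
Qed.

Lemma CkD k f g : Ck k U f -> Ck k U g -> Ck k U (fun x => f x + g x).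
Proof.
elim: k f g => [|k IH] f g [cf df] [cg dg].
  by split=> // y Uy; apply: contD; [exact: cf|exact: cg].
split=> [y Uy|]; first by apply: contD; [exact: cf|exact: cg].
move=> i; have [f1 f2] := df i; have [g1 g2] := dg i; split=> [y Uy|].
  by apply: derivableD; [exact: f1|exact: g1].
apply: (Ck_eq _ (IH _ _ f2 g2)) => y Uy.
by rewrite /pder deriveD //; [exact: f1|exact: g1].
Qed.

Lemma CkM k f g : Ck k U f -> Ck k U g -> Ck k U (fun x => f x * g x).
Proof.
elim: k f g => [|k IH] f g Cf Cg; have [cf df] := Cf; have [cg dg] := Cg.
  by split=> // y Uy; apply: contM; [exact: cf|exact: cg].
split=> [y Uy|]; first by apply: contM; [exact: cf|exact: cg].
move=> i; have [f1 f2] := df i; have [g1 g2] := dg i; split=> [y Uy|].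
  by apply: derivableM; [exact: f1|exact: g1].
apply: (Ck_eq _ (CkD (IH _ _ (CkW Cf) g2) (IH _ _ (CkW Cg) f2))) => y Uy.
by rewrite /pder deriveM //; [exact: f1|exact: g1].
Qed.

Lemma CkV k f : (forall y, U y -> f y != 0) ->
  Ck k U f -> Ck k U (fun x => (f x)^-1).
Proof.
move=> f0; elim: k => [|k IH] Cf; have [cf df] := Cf.
  by split=> // y Uy; apply: contV; [exact: f0|exact: cf].
split=> [y Uy|]; first by apply: contV; [exact: f0|exact: cf].
move=> i; have [f1 f2] := df i; split=> [y Uy|].
  by apply: derivableV; [exact: f0|exact: f1].
have CV := IH (CkW Cf).
apply: (Ck_eq _ (CkM (CkM (CkM (Ck_cst _ (-1)) CV) CV) f2)) => y Uy.
rewrite /pder deriveV //; [|exact: f0|exact: f1].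
by rewrite -exprVn expr2 !mulN1r -mulNr.
Qed.

Lemma Ck_sum k (I : Type) (r : seq I) (f : I -> 'rV[R]_n -> R) :
  (forall i, Ck k U (f i)) -> Ck k U (fun x => \sum_(i <- r) f i x).
Proof.
move=> Cf; elim: r => [|i r IH].
  by apply: (Ck_eq _ (Ck_cst _ 0)) => y _; rewrite big_nil.
by apply: (Ck_eq _ (CkD (Cf i) IH)) => y _; rewrite big_cons.
Qed.

Lemma Ck_coord k j : Ck k U (fun x => x 0 j).
Proof.
case: k => [|k].
  by split=> // y _; exact: coord_continuous.
split=> [y _|i]; first exact: coord_continuous.
split=> [y _|]; first by apply: diff_derivable; exact: differentiable_coord.
apply: (Ck_eq _ (Ck_cst _ ((delta_mx 0 i : 'rV[R]_n) 0 j))) => y _.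
have D : derivable (@id 'rV[R]_n) y (delta_mx 0 i) by exact: derivable_id.
have := derive_mx D; rewrite derive_id => E.
by rewrite {1}E mxE.
Qed.

Lemma Ck1_differentiable f y : Ck 1 U f -> U y -> differentiable f y.
Proof.
move=> [cf df] Uy; apply: C1_differentiable => i; have [d1 [d2 _]] := df i.
by split; [exact: near_open|exact: d2].
Qed.

End Ck.

Lemma CkS n (U : set 'rV[R]_n) k l f : (k <= l)%N -> Ck l U f -> Ck k U f.
Proof.
move=> /subnK <-; elim: (l - k)%N => [|j IH] //; rewrite addSn => /CkW.
exact: IH.
Qed.

(** The definition controls all iterated derivatives at every nearby point, so one open set serves
    for all orders. The closure properties of [Ck] pass to germs through it. *)
Lemma smooth_germP n (f : 'rV[R]_n -> R) x :
  smooth_germ f x <-> exists U, [/\ open U, U x & forall k, Ck k U f].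
Proof.
split.
  move=> sf; pose P y := forall s : seq 'I_n, {for y, continuous (pders s f)} /\
    forall i : 'I_n, derivable (pders s f) y (delta_mx 0 i).
  have [U [oU Ux UP]] := @near_ex_open 'rV[R]_n x P sf.
  exists U; split=> // k.
  suff : forall s, Ck k U (pders s f) by move=> /(_ [::]).
  elim: k => [|k IH] s; first by split=> // y /UP /(_ s) [].
  split=> [y /UP /(_ s) [] //|i]; split=> [y /UP /(_ s)[_ /(_ i)] //|].
  exact: (IH (i :: s)).
move=> [U [oU Ux CU]]; apply: (near_open oU Ux) => y Uy s.
suff {y Uy} H : forall k, Ck k U (pders s f).
  have [_ D] := H 1; split; first by have [c _] := H 0; exact: c.
  by move=> i; have [d _] := D i; exact: d.
elim: s => [|i s IH] //= k.
by have [_ /(_ i) []] := IH k.+1.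
Qed.

Section SmoothGerm.
Context {n : nat}.
Implicit Types (f g : 'rV[R]_n -> R) (x : 'rV[R]_n).

Lemma sg_near f x : smooth_germ f x -> \forall y \near x, smooth_germ f y.
Proof. exact: near_join. Qed.

Lemma sg_eq f g x : (\forall y \near x, f y = g y) ->
  smooth_germ f x -> smooth_germ g x.
Proof.
move=> /near_ex_open[V [oV Vx VP]].
move=> /smooth_germP[U [oU Ux CU]].
apply/smooth_germP; exists (U `&` V); split; [exact: openI|by []|move=> k].
have oUV := openI oU oV.
apply: (Ck_eq oUV (f := f)) => [y [_ /VP] //|].
elim: k f CU {VP} => [|k IH] f CU.
  by have [c _] := CU 0; split=> // y [Uy _]; exact: c.
split=> [y [Uy _]|i]; first by have [c _] := CU 0; exact: c.
split=> [y [Uy _]|]; first by have [_ /(_ i)[d _]] := CU 1; exact: d.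
by apply: IH => l; have [_ /(_ i)[_]] := CU l.+1.
Qed.

Lemma sg_restr f (U : set 'rV[R]_n) x : open U -> U x ->
  (forall k, Ck k U f) -> smooth_germ f x.
Proof. by move=> oU Ux CU; apply/smooth_germP; exists U. Qed.

Lemma sg_common f x (V : set 'rV[R]_n) : open V -> V x -> smooth_germ f x ->
  exists U, [/\ open U, U x, U `<=` V & forall k, Ck k U f].
Proof.
move=> oV Vx /smooth_germP[U [oU Ux CU]]; exists (U `&` V).
split; [exact: openI|by []|exact: subIsetr|move=> k].
elim: k f CU => [|k IH] f CU.
  by have [c _] := CU 0; split=> // y [Uy _]; exact: c.
split=> [y [Uy _]|i]; first by have [c _] := CU 0; exact: c.
split=> [y [Uy _]|]; first by have [_ /(_ i)[d _]] := CU 1; exact: d.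
by apply: IH => l; have [_ /(_ i)[_]] := CU l.+1.
Qed.

Lemma CkI k (U V : set 'rV[R]_n) f : V `<=` U -> Ck k U f -> Ck k V f.
Proof.
move=> VU; elim: k f => [|k IH] f [cf df]; first by split=> // y /VU; exact: cf.
split=> [y /VU|i]; first exact: cf.
have [d1 d2] := df i; split=> [y /VU|]; [exact: d1|exact: IH].
Qed.

Lemma sg_cst c x : smooth_germ (fun=> c) x.
Proof. by apply: (@sg_restr _ setT) => // [|k]; [exact: openT|apply: Ck_cst; exact: openT]. Qed.

Lemma sg_coord j x : smooth_germ (fun y => y 0 j) x.
Proof. by apply: (@sg_restr _ setT) => // [|k]; [exact: openT|apply: Ck_coord; exact: openT]. Qed.

Lemma sgD f g x : smooth_germ f x -> smooth_germ g x ->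
  smooth_germ (fun y => f y + g y) x.
Proof.
move=> /smooth_germP[U [oU Ux CU]] /(sg_common oU Ux)[V [oV Vx VU CV]].
apply: (sg_restr oV Vx) => k; apply: CkD => //; exact: CkI (CU k).
Qed.

Lemma sgM f g x : smooth_germ f x -> smooth_germ g x ->
  smooth_germ (fun y => f y * g y) x.
Proof.
move=> /smooth_germP[U [oU Ux CU]] /(sg_common oU Ux)[V [oV Vx VU CV]].
apply: (sg_restr oV Vx) => k; apply: CkM => //; exact: CkI (CU k).
Qed.

Lemma sg_sum (I : Type) (r : seq I) (f : I -> 'rV[R]_n -> R) x :
  (forall i, smooth_germ (f i) x) ->
  smooth_germ (fun y => \sum_(i <- r) f i y) x.
Proof.
move=> sf; elim: r => [|i r IH].
  by under eq_fun do rewrite big_nil; exact: sg_cst.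
by under eq_fun do rewrite big_cons; exact: (sgD (sf i) IH).
Qed.

Lemma sg_prod (I : Type) (r : seq I) (f : I -> 'rV[R]_n -> R) x :
  (forall i, smooth_germ (f i) x) ->
  smooth_germ (fun y => \prod_(i <- r) f i y) x.
Proof.
move=> sf; elim: r => [|i r IH].
  by under eq_fun do rewrite big_nil; exact: sg_cst.
by under eq_fun do rewrite big_cons; exact: (sgM (sf i) IH).
Qed.

Lemma sgZ c f x : smooth_germ f x -> smooth_germ (fun y => c * f y) x.
Proof. by move=> sf; exact: (sgM (sg_cst c x) sf). Qed.

Lemma sgN f x : smooth_germ f x -> smooth_germ (fun y => - f y) x.
Proof. by move=> /(sgZ (-1)); under eq_fun do rewrite mulN1r. Qed.

Lemma sgB f g x : smooth_germ f x -> smooth_germ g x ->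
  smooth_germ (fun y => f y - g y) x.
Proof. by move=> sf /sgN sg; exact: (sgD sf sg). Qed.

Lemma sg_continuous f x : smooth_germ f x -> {for x, continuous f}.
Proof. by move=> /nbhs_singleton /(_ [::]) []. Qed.

Lemma sgV f x : f x != 0 -> smooth_germ f x -> smooth_germ (fun y => (f y)^-1) x.
Proof.
move=> f0 sf; have /near_ex_open[V [oV Vx VP]] : \forall y \near x, f y != 0.
  exact: (sg_continuous sf (open_nbhs_nbhs (conj (@open_neq R 0) f0))).
have [U [oU Ux UV CU]] := sg_common oV Vx sf.
apply: (sg_restr oU Ux) => k; apply: CkV => // y /UV /VP; exact.
Qed.

Lemma sg_pder f x i : smooth_germ f x -> smooth_germ (pder i f) x.
Proof.
move=> /smooth_germP[U [oU Ux CU]]; apply: (sg_restr oU Ux) => k.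
by have [_ /(_ i) []] := CU k.+1.
Qed.

Lemma sg_derivable f x i : smooth_germ f x -> derivable f x (delta_mx 0 i).
Proof. by move=> /nbhs_singleton /(_ [::]) []. Qed.

Lemma sg_differentiable f x : smooth_germ f x -> differentiable f x.
Proof.
move=> /smooth_germP[U [oU Ux CU]].
exact: (Ck1_differentiable oU (CU 1)).
Qed.

Lemma sg_schwarz f x i j : smooth_germ f x ->
  pder i (pder j f) x = pder j (pder i f) x.
Proof.
move=> sf; apply: schwarz.
- by apply: filterS (sg_near sf) => y sy k; exact: sg_derivable.
- by apply: filterS (sg_near sf) => y sy k l; exact/sg_derivable/sg_pder.
- by move=> k l; exact/sg_continuous/sg_pder/sg_pder.
Qed.

End SmoothGerm.
End Calculus.

(** * Matrix-valued smooth functions *)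
Section MatrixCalculus.
Context {R : realType}.

Lemma cont_mx (T : topologicalType) p q (F : T -> 'M[R]_(p, q)) x :
  (forall i j, {for x, continuous (fun y => F y i j)}) -> {for x, continuous F}.
Proof.
move=> cF; apply/cvgrPdist_lt => e e0.
have : \forall y \near x, forall ij : 'I_p * 'I_q,
    `|F x ij.1 ij.2 - F y ij.1 ij.2| < e.
  by apply: near_fin => -[i j]; apply: cont_dist e0 _; exact: cF.
apply: filterS => y H; rewrite /Num.Def.normr /= mx_normrE.
by apply: bigmax_lt => // -[i j] _; rewrite !mxE; exact: (H (i, j)).
Qed.

Lemma cont_entry (T : topologicalType) p q (F : T -> 'M[R]_(p, q)) x i j :
  {for x, continuous F} -> {for x, continuous (fun y => F y i j)}.
Proof.
by move=> cF; apply: (@continuous_comp _ _ _ F (fun M => M i j)) => //; exact: coord_continuous.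
Qed.

Lemma pder_comp n p (f : 'rV[R]_p -> R) (phi : 'rV[R]_n -> 'rV[R]_p) x i :
  differentiable f (phi x) -> (forall j, differentiable (fun v => phi v 0 j) x) ->
  differentiable (fun v => f (phi v)) x /\
  pder i (fun v => f (phi v)) x =
    \sum_j pder i (fun v => phi v 0 j) x * pder j f (phi x).
Proof.
move=> df dphi.
have E : phi = \sum_(j < p) (fun v => phi v 0 j *: (delta_mx 0 j : 'rV[R]_p)).
  by apply/funext => v; rewrite fct_sumE; exact: row_sum_delta.
have D : differentiable phi x.
  by rewrite E; apply: differentiable_sum => j; apply: differentiableZl; exact: dphi.
have Dc : differentiable (f \o phi) x by exact: differentiable_comp.
split=> //; rewrite /pder -[fun v => f (phi v)]/(f \o phi) deriveE //.
rewrite diff_comp //=.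
have -> : 'd phi x (delta_mx 0 i) = \row_j 'D_(delta_mx 0 i) (fun v => phi v 0 j) x.
  rewrite -(deriveE _ D) (derive_mx (diff_derivable D)).
  by apply/rowP => j; rewrite !mxE.
rewrite [X in 'd f _ X]row_sum_delta linear_sum; apply: eq_bigr => j _.
by rewrite mxE linearZ /= -(deriveE _ df).
Qed.

Lemma Ck_comp k n p (U : set 'rV[R]_n) (V : set 'rV[R]_p) f
    (phi : 'rV[R]_n -> 'rV[R]_p) : open U -> open V ->
  (forall y, U y -> V (phi y)) ->
  Ck k V f -> (forall j, Ck k U (fun v => phi v 0 j)) ->
  Ck k U (fun v => f (phi v)).
Proof.
move=> oU oV UV.
have cc g : (forall y, V y -> {for y, continuous g}) ->
    (forall j y, U y -> {for y, continuous (fun v => phi v 0 j)}) ->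
    forall y, U y -> {for y, continuous (fun v => g (phi v) : R)}.
  move=> cg cphi y Uy; apply: (@continuous_comp _ _ _ phi g).
    by apply: cont_mx => i j; rewrite ord1; exact: cphi.
  by apply: cg; exact: UV.
elim: k f => [|k IH] f Cf Cphi.
  by split=> //; apply: cc; [have [] := Cf|move=> j; have [] := Cphi j].
split; first by apply: cc; [have [] := Cf|move=> j; have [] := Cphi j].
have PC i y : U y -> differentiable (fun v => f (phi v)) y /\
    pder i (fun v => f (phi v)) y =
    \sum_j pder i (fun v => phi v 0 j) y * pder j f (phi y).
  move=> Uy; apply: pder_comp => [|j].
    by apply: (Ck1_differentiable oV (CkS _ Cf)) => //; exact: UV.
  exact: (Ck1_differentiable oU (CkS _ (Cphi j))).
move=> i; split=> [y Uy|]; first by apply: diff_derivable; exact: (PC i y Uy).1.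
apply: (Ck_eq oU (f := fun y =>
    \sum_j pder i (fun v => phi v 0 j) y * pder j f (phi y))).
  by move=> y Uy; rewrite (PC i y Uy).2.
apply: Ck_sum => // j; apply: CkM => //.
  by have [_ /(_ i) []] := Cphi j.
apply: IH; first by have [_ /(_ j) []] := Cf.
by move=> l; exact: CkW.
Qed.

(* A record rather than a definition, to keep unification from unfolding it. *)
Record smx n p q (F : 'rV[R]_n -> 'M[R]_(p, q)) (x : 'rV[R]_n) : Prop := Smx {
  smx_entry :> forall i j, smooth_germ (fun v => F v i j) x }.

Fact mder_key : unit. Proof. by []. Qed.

(* Locked: otherwise unification compares iterated derivatives by unfolding. *)
Definition mder n p q (i : 'I_n) (F : 'rV[R]_n -> 'M[R]_(p, q)) :
    'rV[R]_n -> 'M[R]_(p, q) :=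
  fun x => locked_with mder_key (\matrix_(a, b) pder i (fun v => F v a b) x).

Lemma mderE n p q (i : 'I_n) (F : 'rV[R]_n -> 'M[R]_(p, q)) x a b :
  mder i F x a b = pder i (fun v => F v a b) x.
Proof. by rewrite /mder unlock mxE. Qed.

Lemma smx_row n p (phi : 'rV[R]_n -> 'rV[R]_p) x :
  (forall j, smooth_germ (fun v => phi v 0 j) x) -> smx phi x.
Proof. by move=> H; split=> i j; rewrite ord1. Qed.

Lemma smx_continuous n p q (F : 'rV[R]_n -> 'M[R]_(p, q)) x :
  smx F x -> {for x, continuous F}.
Proof. by move=> sF; apply: cont_mx => i j; exact/sg_continuous/sF. Qed.

Lemma smx_near n p q (F : 'rV[R]_n -> 'M[R]_(p, q)) x :
  smx F x -> \forall y \near x, smx F y.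
Proof.
move=> sF; suff : \forall y \near x, forall i j, smooth_germ (fun v => F v i j) y.
  by apply: filterS => y; split.
apply: (near_fin (P := fun i y => forall j, _)) => i.
by apply: near_fin => j; exact/sg_near/sF.
Qed.

Lemma sg_comp n p f (phi : 'rV[R]_n -> 'rV[R]_p) x :
  smooth_germ f (phi x) -> smx phi x -> smooth_germ (fun v => f (phi v)) x.
Proof.
move=> /smooth_germP[V [oV Vx CV]] sphi.
have cphi : {for x, continuous phi}.
  by apply: cont_mx => i j; exact/sg_continuous/sphi.
have [W0 [oW0 W0x W0V]] := near_ex_open (cphi _ (open_nbhs_nbhs (conj oV Vx))).
have : forall j, exists U, [/\ open U, U x & forall k, Ck k U (fun v => phi v 0 j)].
  by move=> j; apply/smooth_germP; exact: sphi.
move=> /choice[U HU].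
have [W [oW Wx WU]] := near_ex_open (near_fin (fun j =>
  open_nbhs_nbhs (conj (let: And3 a _ _ := HU j in a) (let: And3 _ a _ := HU j in a)))).
apply: (sg_restr (U := W0 `&` W)) => [|//|k]; first exact: openI.
apply: (@Ck_comp k n p _ V) => //; first exact: openI.
  by move=> y [/W0V].
move=> j; have [_ _ /(_ k)] := HU j; apply: CkI => y [_ /WU]; exact.
Qed.

Lemma smx_diff n p (phi : 'rV[R]_n -> 'rV[R]_p) x :
  smx phi x -> differentiable phi x.
Proof.
move=> sphi.
have -> : phi = \sum_(j < p) (fun v => phi v 0 j *: (delta_mx 0 j : 'rV[R]_p)).
  by apply/funext => v; rewrite fct_sumE; exact: row_sum_delta.
apply: differentiable_sum => j; apply: differentiableZl.
exact/sg_differentiable/sphi.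
Qed.

Lemma jacobianE n p (phi : 'rV[R]_n -> 'rV[R]_p) x : smx phi x ->
  'J phi x = \matrix_(i, j) pder i (fun v => phi v 0 j) x.
Proof.
move=> /smx_diff D; apply/row_matrixP => i.
rewrite rowE -deriveEjacobian // (derive_mx (diff_derivable D)).
by apply/rowP => j; rewrite !mxE.
Qed.

Lemma pder_eq n (f g : 'rV[R]_n -> R) i x :
  (\forall y \near x, f y = g y) -> pder i f x = pder i g x.
Proof. by move=> fg; apply: near_eq_derive. Qed.

Section Mder.
Context {n : nat}.
Implicit Types x : 'rV[R]_n.

Lemma near_mx p q (F G : 'rV[R]_n -> 'M[R]_(p, q)) x a b :
  (\forall y \near x, F y = G y) -> \forall y \near x, F y a b = G y a b.
Proof. by apply: filterS => y ->. Qed.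

Lemma smx_eq p q (F G : 'rV[R]_n -> 'M[R]_(p, q)) x :
  (\forall y \near x, F y = G y) -> smx F x -> smx G x.
Proof. by move=> FG sF; split=> a b; apply: sg_eq (sF a b); exact: near_mx. Qed.

Lemma mder_eq p q (F G : 'rV[R]_n -> 'M[R]_(p, q)) i x :
  (\forall y \near x, F y = G y) -> mder i F x = mder i G x.
Proof. by move=> FG; apply/matrixP => a b; rewrite !(mxE, mderE); apply/pder_eq/near_mx. Qed.

Lemma smx_cst p q (M : 'M[R]_(p, q)) x : smx (fun=> M) x.
Proof. by split=> a b; exact: sg_cst. Qed.

Lemma pder_cst (c : R) i x : pder i (fun=> c) x = 0.
Proof. by rewrite /pder derive_cst. Qed.

Lemma mder_cst p q (M : 'M[R]_(p, q)) i x : mder i (fun=> M) x = 0.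
Proof. by apply/matrixP => a b; rewrite !(mxE, mderE) pder_cst. Qed.

Lemma smxD p q (F G : 'rV[R]_n -> 'M[R]_(p, q)) x :
  smx F x -> smx G x -> smx (fun v => F v + G v) x.
Proof.
move=> sF sG; split=> a b; under eq_fun do rewrite mxE.
exact: (sgD (sF a b) (sG a b)).
Qed.

Lemma pderD (f g : 'rV[R]_n -> R) i x : smooth_germ f x -> smooth_germ g x ->
  pder i (fun v => f v + g v) x = pder i f x + pder i g x.
Proof.
move=> /(sg_derivable (i := i)) df /(sg_derivable (i := i)) dg.
exact: (deriveD df dg).
Qed.

Lemma pderM (f g : 'rV[R]_n -> R) i x : smooth_germ f x -> smooth_germ g x ->
  pder i (fun v => f v * g v) x = pder i f x * g x + f x * pder i g x.
Proof.
move=> /(sg_derivable (i := i)) df /(sg_derivable (i := i)) dg.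
by rewrite {1}/pder (deriveM df dg) addrC; congr (_ + _); rewrite mulrC.
Qed.

Lemma pder_sum (I : Type) (r : seq I) (f : I -> 'rV[R]_n -> R) i x :
  (forall k, smooth_germ (f k) x) ->
  pder i (fun v => \sum_(k <- r) f k v) x = \sum_(k <- r) pder i (f k) x.
Proof.
move=> sf; elim: r => [|k r IH].
  by under eq_fun do rewrite big_nil; rewrite big_nil pder_cst.
under eq_fun do rewrite big_cons.
by rewrite big_cons (pderD _ (sf k) (sg_sum r sf)) IH.
Qed.

Lemma mderD p q (F G : 'rV[R]_n -> 'M[R]_(p, q)) i x : smx F x -> smx G x ->
  mder i (fun v => F v + G v) x = mder i F x + mder i G x.
Proof.
move=> sF sG; apply/matrixP => a b; rewrite !(mxE, mderE).
under eq_fun do rewrite mxE.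
exact: (pderD i (sF a b) (sG a b)).
Qed.

Lemma smx_scale p q (f : 'rV[R]_n -> R) (G : 'rV[R]_n -> 'M[R]_(p, q)) x :
  smooth_germ f x -> smx G x -> smx (fun v => f v *: G v) x.
Proof.
move=> sf sG; split=> a b; under eq_fun do rewrite mxE.
exact: (sgM sf (sG a b)).
Qed.

Lemma mder_scale p q (f : 'rV[R]_n -> R) (G : 'rV[R]_n -> 'M[R]_(p, q)) i x :
  smooth_germ f x -> smx G x ->
  mder i (fun v => f v *: G v) x = pder i f x *: G x + f x *: mder i G x.
Proof.
move=> sf sG; apply/matrixP => a b; rewrite !(mxE, mderE).
under eq_fun do rewrite mxE.
exact: (pderM i sf (sG a b)).
Qed.

Lemma smxZ p q c (G : 'rV[R]_n -> 'M[R]_(p, q)) x :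
  smx G x -> smx (fun v => c *: G v) x.
Proof. by apply: smx_scale; exact: sg_cst. Qed.

Lemma mderZ p q c (G : 'rV[R]_n -> 'M[R]_(p, q)) i x :
  smx G x -> mder i (fun v => c *: G v) x = c *: mder i G x.
Proof.
by move=> sG; rewrite (mder_scale i (sg_cst c x) sG) pder_cst scale0r add0r.
Qed.

Lemma smxN p q (G : 'rV[R]_n -> 'M[R]_(p, q)) x :
  smx G x -> smx (fun v => - G v) x.
Proof. by move=> /(smxZ (-1)); under eq_fun do rewrite scaleN1r. Qed.

Lemma mderN p q (G : 'rV[R]_n -> 'M[R]_(p, q)) i x :
  smx G x -> mder i (fun v => - G v) x = - mder i G x.
Proof.
move=> sG; apply/matrixP => a b; rewrite mderE [RHS]mxE mderE.
under eq_fun do rewrite mxE.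
have E := deriveN (sg_derivable (i := i) (sG a b)).
by rewrite /pder -E.
Qed.

Lemma smxB p q (F G : 'rV[R]_n -> 'M[R]_(p, q)) x :
  smx F x -> smx G x -> smx (fun v => F v - G v) x.
Proof. by move=> sF /smxN sG; exact: smxD sF sG. Qed.

Lemma mderB p q (F G : 'rV[R]_n -> 'M[R]_(p, q)) i x : smx F x -> smx G x ->
  mder i (fun v => F v - G v) x = mder i F x - mder i G x.
Proof. by move=> sF sG; rewrite (mderD i sF (smxN sG)) mderN. Qed.

Lemma smxM p q r (F : 'rV[R]_n -> 'M[R]_(p, q)) (G : 'rV[R]_n -> 'M[R]_(q, r)) x :
  smx F x -> smx G x -> smx (fun v => F v *m G v) x.
Proof.
move=> sF sG; split=> a b; under eq_fun do rewrite mxE.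
apply: sg_sum => k; exact: (sgM (sF a k) (sG k b)).
Qed.

Lemma mderM p q r (F : 'rV[R]_n -> 'M[R]_(p, q)) (G : 'rV[R]_n -> 'M[R]_(q, r)) i x :
  smx F x -> smx G x ->
  mder i (fun v => F v *m G v) x = mder i F x *m G x + F x *m mder i G x.
Proof.
move=> sF sG; apply/matrixP => a b; rewrite !(mxE, mderE).
under eq_fun do rewrite mxE.
rewrite pder_sum; last by move=> k; exact: (sgM (sF a k) (sG k b)).
rewrite -big_split /=; apply: eq_bigr => k _; rewrite !mderE.
exact: (pderM i (sF a k) (sG k b)).
Qed.

Lemma smx_tr p q (F : 'rV[R]_n -> 'M[R]_(p, q)) x :
  smx F x -> smx (fun v => (F v)^T) x.
Proof. by move=> sF; split=> a b; under eq_fun do rewrite mxE; exact: sF. Qed.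

Lemma mder_tr p q (F : 'rV[R]_n -> 'M[R]_(p, q)) i x :
  mder i (fun v => (F v)^T) x = (mder i F x)^T.
Proof. by apply/matrixP => a b; rewrite !(mxE, mderE); under eq_fun do rewrite mxE. Qed.

Lemma smx_sum (I : Type) (r : seq I) p q (F : I -> 'rV[R]_n -> 'M[R]_(p, q)) x :
  (forall k, smx (F k) x) -> smx (fun v => \sum_(k <- r) F k v) x.
Proof.
move=> sF; split=> a b; under eq_fun do rewrite summxE.
by apply: sg_sum => k; exact: sF.
Qed.

Lemma mder_sum (I : Type) (r : seq I) p q (F : I -> 'rV[R]_n -> 'M[R]_(p, q)) i x :
  (forall k, smx (F k) x) ->
  mder i (fun v => \sum_(k <- r) F k v) x = \sum_(k <- r) mder i (F k) x.
Proof.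
move=> sF; apply/matrixP => a b; rewrite !(mxE, mderE) summxE.
under eq_fun do rewrite summxE.
rewrite pder_sum; last by move=> k; exact: sF.
by apply: eq_bigr => k _; rewrite mderE.
Qed.

Lemma smx_mder p q (F : 'rV[R]_n -> 'M[R]_(p, q)) i x :
  smx F x -> smx (mder i F) x.
Proof. by move=> sF; split=> a b; under eq_fun do rewrite mderE; exact/sg_pder/sF. Qed.

Lemma mder_schwarz p q (F : 'rV[R]_n -> 'M[R]_(p, q)) i j x :
  smx F x -> mder i (mder j F) x = mder j (mder i F) x.
Proof.
move=> sF; apply/matrixP => a b; rewrite [LHS]mderE [RHS]mderE.
have E k : (fun v => mder k F v a b) = pder k (fun v => F v a b).
  by apply/funext => v; rewrite mderE.
rewrite (E i) (E j); exact: (sg_schwarz i j (sF a b)).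
Qed.

Lemma smx_block p1 p2 q1 q2 (F1 : 'rV[R]_n -> 'M[R]_(p1, q1))
   (F2 : 'rV[R]_n -> 'M[R]_(p1, q2)) (F3 : 'rV[R]_n -> 'M[R]_(p2, q1))
   (F4 : 'rV[R]_n -> 'M[R]_(p2, q2)) x :
  smx F1 x -> smx F2 x -> smx F3 x -> smx F4 x ->
  smx (fun v => block_mx (F1 v) (F2 v) (F3 v) (F4 v)) x.
Proof.
move=> s1 s2 s3 s4; split=> a b.
case: (split_ordP a) => a' ->; case: (split_ordP b) => b' ->;
  under eq_fun do rewrite ?(block_mxEul, block_mxEur, block_mxEdl, block_mxEdr);
  by [exact: s1|exact: s2|exact: s3|exact: s4].
Qed.

Lemma mder_block p1 p2 q1 q2 (F1 : 'rV[R]_n -> 'M[R]_(p1, q1))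
   (F2 : 'rV[R]_n -> 'M[R]_(p1, q2)) (F3 : 'rV[R]_n -> 'M[R]_(p2, q1))
   (F4 : 'rV[R]_n -> 'M[R]_(p2, q2)) i x :
  mder i (fun v => block_mx (F1 v) (F2 v) (F3 v) (F4 v)) x =
  block_mx (mder i F1 x) (mder i F2 x) (mder i F3 x) (mder i F4 x).
Proof.
apply/matrixP => a b; rewrite mderE.
case: (split_ordP a) => a' ->; case: (split_ordP b) => b' ->;
  under eq_fun do rewrite ?(block_mxEul, block_mxEur, block_mxEdl, block_mxEdr);
  by rewrite ?(block_mxEul, block_mxEur, block_mxEdl, block_mxEdr) mderE.
Qed.

Lemma smx_row_mx p q1 q2 (F1 : 'rV[R]_n -> 'M[R]_(p, q1))
   (F2 : 'rV[R]_n -> 'M[R]_(p, q2)) x :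
  smx F1 x -> smx F2 x -> smx (fun v => row_mx (F1 v) (F2 v)) x.
Proof.
move=> s1 s2; split=> a b; case: (split_ordP b) => b' ->;
  under eq_fun do rewrite ?(row_mxEl, row_mxEr); by [exact: s1|exact: s2].
Qed.

Lemma smx_id x : smx id x.
Proof. by split=> i j; rewrite ord1; exact: sg_coord. Qed.

Lemma smx_linear p q (L : {linear 'rV[R]_n -> 'M[R]_(p, q)}) x : smx L x.
Proof.
split=> a b; pose c j := L (delta_mx 0 j) a b.
have -> : (fun v : 'rV[R]_n => L v a b) = fun v => \sum_j c j * v 0 j.
  apply/funext => v; rewrite {1}[v]row_sum_delta linear_sum summxE.
  by apply: eq_bigr => j _; rewrite linearZ mxE mulrC.
by apply: sg_sum => j; apply: sgZ; exact: sg_coord.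
Qed.

Lemma jacobian_linear p (L : {linear 'rV[R]_n -> 'rV[R]_p}) x :
  'J L x = lin1_mx L.
Proof.
have D : differentiable L x by exact/smx_diff/smx_linear.
apply/row_matrixP => i; rewrite !rowE -(deriveEjacobian _ D) mul_rV_lin1.
rewrite /derive; apply: cvg_lim => //.
apply: cvg_near_cst; near=> h.
have h0 : h != 0 by near: h; exact: nbhs_dnbhs_neq.
have -> : (L \o shift x) (h *: delta_mx 0 i) = h *: L (delta_mx 0 i) + L x.
  by rewrite /= linearD linearZ.
by rewrite addrK scalerA mulVf // scale1r.
Unshelve. all: by end_near.
Qed.

Lemma smx_det p (F : 'rV[R]_n -> 'M[R]_p) x : smx F x ->
  smooth_germ (fun v => \det (F v)) x.
Proof.
move=> sF; apply: sg_sum => s; apply: sgZ; apply: sg_prod => i; exact: sF.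
Qed.

Lemma unitmx_near (T : topologicalType) p (F : T -> 'M[R]_p) (x : T) :
  {for x, continuous (fun v => \det (F v))} -> F x \in unitmx ->
  \forall y \near x, F y \in unitmx.
Proof.
rewrite unitmxE unitfE => c u.
have := c _ (open_nbhs_nbhs (conj (@open_neq R 0) u)).
by move=> H; near=> y; rewrite unitmxE unitfE; near: y; exact: H.
Unshelve. all: by end_near.
Qed.

Lemma smx_unit_near p (F : 'rV[R]_n -> 'M[R]_p) x : smx F x -> F x \in unitmx ->
  \forall y \near x, F y \in unitmx.
Proof. by move=> sF; apply: unitmx_near; exact/sg_continuous/smx_det. Qed.

Lemma smx_inv p (F : 'rV[R]_n -> 'M[R]_p) x : smx F x -> F x \in unitmx ->
  smx (fun v => invmx (F v)) x.
Proof.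
move=> sF uF.
apply: (@smx_eq _ _ (fun v => (\det (F v))^-1 *: \adj (F v))).
  by apply: filterS (smx_unit_near sF uF) => y uy; rewrite /invmx uy.
apply: smx_scale.
  by apply: sgV (smx_det sF); rewrite -unitfE -unitmxE.
split=> a b; under eq_fun do rewrite mxE; rewrite /cofactor.
apply: sgZ; apply: smx_det; split=> c d.
by under eq_fun do rewrite !mxE; exact: sF.
Qed.

End Mder.

Section Comp.
Context {n p : nat} (phi : 'rV[R]_n -> 'rV[R]_p) (x : 'rV[R]_n).
Hypothesis sphi : smx phi x.

Lemma smx_comp a b (F : 'rV[R]_p -> 'M[R]_(a, b)) :
  smx F (phi x) -> smx (fun v => F (phi v)) x.
Proof. by move=> sF; split=> i j; exact: sg_comp (sF i j) sphi. Qed.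

Lemma smx_J : smx (jacobian phi) x.
Proof.
apply: (@smx_eq n _ _ (fun y => \matrix_(i, j) pder i (fun v => phi v 0 j) y)).
  by apply: filterS (smx_near sphi) => y sy; rewrite jacobianE.
by split=> i j; under eq_fun do rewrite mxE; exact/sg_pder/sphi.
Qed.

Lemma mder_comp a b (F : 'rV[R]_p -> 'M[R]_(a, b)) i : smx F (phi x) ->
  mder i (fun v => F (phi v)) x = \sum_k 'J phi x i k *: mder k F (phi x).
Proof.
move=> sF; apply/matrixP => c d; rewrite mderE summxE jacobianE //.
rewrite (pder_comp i (sg_differentiable (sF c d))
  (fun j => sg_differentiable (sphi 0 j))).2.
by apply: eq_bigr => k _; rewrite !(mxE, mderE).
Qed.

Lemma jacobian_comp q (psi : 'rV[R]_p -> 'rV[R]_q) : smx psi (phi x) ->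
  'J (fun v => psi (phi v)) x = 'J phi x *m 'J psi (phi x).
Proof.
move=> spsi; rewrite (jacobianE (smx_comp spsi)) !jacobianE //.
apply/matrixP => i j; rewrite !mxE.
rewrite (pder_comp i (sg_differentiable (spsi 0 j))
  (fun j => sg_differentiable (sphi 0 j))).2.
by apply: eq_bigr => k _; rewrite !mxE.
Qed.

(** Schwarz for a map. This symmetry removes the second derivatives of a coordinate change from
    torsion, curvature and exterior derivative. *)
Lemma mder_jacobian_sym i k j :
  mder i (jacobian phi) x k j = mder k (jacobian phi) x i j.
Proof.
have E l m : mder l (jacobian phi) x m j =
    pder l (pder m (fun v => phi v 0 j)) x.
  rewrite mderE; apply: pder_eq; apply: filterS (smx_near sphi) => y sy.
  by rewrite jacobianE // mxE.
exact: (etrans (E i k) (etrans (sg_schwarz i k (sphi 0 j)) (esym (E k i)))).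
Qed.

End Comp.

Lemma jacobian_eq n p (f g : 'rV[R]_n -> 'rV[R]_p) x :
  (\forall y \near x, f y = g y) -> smx f x -> 'J f x = 'J g x.
Proof.
move=> fg sf; rewrite (jacobianE sf) (jacobianE (smx_eq fg sf)).
by apply/matrixP => i j; rewrite !mxE; apply/pder_eq/near_mx.
Qed.

End MatrixCalculus.

(** * Moving frames and naturality of the curvature *)
Section Riemann.
Context {R : realType}.

Fact riemann_key : unit. Proof. by []. Qed.

(** Curvature of a connection in a frame: row [k] of [O i] holds the components of the derivative of
    the [k]-th frame vector in direction [i]. Since matrices act on rows, the quadratic terms appear
    in the reverse of the usual order. *)
Definition curv n p (O : 'I_n -> 'rV[R]_n -> 'M[R]_p) (i j : 'I_n) (x : 'rV[R]_n) :
    'M[R]_p := locked_with riemann_key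
  (mder i (O j) x - mder j (O i) x + O j x *m O i x - O i x *m O j x).

Lemma curvE n p (O : 'I_n -> 'rV[R]_n -> 'M[R]_p) i j x : curv O i j x =
  mder i (O j) x - mder j (O i) x + O j x *m O i x - O i x *m O j x.
Proof. by rewrite /curv unlock. Qed.

(** Differentiate the intertwining relation once more and antisymmetrize: the second derivatives of
    [Psi] cancel by Schwarz, and its first derivatives are eliminated by the relation itself. *)
Lemma gauge_curv n p q (T : 'I_n -> 'rV[R]_n -> 'M[R]_p)
    (O : 'I_n -> 'rV[R]_n -> 'M[R]_q) (Psi : 'rV[R]_n -> 'M[R]_(p, q)) x i j :
  (forall k, smx (T k) x) -> (forall k, smx (O k) x) -> smx Psi x ->
  (forall k, \forall y \near x,
     T k y *m Psi y = mder k Psi y + Psi y *m O k y) ->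
  curv T i j x *m Psi x = Psi x *m curv O i j x.
Proof.
move=> sT sO sP E.
have D a b : mder a (T b) x *m Psi x + T b x *m mder a Psi x =
    mder a (mder b Psi) x + (mder a Psi x *m O b x + Psi x *m mder a (O b) x).
  rewrite -(mderM a (sT b) sP) -(mderM a sP (sO b)).
  rewrite -(mderD a (smx_mder _ sP) (smxM sP (sO b))).
  exact: mder_eq.
have dP a : mder a Psi x = T a x *m Psi x - Psi x *m O a x.
  by rewrite (nbhs_singleton (E a)) addrK.
have := congr2 (fun u v => u - v) (D i j) (D j i).
rewrite (mder_schwarz i j sP) !dP !curvE !(mulmxDl, mulmxDr, mulmxN, mulNmx) !mulmxA.
set t1 := mder i (T j) x *m _; set t2 := mder j (T i) x *m _.
set t3 := mder j (mder i _) x; set t4 := Psi x *m mder i (O j) x.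
set t5 := Psi x *m mder j (O i) x.
set a1 := T j x *m T i x *m _; set a2 := T i x *m T j x *m _.
set a3 := T j x *m Psi x *m _; set a4 := T i x *m Psi x *m _.
set a5 := Psi x *m O i x *m _; set a6 := Psi x *m O j x *m _.
move=> /eqP; rewrite -subr_eq0 => /eqP H; apply/eqP; rewrite -subr_eq0; apply/eqP.
rewrite -[RHS]H; apply/matrixP => a b; rewrite !mxE; ring.
Qed.

(** The terms with second derivatives of [psi] are symmetric in [i] and [j] and drop out. *)
Lemma curv_pullback n p q (Gam : 'I_p -> 'rV[R]_p -> 'M[R]_q)
    (psi : 'rV[R]_n -> 'rV[R]_p) x i j :
  smx psi x -> (forall a, smx (Gam a) (psi x)) ->
  let J := 'J psi x in
  curv (fun k y => \sum_a 'J psi y k a *: Gam a (psi y)) i j x =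
  \sum_a \sum_b (J i a * J j b) *: curv Gam a b (psi x).
Proof.
move=> sp sG J.
have sGp b : smx (fun y => Gam b (psi y)) x by exact: smx_comp.
have sJ : smx (jacobian psi) x by exact: smx_J.
have M k l : mder k (fun y => \sum_a 'J psi y l a *: Gam a (psi y)) x =
    \sum_b (mder k (jacobian psi) x l b *: Gam b (psi x)) +
    \sum_a \sum_b (J k a * J l b) *: mder a (Gam b) (psi x).
  rewrite mder_sum; last by move=> b; apply: smx_scale; [exact: sJ|exact: sGp].
  rewrite exchange_big /= -big_split; apply: eq_bigr => b _ /=.
  rewrite (mder_scale k (sJ l b) (sGp b)) (mder_comp sp k (sG b)) scaler_sumr.
  rewrite -mderE; congr (_ + _); apply: eq_bigr => a _.
  by rewrite scalerA mulrC.
rewrite !curvE !M (eq_bigr (fun b => mder j (jacobian psi) x i b *: Gam b (psi x))); last first.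
  by move=> b _; congr (_ *: _); exact: mder_jacobian_sym.
rewrite [X in _ - (_ + X)]exchange_big /=.
have P (u v : 'I_n) : (\sum_a J u a *: Gam a (psi x)) *m (\sum_b J v b *: Gam b (psi x)) =
    \sum_a \sum_b (J u a * J v b) *: (Gam a (psi x) *m Gam b (psi x)).
  rewrite mulmx_suml; apply: eq_bigr => a _; rewrite mulmx_sumr; apply: eq_bigr => b _.
  by rewrite -scalemxAl -scalemxAr scalerA.
rewrite opprD addrACA subrr add0r [_ *m (\sum_a 'J psi x i a *: _)]P.
rewrite [(\sum_a 'J psi x i a *: _) *m _]P [X in _ + X - _]exchange_big /=.
rewrite -sumrB -big_split -sumrB; apply: eq_bigr => a _ /=.
rewrite -sumrB -big_split -sumrB; apply: eq_bigr => b _ /=.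
by rewrite curvE !(scalerDr, scalerN) [J j b * J i a]mulrC.
Qed.

(** Vanishing torsion and metric compatibility, required at the single point [x], so that a
    candidate can be compared with the Christoffel symbols point by point. *)
Definition levi_civita n (O : 'I_n -> 'M[R]_n) (G : 'rV[R]_n -> 'M[R]_n) x :=
  (forall i k, row k (O i) = row i (O k)) /\
  (forall i, mder i G x = O i *m G x + (O i *m G x)^T).

(** With an index lowered by [G], the difference of the two connections is symmetric in its first
    two indices and antisymmetric in its last two; passing through the permutations of the indices
    makes it equal to its own negative. *)
Lemma levi_civita_unique n (O O' : 'I_n -> 'M[R]_n) G x : G x \in unitmx ->
  levi_civita O G x -> levi_civita O' G x -> O =1 O'.
Proof.
move=> uG [t m] [t' m'] i.
pose D i k l := (O i *m G x) k l - (O' i *m G x) k l.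
have Dt a b c : D a b c = D b a c.
  have r (Q : 'I_n -> 'M[R]_n) : (forall i k, row k (Q i) = row i (Q k)) ->
      (Q a *m G x) b c = (Q b *m G x) a c.
    move=> /(_ a b) /(congr1 (fun r => (r *m G x) 0 c)).
    by rewrite -!row_mul !mxE.
  by rewrite /D !(r _ t) !(r _ t').
have Dm a b c : D a b c = - D a c b.
  have := m' a; rewrite m /D => /matrixP/(_ b c).
  by rewrite [LHS]mxE [RHS]mxE [X in _ + X]mxE [X in _ = _ + X]mxE; lra.
have D0 a b c : D a b c = 0.
  have := Dt a b c; have := Dm b a c; have := Dt b c a; have := Dm c b a.
  have := Dt c a b; have := Dm a c b; lra.
apply: (can_inj (mulmxK uG)); apply/matrixP => k l.
by have /eqP := D0 i k l; rewrite subr_eq0 => /eqP.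
Qed.

Definition Chr n (G : 'rV[R]_n -> 'M[R]_n) (i : 'I_n) (x : 'rV[R]_n) : 'M[R]_n :=
  locked_with riemann_key (\matrix_(k, l) christoffel G l i k x).

Lemma ChrE n (G : 'rV[R]_n -> 'M[R]_n) i x k l : Chr G i x k l = christoffel G l i k x.
Proof. by rewrite /Chr unlock mxE. Qed.

Lemma christoffelE n (G : 'rV[R]_n -> 'M[R]_n) k i j x : christoffel G k i j x =
  2^-1 * \sum_l invmx (G x) k l *
    (pder i (fun y => G y j l) x + pder j (fun y => G y i l) x
     - pder l (fun y => G y i j) x).
Proof. by []. Qed.

Lemma curv_entry n p (O : 'I_n -> 'rV[R]_n -> 'M[R]_p) i j x k l :
  curv O i j x k l = pder i (fun v => O j v k l) x - pder j (fun v => O i v k l) x +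
    \sum_h (O j x k h * O i x h l - O i x k h * O j x h l).
Proof.
have E (A B C D : 'M[R]_p) :
    (A - B + C *m D - D *m C) k l = A k l - B k l + \sum_h (C k h * D h l - D k h * C h l).
  by rewrite sumrB addrA !mxE.
by rewrite curvE E 2!mderE.
Qed.

Lemma riemannE n (G : 'rV[R]_n -> 'M[R]_n) l i j k x :
  riemann G l i j k x = curv (Chr G) i j x k l.
Proof.
rewrite /riemann curv_entry.
have E i' : (fun v => Chr G i' v k l) = christoffel G l i' k.
  by apply/funext => v; rewrite ChrE.
rewrite (E i) (E j); congr (_ + _); apply: eq_bigr => h _.
by rewrite !ChrE [X in X - _]mulrC [X in _ - X]mulrC.
Qed.

Lemma Chr_levi_civita n (G : 'rV[R]_n -> 'M[R]_n) x :
  (\forall y \near x, (G y)^T = G y) -> G x \in unitmx ->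
  levi_civita (Chr G ^~ x) G x.
Proof.
move=> sym uG.
have ps i a b : pder i (fun v => G v a b) x = pder i (fun v => G v b a) x.
  by apply: pder_eq; apply: filterS sym => y {2}<-; rewrite mxE.
have Isym : (invmx (G x))^T = invmx (G x).
  by rewrite trmx_inv (nbhs_singleton sym).
have S m l : \sum_h invmx (G x) h m * G x h l = (m == l)%:R.
  have /matrixP/(_ m l) := mulVmx uG; rewrite mxE [in RHS]mxE => <-.
  by apply: eq_bigr => h _; rewrite -{1}Isym mxE.
(* Lowering the upper index cancels the inverse matrix and leaves the Koszul formula, from which
   compatibility is read off. *)
have CG i k l : (Chr G i x *m G x) k l = 2^-1 * (pder i (fun v => G v k l) x +
    pder k (fun v => G v i l) x - pder l (fun v => G v i k) x).
  rewrite mxE; under eq_bigr do rewrite ChrE christoffelE -mulrA mulr_suml.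
  rewrite -mulr_sumr exchange_big /=; congr (_ * _).
  rewrite (bigD1 l) //= [X in _ + X]big1 ?addr0 => [|m ml].
    under eq_bigr do rewrite mulrAC.
    by rewrite -mulr_suml S eqxx mul1r.
  under eq_bigr do rewrite mulrAC.
  by rewrite -mulr_suml S (negbTE ml) mul0r.
split=> [i k|i].
  apply/rowP => l; rewrite !mxE !ChrE !christoffelE; congr (_ * _); apply: eq_bigr => h _.
  by rewrite (ps h i k); congr (_ * (_ - _)); rewrite addrC.
apply/matrixP => a b; rewrite mderE [RHS]mxE [(_^T) _ _]mxE !CG.
by rewrite (ps i b a) (ps b i a) (ps a i b); lra.
Qed.

Lemma Chr_smooth n (G : 'rV[R]_n -> 'M[R]_n) x i :
  smx G x -> G x \in unitmx -> smx (Chr G i) x.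
Proof.
move=> sG uG; split=> k l; under eq_fun do rewrite ChrE christoffelE.
apply: sgZ; apply: sg_sum => h.
apply: sgM; first exact: (smx_inv sG uG).
by apply: sgB; first apply: sgD; exact: sg_pder (sG _ _).
Qed.

Section Frame.
Context {n : nat} (G hh Psi : 'rV[R]_n -> 'M[R]_n)
  (O : 'I_n -> 'rV[R]_n -> 'M[R]_n) (x : 'rV[R]_n).
Hypotheses (sPsi : smx Psi x) (shh : smx hh x) (sO : forall k, smx (O k) x).
Hypothesis uPsi : Psi x \in unitmx.
Hypothesis hh_sym : \forall y \near x, (hh y)^T = hh y.
Hypothesis uhh : hh x \in unitmx.
Hypothesis GE : \forall y \near x, G y = Psi y *m hh y *m (Psi y)^T.
Hypothesis O_metric : \forall y \near x, forall i,
  mder i hh y = O i y *m hh y + (O i y *m hh y)^T.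
Hypothesis O_torsion : \forall y \near x, forall i k,
  row k (mder i Psi y + Psi y *m O i y) = row i (mder k Psi y + Psi y *m O k y).

(** [Psi] expresses the coordinate vectors through a moving frame with Gram matrix [hh], and [O] is
    a candidate connection in that frame. Carried over to coordinates by the gauge formula, it is
    torsion free and metric, so uniqueness identifies it with the Christoffel matrices without
    computing them. *)
Lemma frame_Chr : \forall y \near x, forall i,
  Chr G i y *m Psi y = mder i Psi y + Psi y *m O i y.
Proof.
have sPsi' := smx_near sPsi; have shh' := smx_near shh.
have uPsi' := smx_unit_near sPsi uPsi; have uhh' := smx_unit_near shh uhh.
have GE' := near_join GE; have hh_sym' := near_join hh_sym.
near=> y => i.
have GEy : \forall z \near y, G z = Psi z *m hh z *m (Psi z)^T.
  by near: y.
have hsy : \forall z \near y, (hh z)^T = hh z by near: y.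
have sPy : smx Psi y by near: y; exact: sPsi'.
have shy : smx hh y by near: y; exact: shh'.
have uPy : Psi y \in unitmx by near: y.
have uhy : hh y \in unitmx by near: y.
have Om i' : mder i' hh y = O i' y *m hh y + (O i' y *m hh y)^T.
  by move: i'; near: y.
have Ot i' k : row k (mder i' Psi y + Psi y *m O i' y) =
               row i' (mder k Psi y + Psi y *m O k y).
  by move: i' k; near: y.
have Gsym : \forall z \near y, (G z)^T = G z.
  apply: filterS2 GEy hsy => z -> hz.
  by rewrite !trmx_mul trmxK hz mulmxA.
have uG : G y \in unitmx.
  by rewrite (nbhs_singleton GEy) !unitmx_mul uPy uhy unitmx_tr.
pose T i := (mder i Psi y + Psi y *m O i y) *m invmx (Psi y).
have TP i' : T i' *m Psi y = mder i' Psi y + Psi y *m O i' y by rewrite mulmxKV.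
have LT : levi_civita T G y.
  split=> [i' k|i']; first by rewrite !row_mul Ot.
  have GT : T i' *m G y = (mder i' Psi y + Psi y *m O i' y) *m hh y *m (Psi y)^T.
    by rewrite (nbhs_singleton GEy) !mulmxA TP.
  rewrite GT (mder_eq _ GEy) (mderM i' (smxM sPy shy) (smx_tr sPy)).
  rewrite (mderM i' sPy shy) mder_tr Om.
  have := nbhs_singleton hsy; move: (hh y) (Psi y) (mder _ _ _) (O i' y) => h P D Oi hs.
  rewrite linearD /= !trmx_mul linearD /= !trmx_mul !hs !(mulmxDl, mulmxDr) !mulmxA -!addrA.
  by congr (_ + (_ + _)); rewrite trmxK addrC.
have := levi_civita_unique uG (Chr_levi_civita Gsym uG) LT i.
by move=> ->; exact: TP.
Unshelve. all: by end_near. Qed.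

Lemma frame_unit : G x \in unitmx.
Proof. by rewrite (nbhs_singleton GE) !unitmx_mul uPsi uhh unitmx_tr. Qed.

Lemma frame_smooth : smx G x.
Proof.
apply: (@smx_eq _ _ _ _ (fun y => Psi y *m hh y *m (Psi y)^T)).
  by apply: filterS GE.
exact: smxM (smxM sPsi shh) (smx_tr sPsi).
Qed.

Lemma frame_curv i j : curv (Chr G) i j x *m Psi x = Psi x *m curv O i j x.
Proof.
apply: (gauge_curv i j _ sO sPsi) => k.
  by apply: Chr_smooth; [exact: frame_smooth|exact: frame_unit].
by apply: filterS frame_Chr => y; apply.
Qed.

End Frame.

Section Naturality.
Context {n : nat} (G H : 'rV[R]_n -> 'M[R]_n) (psi : 'rV[R]_n -> 'rV[R]_n)
  (x : 'rV[R]_n).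
Hypotheses (spsi : smx psi x) (sG : smx G (psi x)).
Hypothesis Gsym : \forall y \near psi x, (G y)^T = G y.
Hypothesis uG : G (psi x) \in unitmx.
Hypothesis uJ : 'J psi x \in unitmx.
Hypothesis HE : \forall y \near x, H y = 'J psi y *m G (psi y) *m ('J psi y)^T.

Let J := 'J psi x.

(** A change of coordinates is treated as a moving frame: [Psi] is the Jacobian, [hh] the metric [G]
    along [psi], and [O] the pulled back Christoffel matrices. *)
Lemma natural_curv i j : curv (Chr H) i j x *m J =
  J *m \sum_a \sum_b (J i a * J j b) *: curv (Chr G) a b (psi x).
Proof.
have cpsi := smx_continuous spsi.
have Gsym' := near_join Gsym; have spsi' := smx_near spsi.
have sG' := smx_near sG; have uG' := smx_unit_near sG uG.
have pull (P : 'rV[R]_n -> Prop) : (\forall y \near psi x, P y) ->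
  \forall y \near x, P (psi y) by move=> HP; exact: cpsi.
rewrite -(curv_pullback i j spsi (fun a => Chr_smooth a sG uG)).
apply: (@frame_curv n H (fun y => G (psi y)) (jacobian psi)
  (fun k y => \sum_a 'J psi y k a *: Chr G a (psi y)) x
  (smx_J spsi) (smx_comp spsi sG) _ uJ (pull _ Gsym) uG HE).
- move=> k; apply: smx_sum => a; apply: smx_scale; first exact: smx_J.
  exact: (smx_comp spsi (Chr_smooth a sG uG)).
- near=> y => i'.
  have spy : smx psi y by near: y; exact: spsi'.
  have sGy : smx G (psi y) by near: y; exact: (pull _ sG').
  have LC : levi_civita (Chr G ^~ (psi y)) G (psi y).
    near: y; apply: (pull (fun z => levi_civita (Chr G ^~ z) G z)); near=> z; apply: Chr_levi_civita.
      by near: z.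
    by near: z.
  rewrite (mder_comp spy i' sGy) mulmx_suml raddf_sum -big_split /=.
  apply: eq_bigr => a _; rewrite -scalemxAl (LC.2 a).
  by rewrite linearZ scalerDr.
- near=> y => i' k.
  have spy : smx psi y by near: y; exact: spsi'.
  have LC : levi_civita (Chr G ^~ (psi y)) G (psi y).
    near: y; apply: (pull (fun z => levi_civita (Chr G ^~ z) G z)); near=> z; apply: Chr_levi_civita.
      by near: z.
    by near: z.
  have rD u (A B : 'M[R]_n) : row u (A + B) = row u A + row u B.
    by apply/rowP => ?; rewrite !mxE.
  rewrite [LHS]rD [RHS]rD; apply: (congr2 +%R).
    have rE u (A : 'M[R]_n) b : row u A 0 b = A u b by rewrite mxE.
    by apply/rowP => b; rewrite [LHS]rE [RHS]rE; exact: (mder_jacobian_sym spy i' k b).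
  rewrite !row_mul; apply/rowP => c.
  rewrite !mulmx_sumr !summxE.
  have E u v : \sum_a (row u ('J psi y) *m ('J psi y v a *: Chr G a (psi y))) 0 c =
     \sum_a \sum_b ('J psi y v a * 'J psi y u b) * Chr G a (psi y) b c.
    apply: eq_bigr => a _; rewrite -scalemxAr !mxE mulr_sumr.
    by apply: eq_bigr => b _; rewrite !mxE mulrA.
  rewrite !E exchange_big /=; apply: eq_bigr => a _; apply: eq_bigr => b _.
  have /rowP/(_ c) := LC.1 a b; rewrite !mxE => ->.
  by congr (_ * _); exact: mulrC.
Unshelve. all: by end_near. Qed.

Lemma natural_ricci : ricci H x = J *m ricci G (psi x) *m J^T.
Proof.
have C i j : curv (Chr H) i j x =
    J *m (\sum_a \sum_b (J i a * J j b) *: curv (Chr G) a b (psi x)) *m invmx J.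
  by rewrite -natural_curv mulmxK.
have uK : J \in unitmx := uJ.
move: uK C; move: (J) => K uK C.
apply/matrixP => j k; rewrite mxE.
under eq_bigr do rewrite riemannE C.
(* In the trace the inverse Jacobian of the upper index meets the Jacobian of the first lower index,
   and the two cancel. *)
have -> : \sum_i (K *m (\sum_a \sum_b (K i a * K j b) *: curv (Chr G) a b (psi x)) *m invmx K) k i
   = \sum_a \sum_b K j b * (K *m curv (Chr G) a b (psi x)) k a.
  transitivity (\sum_i \sum_a \sum_b K j b * ((K *m curv (Chr G) a b (psi x) *m invmx K) k i * K i a)).
    apply: eq_bigr => i _; rewrite mulmx_sumr mulmx_suml summxE; apply: eq_bigr => a _.
    rewrite mulmx_sumr mulmx_suml summxE; apply: eq_bigr => b _.
    rewrite -scalemxAr -scalemxAl [LHS]mxE; ring.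
  rewrite exchange_big /=; apply: eq_bigr => a _; rewrite exchange_big /=.
  apply: eq_bigr => b _; rewrite -mulr_sumr; congr (_ * _).
  have E := mulmxKV uK (K *m curv (Chr G) a b (psi x)).
  by rewrite -[in RHS]E [RHS]mxE.
rewrite exchange_big /= [RHS]mxE.
transitivity (\sum_b \sum_c \sum_a K j b * (K k c * riemann G a a b c (psi x))).
  apply: eq_bigr => b _; rewrite exchange_big /=; apply: eq_bigr => a _.
  rewrite [(_ *m _) _ _]mxE mulr_sumr.
  by apply: eq_bigr => c _; rewrite riemannE.
rewrite exchange_big /=; apply: eq_bigr => c _; rewrite !mxE mulr_suml.
apply: eq_bigr => b _; rewrite mxE mulr_sumr mulr_suml; apply: eq_bigr => a _.
by rewrite [K k c * _]mulrC mulrA.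
Qed.

(** The pairing of bilinear forms induced by [h], written as a trace so that congruence by a
    Jacobian cancels by cyclicity. The eight-fold sum in [riemann_norm] is regrouped into two plain
    contractions and this pairing, which are then transformed separately. *)
Let form (h M M' : 'M[R]_n) := \tr (M *m h *m M'^T *m h^T).

Lemma formE h A B : form h A B =
  \sum_k \sum_l \sum_c \sum_d h k c * h l d * A k l * B c d.
Proof.
rewrite /form /mxtrace; apply: eq_bigr => k _; rewrite mxE.
transitivity (\sum_c \sum_d \sum_l h k c * h l d * A k l * B c d).
  apply: eq_bigr => c _; rewrite !mxE mulr_suml; apply: eq_bigr => d _.
  rewrite !mxE !mulr_suml; apply: eq_bigr => l _; ring.
under eq_bigr do rewrite exchange_big /=.
by rewrite exchange_big.
Qed.

Lemma riemann_normE (G' : 'rV[R]_n -> 'M[R]_n) y :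
  let h := invmx (G' y) in let M i j := curv (Chr G') i j y *m G' y in
  riemann_norm G' y = Num.sqrt (\sum_i \sum_a h i a *
     \sum_j \sum_b h j b * form h (M i j) (M a b)).
Proof.
move=> h M; rewrite /riemann_norm; congr (Num.sqrt _).
have LE i j k l : riemann_low G' i j k l y = M i j k l.
  by rewrite /riemann_low [RHS]mxE; apply: eq_bigr => e _; rewrite riemannE.
transitivity (\sum_i \sum_j \sum_a \sum_b h i a * (h j b * form h (M i j) (M a b))).
  apply: eq_bigr => i _; apply: eq_bigr => j _.
  rewrite (eq_bigr (fun k => \sum_a \sum_b \sum_l \sum_c \sum_d
     h i a * h j b * h k c * h l d * M i j k l * M a b c d)); last first.
    move=> k _; rewrite exchange_big /=; apply: eq_bigr => a _.
    rewrite exchange_big /=; apply: eq_bigr => b _.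
    by apply: eq_bigr => l _; apply: eq_bigr => c _; apply: eq_bigr => d _; rewrite !LE.
  rewrite exchange_big /=; apply: eq_bigr => a _.
  rewrite exchange_big /=; apply: eq_bigr => b _.
  rewrite formE !mulr_sumr; apply: eq_bigr => k _; rewrite !mulr_sumr.
  apply: eq_bigr => l _; rewrite !mulr_sumr; apply: eq_bigr => c _.
  rewrite !mulr_sumr; apply: eq_bigr => d _; ring.
apply: eq_bigr => i _; rewrite exchange_big /=; apply: eq_bigr => a _.
by rewrite mulr_sumr; apply: eq_bigr => j _; rewrite mulr_sumr.
Qed.

Lemma natural_riemann_norm : riemann_norm H x = riemann_norm G (psi x).
Proof.
rewrite !riemann_normE; congr (Num.sqrt _).
set h := invmx (H x); set g := invmx (G (psi x)).
have Hx := nbhs_singleton HE.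
have gE : J^T *m h *m J = g.
  have uJt : J^T \in unitmx by rewrite unitmx_tr.
  have uH : H x \in unitmx by rewrite Hx !unitmx_mul uJ uG.
  apply: (can_inj (mulmxK uG)); rewrite mulVmx //.
  apply: (can_inj (mulKmx uJ)); apply: (can_inj (mulmxK uJt)).
  rewrite mulmx1; apply: (can_inj (mulmxK (_ : invmx (J *m J^T) \in unitmx))).
    by rewrite unitmx_inv unitmx_mul uJ.
  have E : J *m (J^T *m h *m J *m G (psi x)) *m J^T = J *m J^T.
    by rewrite -!mulmxA [J *m (G _ *m _)]mulmxA -Hx mulVmx // mulmx1.
  by rewrite E.
(* By [gE], contracting with [h] what carries two Jacobian factors is contracting the original with
   [g]; this is used once for each of the first two index pairs. *)
have contr (z : 'I_n -> 'I_n -> R) :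
    \sum_k \sum_c h k c * \sum_e \sum_f J k e * J c f * z e f = \sum_e \sum_f g e f * z e f.
  rewrite -gE.
  transitivity (\sum_k \sum_c \sum_e \sum_f h k c * (J k e * J c f * z e f)).
    apply: eq_bigr => k _; apply: eq_bigr => c _; rewrite mulr_sumr.
    by apply: eq_bigr => e _; rewrite mulr_sumr.
  under eq_bigr do rewrite exchange_big /=.
  rewrite exchange_big /=; apply: eq_bigr => e _.
  under eq_bigr do rewrite exchange_big /=.
  rewrite exchange_big /=; apply: eq_bigr => f _.
  rewrite exchange_big mxE mulr_suml; apply: eq_bigr => c _ /=.
  rewrite [(J^T *m h) e c]mxE !mulr_suml; apply: eq_bigr => k _.
  rewrite [J^T e k]mxE; ring.
pose M i j := curv (Chr G) i j (psi x) *m G (psi x).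
have MH i j : curv (Chr H) i j x *m H x =
    \sum_e J i e *: \sum_f J j f *: (J *m M e f *m J^T).
  rewrite Hx !mulmxA natural_curv mulmx_sumr !mulmx_suml; apply: eq_bigr => e _.
  rewrite mulmx_sumr !mulmx_suml scaler_sumr; apply: eq_bigr => f _.
  by rewrite -scalemxAr -!scalemxAl scalerA !mulmxA.
have formJ A B : form h (J *m A *m J^T) (J *m B *m J^T) = form g A B.
  rewrite /form -gE !trmx_mul !trmxK -!mulmxA mxtrace_mulC !mulmxA.
  by rewrite mxtrace_mulC !mulmxA.
have form_sum (u v : 'I_n -> R) (A B : 'I_n -> 'M[R]_n) :
    form h (\sum_e u e *: A e) (\sum_f v f *: B f) =
    \sum_e \sum_f u e * v f * form h (A e) (B f).
  rewrite /form !mulmx_suml raddf_sum; apply: eq_bigr => e _ /=.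
  rewrite raddf_sum mulmx_sumr mulmx_suml raddf_sum; apply: eq_bigr => f _ /=.
  have tZ : (v f *: B f)^T = v f *: (B f)^T by apply/matrixP => ? ?; rewrite !mxE.
  by rewrite tZ -!scalemxAl -scalemxAr -!scalemxAl !mxtraceZ mulrA.
rewrite -[RHS](contr (fun e e' => \sum_f \sum_f' g f f' * form g (M e f) (M e' f'))).
apply: eq_bigr => i _; apply: eq_bigr => a _; congr (_ * _).
under eq_bigr do under eq_bigr do rewrite !MH form_sum mulr_sumr.
transitivity (\sum_e \sum_e' J i e * J a e' * (\sum_j \sum_b h j b *
   form h (\sum_f J j f *: (J *m M e f *m J^T)) (\sum_f J b f *: (J *m M e' f *m J^T)))).
  under eq_bigr do rewrite exchange_big /=.
  rewrite exchange_big /=; apply: eq_bigr => e _.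
  under eq_bigr do under eq_bigr do rewrite mulr_sumr.
  under eq_bigr do rewrite exchange_big /=.
  rewrite exchange_big /=; apply: eq_bigr => e' _.
  rewrite mulr_sumr; apply: eq_bigr => j _; rewrite mulr_sumr; apply: eq_bigr => b _.
  ring.
apply: eq_bigr => e _; apply: eq_bigr => e' _; congr (_ * _).
rewrite -contr; apply: eq_bigr => j _; apply: eq_bigr => b _; congr (_ * _).
rewrite form_sum; apply: eq_bigr => f _; apply: eq_bigr => f' _.
by rewrite formJ.
Qed.

End Naturality.
End Riemann.

(** * Kaehler metrics and products in coordinates *)
Section KahlerLocal.
Context {R : realType} {n : nat}.
Let J := @std_J R n.

Lemma std_JJ : J *m J = - 1%:M.
Proof.
rewrite /J /std_J mulmx_block !(mul0mx, mulmx0, mulmx1, mul1mx, add0r, addr0).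
by rewrite scalar_mx_block opp_block_mx !oppr0.
Qed.

Lemma tr_std_J : J^T = - J.
Proof.
by rewrite /J /std_J tr_block_mx !trmx0 linearN /= trmx1 opp_block_mx !oppr0 opprK.
Qed.

Lemma mxtrace_std_J : \tr J = 0.
Proof. by rewrite /J /std_J mxtrace_block !mxtrace0 addr0. Qed.

(** In a holomorphic chart the complex structure is the constant matrix [J], so being parallel means
    commuting with the Christoffel matrices. With an index lowered, the commutator is a combination
    of first derivatives of [G]; it vanishes by the closedness identity for [i], [k], [l] together
    with the same identity twisted by [J] in the last two indices. *)
Lemma kahler_parallel (G : 'rV[R]_(n + n) -> 'M[R]_(n + n)) x i :
  smx G x -> G x \in unitmx ->
  (\forall y \near x, (G y)^T = G y) ->
  (\forall y \near x, J *m G y *m J^T = G y) ->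
  (forall i j k, pder i (fun v => (J *m G v) j k) x +
     pder j (fun v => (J *m G v) k i) x + pder k (fun v => (J *m G v) i j) x = 0) ->
  J *m Chr G i x = Chr G i x *m J.
Proof.
move=> sG uG Gsym GJ closed.
pose T a := mder a G x.
have TJ a : J *m T a *m J^T = T a.
  rewrite -[RHS](mder_eq _ GJ) (mderM a (smxM (smx_cst J x) sG) (smx_cst _ x)).
  rewrite (mderM a (smx_cst J x) sG) !mder_cst mulmx0 mul0mx add0r addr0.
  by [].
have Tsym a : (T a)^T = T a by rewrite -mder_tr; exact: mder_eq.
have JTC a : J *m T a = T a *m J.
  have := congr1 (mulmx^~ J) (TJ a); rewrite -mulmxA tr_std_J mulNmx std_JJ opprK.
  by rewrite mulmx1.
have cl a b c : (J *m T a) b c + (J *m T b) c a + (J *m T c) a b = 0.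
  have E u d e : pder u (fun v => (J *m G v) d e) x = (J *m T u) d e.
    rewrite -mderE (mderM u (smx_cst J x) sG) mder_cst mul0mx add0r.
    by [].
  by rewrite -(E a b c) -(E b c a) -(E c a b).
have [tor met] := Chr_levi_civita Gsym uG.
pose C a := Chr G a x *m G x.
have CE a k l : 2 * C a k l = T a k l + T k a l - T l a k.
  have t u b c : C u b c = C b u c.
    have /(congr1 (fun r => (r *m G x) 0 c)) := tor u b.
    by rewrite -!row_mul [LHS]mxE [RHS]mxE.
  have mm u b c : T u b c = C u b c + C u c b.
    by rewrite /T met [LHS]mxE [X in _ + X]mxE.
  move: (C) t mm => D t mm; rewrite (mm a k l) (mm k a l) (mm l a k).
  by rewrite (t k a l) (t l a k) (t l k a); ring.
have GJ' : J *m G x = G x *m J.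
  have := congr1 (mulmx^~ J) (nbhs_singleton GJ).
  by rewrite -mulmxA tr_std_J mulNmx std_JJ opprK mulmx1.
apply: (can_inj (mulmxK uG)); rewrite -mulmxA -[RHS]mulmxA GJ' [RHS]mulmxA -/(C i).
apply/matrixP => k l; apply: (mulfI (_ : 2 != 0 :> R)) => //.
(* A bilinear combination of the closedness identity over k, l twisted by J. *)
have key : (T i *m J) k l - \sum_a J k a * T a l i + \sum_b J l b * T b i k = 0.
  have S1 : \sum_a \sum_b J k a * J l b * (J *m T i) a b = (T i *m J) k l.
    transitivity ((J *m (J *m T i) *m J^T) k l).
      rewrite [RHS]mxE exchange_big /=; apply: eq_bigr => b _.
      rewrite [(J *m (J *m T i)) k b]mxE mulr_suml; apply: eq_bigr => a _.
      by rewrite [J^T b l]mxE mulrAC.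
    by rewrite mulmxA std_JJ mulNmx mul1mx tr_std_J mulmxN mulNmx opprK.
  have S2 : \sum_a \sum_b J k a * J l b * (J *m T a) b i = - \sum_a J k a * T a l i.
    rewrite -sumrN; apply: eq_bigr => a _.
    have -> : T a l i = - (J *m (J *m T a)) l i.
      by rewrite mulmxA std_JJ mulNmx mul1mx mxE opprK.
    rewrite mulrN opprK [(J *m (J *m T a)) l i]mxE mulr_sumr.
    by apply: eq_bigr => b _; rewrite mulrA.
  have S3 : \sum_a \sum_b J k a * J l b * (J *m T b) i a = \sum_b J l b * T b i k.
    rewrite exchange_big /=; apply: eq_bigr => b _; rewrite -{2}(TJ b).
    rewrite [(_ *m J^T) i k]mxE mulr_sumr; apply: eq_bigr => a _.
    by rewrite [J^T a k]mxE; ring.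
  rewrite -S1 -S3 -S2 -!big_split /= big1 // => a _; rewrite -!big_split /= big1 // => b _.
  by rewrite -!mulrDr cl mulr0.
have NJ a b : J a b = - J b a by have /matrixP/(_ b a) := tr_std_J; rewrite mxE [RHS]mxE.
have L : 2 * (J *m C i) k l =
    (J *m T i) k l + \sum_a J k a * T a i l - (T l *m J^T) i k.
  rewrite [(J *m C i) k l]mxE [(J *m T i) k l]mxE [(T l *m _) i k]mxE.
  rewrite mulr_sumr -big_split -sumrB; apply: eq_bigr => a _ /=.
  rewrite mulrCA CE [J^T a k]mxE; ring.
have Rr : 2 * (C i *m J) k l =
    (T i *m J) k l + (T k *m J) i l - \sum_a T a i k * J a l.
  rewrite [(C i *m J) k l]mxE [(T i *m J) k l]mxE [(T k *m _) i l]mxE.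
  rewrite mulr_sumr -big_split -sumrB; apply: eq_bigr => a _ /=.
  rewrite mulrA CE; ring.
rewrite L Rr JTC.
have Ts a b c : T a b c = T a c b by rewrite -{1}(Tsym a) mxE.
have -> : \sum_a J k a * T a i l = \sum_a J k a * T a l i.
  by apply: eq_bigr => a _; rewrite Ts.
have -> : \sum_a T a i k * J a l = - \sum_b J l b * T b i k.
  by rewrite -sumrN; apply: eq_bigr => a _; rewrite NJ mulrN mulrC.
have -> : (T l *m J^T) i k = - (T l *m J) i k by rewrite tr_std_J mulmxN mxE.
rewrite opprK.
have c1 := cl i k l; rewrite !JTC in c1.
have e1 : (T k *m J) l i = - (T k *m J) i l.
  rewrite -{1}(trmxK (T k *m J)) [LHS]mxE trmx_mul Tsym tr_std_J mulNmx [LHS]mxE.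
  by rewrite JTC.
rewrite e1 in c1; move: key c1; lra.
Qed.

End KahlerLocal.

Section ProductLocal.
Context {R : realType} {m K : nat} (d : 'I_m -> nat).
Unset Implicit Arguments.
Context (E : forall i, 'M[R]_(K, d i)).
Hypothesis E_orth : forall i, (E i)^T *m E i = 1%:M.
Hypothesis E_orth0 : forall i j, i != j -> (E i)^T *m E j = 0.
Hypothesis E_full : \sum_i E i *m (E i)^T = 1%:M.
Context (g : forall i, 'rV[R]_(d i) -> 'M[R]_(d i)) (b : 'I_m -> R) (z : 'rV[R]_K).
Set Implicit Arguments.
Hypothesis b_neq0 : forall i, b i != 0.
Hypothesis sg : forall i, smx (g i) (z *m E i).
Hypothesis ug : forall i, g i (z *m E i) \in unitmx.
Hypothesis gsym : forall i, \forall y \near z *m E i, (g i y)^T = g i y.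

(** Blocks of different sizes are placed by the orthonormal inclusions [E i] instead of by index
    arithmetic; block algebra then follows from [E_orth], [E_orth0] and [E_full] without casts. *)
Definition diag_blocks (B : forall i, 'M[R]_(d i)) : 'M[R]_K :=
  \sum_i E i *m B i *m (E i)^T.

Lemma diag_blocksM B C :
  diag_blocks B *m diag_blocks C = diag_blocks (fun i => B i *m C i).
Proof.
rewrite /diag_blocks mulmx_suml; apply: eq_bigr => i _; rewrite mulmx_sumr.
rewrite (bigD1 i) //= big1 ?addr0 => [|j ji].
  by rewrite -!mulmxA [_^T *m (E i *m _)]mulmxA E_orth mul1mx !mulmxA.
by rewrite -!mulmxA [_^T *m (E j *m _)]mulmxA E_orth0 1?eq_sym // mul0mx !mulmx0.
Qed.

Lemma tr_diag_blocks B : (diag_blocks B)^T = diag_blocks (fun i => (B i)^T).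
Proof.
rewrite /diag_blocks raddf_sum; apply: eq_bigr => i _ /=.
by rewrite !trmx_mul trmxK mulmxA.
Qed.

Lemma diag_blocks_eq B C : (forall i, B i = C i) -> diag_blocks B = diag_blocks C.
Proof. by move=> BC; apply: eq_bigr => i _; rewrite BC. Qed.

Lemma diag_blocksD B C :
  diag_blocks B + diag_blocks C = diag_blocks (fun i => B i + C i).
Proof. by rewrite /diag_blocks -big_split; apply: eq_bigr => i _; rewrite mulmxDr mulmxDl. Qed.

Lemma diag_blocksN B : - diag_blocks B = diag_blocks (fun i => - B i).
Proof. by rewrite /diag_blocks -sumrN; apply: eq_bigr => i _; rewrite mulmxN mulNmx. Qed.

Lemma diag_blocksZ c B : c *: diag_blocks B = diag_blocks (fun i => c *: B i).
Proof. by rewrite /diag_blocks scaler_sumr; apply: eq_bigr => i _; rewrite -scalemxAr -scalemxAl. Qed.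

Lemma diag_blocks1 : diag_blocks (fun=> 1%:M) = 1%:M.
Proof. by rewrite -E_full; apply: eq_bigr => i _; rewrite mulmx1. Qed.

Lemma mxtrace_diag_blocks B : \tr (diag_blocks B) = \sum_i \tr (B i).
Proof.
rewrite /diag_blocks raddf_sum; apply: eq_bigr => i _ /=.
by rewrite mxtrace_mulC mulmxA E_orth mul1mx.
Qed.

Lemma diag_blocks_unit B : (forall i, B i \in unitmx) -> diag_blocks B \in unitmx.
Proof.
move=> uB; have := @mulmx1_unit _ _ (diag_blocks B) (diag_blocks (fun i => invmx (B i))).
rewrite diag_blocksM (diag_blocks_eq (C := fun=> 1%:M)) => [|i]; last by rewrite mulmxV.
by rewrite diag_blocks1 => /(_ erefl) [].
Qed.

Lemma smx_diag_blocks n (B : forall i, 'rV[R]_n -> 'M[R]_(d i)) x :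
  (forall i, smx (B i) x) -> smx (fun v => diag_blocks (fun i => B i v)) x.
Proof.
by move=> sB; apply: smx_sum => i; apply: smxM (smx_cst _ _); apply: smxM (smx_cst _ _) _.
Qed.

Lemma mder_diag_blocks n (B : forall i, 'rV[R]_n -> 'M[R]_(d i)) x k :
  (forall i, smx (B i) x) ->
  mder k (fun v => diag_blocks (fun i => B i v)) x = diag_blocks (fun i => mder k (B i) x).
Proof.
move=> sB; have s i : smx (fun v => E i *m B i v) x by exact: smxM (smx_cst _ _) (sB i).
rewrite mder_sum => [|i]; last exact: smxM (s i) (smx_cst _ _).
apply: eq_bigr => i _; rewrite (mderM k (s i) (smx_cst _ _)) mder_cst mulmx0 addr0.
by rewrite (mderM k (smx_cst _ _) (sB i)) mder_cst mul0mx add0r.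
Qed.

Definition block_proj i : {linear 'rV[R]_K -> 'rV[R]_(d i)} := mulmxr (E i).

Lemma smx_proj i y : smx (fun v => v *m E i) y.
Proof. exact: (smx_linear (block_proj i)). Qed.

Lemma jacobian_proj i y : 'J (fun v => v *m E i) y = E i.
Proof.
have := jacobian_linear (block_proj i) y; rewrite /= => ->.
by apply/matrixP => a c; rewrite mxE /= -rowE mxE.
Qed.

Definition product_metric (y : 'rV[R]_K) : 'M[R]_K :=
  diag_blocks (fun i => b i *: g i (y *m E i)).

Let theta i k (y : 'rV[R]_K) :=
  \sum_a 'J (fun v => v *m E i) y k a *: Chr (g i) a (y *m E i).

Let smx_theta i k : smx (theta i k) z.
Proof.
apply: smx_sum => a; apply: smx_scale; first exact: (smx_J (smx_proj i z)).
exact: (smx_comp (smx_proj i z) (Chr_smooth a (sg i) (ug i))).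
Qed.

Lemma product_smooth : smx product_metric z.
Proof.
apply: smx_diag_blocks => i; apply: smxZ.
exact: (smx_comp (smx_proj i z) (sg i)).
Qed.

Lemma product_unit : product_metric z \in unitmx.
Proof. by apply: diag_blocks_unit => i; rewrite unitmxZ // unitfE. Qed.

Lemma product_proj_near i (Q : 'rV[R]_(d i) -> Prop) :
  (\forall y \near z *m E i, Q y) -> \forall y \near z, Q (y *m E i).
Proof. exact: (smx_continuous (smx_proj i z)). Qed.

Lemma product_sym : \forall y \near z, (product_metric y)^T = product_metric y.
Proof.
have := near_fin (fun i => product_proj_near (gsym i)).
apply: filterS => y H; rewrite tr_diag_blocks; apply: diag_blocks_eq => i.
by rewrite linearZ /= H.
Qed.

(** The block sum of the pulled back Christoffel matrices is torsion free and metric, so uniqueness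
    applies. The constant weights [b i] cancel from the compatibility condition, which is why
    neither the connection nor the Ricci tensor of the product contains them. *)
Lemma product_Chr : \forall y \near z, forall k,
  Chr product_metric k y = diag_blocks (fun i => theta i k y).
Proof.
have H1 := near_fin (fun i => product_proj_near (smx_near (sg i))).
have H2 := near_fin (fun i => product_proj_near (smx_unit_near (sg i) (ug i))).
have H3 := near_fin (fun i => product_proj_near (near_join (gsym i))).
have H4 := near_join product_sym.
have H5 := smx_unit_near product_smooth product_unit.
near=> y => k.
have sy i : smx (g i) (y *m E i) by move: i; near: y; exact: H1.
have uy i : g i (y *m E i) \in unitmx by move: i; near: y; exact: H2.
have gy i : \forall y \near y *m E i, (g i y)^T = g i y by move: i; near: y; exact: H3.
have py : \forall y \near y, (product_metric y)^T = product_metric y by near: y; exact: H4.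
have upy : product_metric y \in unitmx by near: y; exact: H5.
apply: (levi_civita_unique (O := Chr product_metric ^~ y)
  (O' := fun k => diag_blocks (fun i => theta i k y)) upy).
  exact: Chr_levi_civita py upy.
split=> [k1 k2|k1].
  rewrite /diag_blocks !linear_sum; apply: eq_bigr => i _ /=.
  rewrite !row_mul; congr (_ *m _); apply/rowP => c.
  have X u v : (row u (E i) *m theta i v y) 0 c =
     \sum_a \sum_e E i v a * E i u e * Chr (g i) a (y *m E i) e c.
    rewrite /theta mulmx_sumr summxE; apply: eq_bigr => a _.
    rewrite jacobian_proj -scalemxAr mxE [(_ *m _) _ _]mxE mulr_sumr.
    by apply: eq_bigr => e _; rewrite mxE mulrA.
  rewrite !X exchange_big; apply: eq_bigr => a _; apply: eq_bigr => e _ /=.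
  have [t _] := Chr_levi_civita (gy i) (uy i).
  have /rowP/(_ c) := t e a; rewrite [LHS]mxE [RHS]mxE => ->.
  by congr (_ * _); exact: mulrC.
have sgp i : smx (fun v => g i (v *m E i)) y by exact: (smx_comp (smx_proj i y) (sy i)).
rewrite mder_diag_blocks => [|i]; last exact: smxZ.
rewrite diag_blocksM tr_diag_blocks diag_blocksD; apply: diag_blocks_eq => i.
rewrite (mderZ _ _ (sgp i)) (mder_comp (smx_proj i y) k1 (sy i)).
have [_ m'] := Chr_levi_civita (gy i) (uy i).
rewrite -scalemxAr linearZ /= -scalerDr; congr (_ *: _).
rewrite /theta mulmx_suml raddf_sum -big_split; apply: eq_bigr => a _ /=.
by rewrite m' -scalemxAl linearZ scalerDr.
Unshelve. all: by end_near. Qed.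

Lemma product_curv k l : curv (Chr product_metric) k l z =
  diag_blocks (fun i => \sum_a \sum_c (E i k a * E i l c) *:
     curv (Chr (g i)) a c (z *m E i)).
Proof.
have C k' : \forall y \near z, Chr product_metric k' y = diag_blocks (fun i => theta i k' y).
  by apply: filterS product_Chr => y; apply.
rewrite curvE (mder_eq _ (C k)) (mder_eq _ (C l)).
rewrite (nbhs_singleton (C k)) (nbhs_singleton (C l)).
rewrite !(mder_diag_blocks _ (fun i => smx_theta i _)) !diag_blocksM.
rewrite !diag_blocksN !diag_blocksD; apply: diag_blocks_eq => i.
rewrite -curvE (curv_pullback k l (smx_proj i z) (fun a => Chr_smooth a (sg i) (ug i))).
by rewrite jacobian_proj.
Qed.

Lemma product_ricci :
  ricci product_metric z = diag_blocks (fun i => ricci (g i) (z *m E i)).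
Proof.
apply/matrixP => j k; rewrite [LHS]mxE.
under eq_bigr do rewrite riemannE product_curv /diag_blocks summxE.
rewrite exchange_big summxE; apply: eq_bigr => i _ /=.
have -> : \sum_e (E i *m (\sum_a \sum_c (E i e a * E i j c) *:
      curv (Chr (g i)) a c (z *m E i)) *m (E i)^T) k e =
    \sum_a \sum_c E i j c * (E i *m curv (Chr (g i)) a c (z *m E i)) k a.
  transitivity (\sum_e \sum_a \sum_c E i j c *
      ((E i *m curv (Chr (g i)) a c (z *m E i) *m (E i)^T) k e * E i e a)).
    apply: eq_bigr => e _; rewrite mulmx_sumr mulmx_suml summxE; apply: eq_bigr => a _.
    rewrite mulmx_sumr mulmx_suml summxE; apply: eq_bigr => c _.
    rewrite -scalemxAr -scalemxAl [LHS]mxE; ring.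
  rewrite exchange_big /=; apply: eq_bigr => a _; rewrite exchange_big /=.
  apply: eq_bigr => c _; rewrite -mulr_sumr; congr (_ * _).
  transitivity ((E i *m curv (Chr (g i)) a c (z *m E i) *m (E i)^T *m E i) k a).
    by rewrite [RHS]mxE.
  by rewrite -mulmxA E_orth mulmx1.
rewrite exchange_big /= [RHS]mxE.
under [RHS]eq_bigr do rewrite mxE mulr_suml.
rewrite [RHS]exchange_big /=; apply: eq_bigr => c _.
transitivity (\sum_a \sum_e E i j c * (E i k e * riemann (g i) a a c e (z *m E i))).
  apply: eq_bigr => a _; rewrite [(_ *m _) _ _]mxE mulr_sumr.
  by apply: eq_bigr => e _; rewrite riemannE.
rewrite exchange_big /=; apply: eq_bigr => e _.
rewrite -mulr_sumr -mulr_sumr !mxE -mulrA; congr (_ * _); exact: mulrC.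
Qed.

End ProductLocal.

(** * Ricci curvature of a circle bundle in coordinates *)
Section KaluzaKlein.
Context {R : realType} {K : nat}.
Let lin_rsub : {linear 'rV[R]_(1 + K) -> 'rV[R]_K} := rsubmx.

Lemma smx_rsub (v : 'rV[R]_(1 + K)) : smx (fun v : 'rV[R]_(1 + K) => rsubmx v) v.
Proof. exact: (smx_linear lin_rsub). Qed.

Lemma jacobian_rsub v : 'J (fun v : 'rV[R]_(1 + K) => rsubmx v) v = col_mx 0 1%:M.
Proof.
have := jacobian_linear lin_rsub v; rewrite /= => ->.
apply/matrixP => a c; rewrite mxE !mxE.
case: (split_ordP a) => a' ->; rewrite ?col_mxEu ?col_mxEd !mxE.
  by rewrite eqxx /= eq_sym eq_lrshift.
by rewrite eqxx /= eq_rshift eq_sym.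
Qed.

Lemma mder_rsub p q (f : 'rV[R]_K -> 'M[R]_(p, q)) v : smx f (rsubmx v) ->
  mder (lshift K 0) (fun v : 'rV[R]_(1 + K) => f (rsubmx v)) v = 0 /\
  forall j, mder (rshift 1 j) (fun v : 'rV[R]_(1 + K) => f (rsubmx v)) v =
     mder j f (rsubmx v).
Proof.
move=> sf; split=> [|j]; rewrite (mder_comp (smx_rsub v) _ sf) jacobian_rsub.
  by rewrite big1 // => k _; rewrite col_mxEu mxE scale0r.
rewrite (bigD1 j) //= col_mxEd mxE eqxx scale1r big1 ?addr0 // => k kj.
by rewrite col_mxEd mxE eq_sym (negbTE kj) scale0r.
Qed.

Context (h : 'rV[R]_K -> 'M[R]_K) (phi : 'M[R]_K) (A : 'rV[R]_(1 + K) -> 'rV[R]_K)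
  (G : 'rV[R]_(1 + K) -> 'M[R]_(1 + K)) (v0 : 'rV[R]_(1 + K)).
Let z0 : 'rV[R]_K := rsubmx v0.
Hypotheses (sh : smx h z0) (uh : h z0 \in unitmx).
Hypothesis hsym : \forall z \near z0, (h z)^T = h z.
Hypothesis phi_parallel : \forall z \near z0, forall k,
  phi *m Chr h k z = Chr h k z *m phi.
Let F z := phi *m h z.
Hypothesis F_antisym : \forall z \near z0, (F z)^T = - F z.
Hypothesis phi_tr : \tr phi = 0.
Hypotheses (sA : smx A v0) (A0 : A v0 = 0).
Hypothesis A_vert : \forall v \near v0, mder (lshift K 0) A v = 0.
Hypothesis A_curv : \forall v \near v0, forall j k,
  mder (rshift 1 j) A v 0 k - mder (rshift 1 k) A v 0 j = F (rsubmx v) j k.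
Hypothesis GE : \forall v \near v0, G v =
  (row_mx 1%:M (A v))^T *m row_mx 1%:M (A v) + block_mx 0 0 0 (h (rsubmx v)).

(** The rows write the coordinate vectors in terms of the vertical vector and the horizontal lifts;
    in that frame the metric is the block matrix [hh], with no trace of [A]. *)
Let Psi (v : 'rV[R]_(1 + K)) : 'M[R]_(1 + K) := block_mx 1%:M 0 (A v)^T 1%:M.
Let hh (v : 'rV[R]_(1 + K)) : 'M[R]_(1 + K) := block_mx 1%:M 0 0 (h (rsubmx v)).
Let O0 : 'M[R]_(1 + K) := block_mx 0 0 0 (2^-1 *: phi).
Let Oj (j : 'I_K) (v : 'rV[R]_(1 + K)) : 'M[R]_(1 + K) :=
  block_mx 0 (2^-1 *: row j phi) (- (2^-1 *: (row j (F (rsubmx v)))^T))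
    (Chr h j (rsubmx v) + (2^-1 * A v 0 j) *: phi).
(* The Levi-Civita connection in the frame e_0, e_k - A_k e_0. *)
Let O (i : 'I_(1 + K)) (v : 'rV[R]_(1 + K)) : 'M[R]_(1 + K) :=
  match fintype.split i with inl _ => O0 | inr j => Oj j v end.

Let O_l v : O (lshift K 0) v = O0.
Proof. by rewrite /O (unsplitK (inl _ : 'I_1 + 'I_K)). Qed.

Let O_r j v : O (rshift 1 j) v = Oj j v.
Proof. by rewrite /O (unsplitK (inr _ : 'I_1 + 'I_K)). Qed.

Let ord_case (Q : 'I_(1 + K) -> Prop) :
  Q (lshift K 0) -> (forall j, Q (rshift 1 j)) -> forall i, Q i.
Proof. by move=> Q0 Qj i; case: (split_ordP i) => j -> //; rewrite ord1. Qed.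

Let near_z (P : 'rV[R]_K -> Prop) :
  (\forall z \near z0, P z) -> \forall v \near v0, P (rsubmx v).
Proof. by move=> H; exact: (smx_continuous (smx_rsub v0)). Qed.

Let smx_F z : smx h z -> smx F z.
Proof. by move=> s; exact: smxM (smx_cst _ _) s. Qed.

Let smx_Oj j v : smx h (rsubmx v) -> h (rsubmx v) \in unitmx -> smx A v -> smx (Oj j) v.
Proof.
move=> s u sa; apply: smx_block; try exact: smx_cst.
  apply: smxN; apply: smxZ; apply: smx_tr; split=> a c.
  under eq_fun do rewrite mxE.
  exact: (smx_comp (smx_rsub v) (smx_F s) j c).
apply: smxD; first exact: (smx_comp (smx_rsub v) (Chr_smooth j s u)).
by apply: smx_scale; [apply: sgZ; exact: sa|exact: smx_cst].
Qed.

Let smx_O i : smx (O i) v0.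
Proof.
elim/ord_case: i => [|j].
  by apply: smx_eq (smx_cst O0 _); near=> v; rewrite O_l.
apply: smx_eq (smx_Oj j sh uh sA); by near=> v; rewrite O_r.
Unshelve. all: by end_near. Qed.

Let smx_Psi v : smx A v -> smx Psi v.
Proof. by move=> s; apply: smx_block; try exact: smx_cst; exact: smx_tr. Qed.

Let smx_hh v : smx h (rsubmx v) -> smx hh v.
Proof.
by move=> s; apply: smx_block; try exact: smx_cst; exact: (smx_comp (smx_rsub v) s).
Qed.

Let mder_Psi i v : mder i Psi v = block_mx 0 0 (mder i A v)^T 0.
Proof. by rewrite mder_block !mder_cst mder_tr. Qed.

Let Psi_O0 v : Psi v *m O0 = O0.
Proof.
by rewrite mulmx_block !(mul0mx, mulmx0, mul1mx, mulmx1, add0r, addr0).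
Qed.

Let Psi_Oj j v : Psi v *m Oj j v = block_mx 0 (2^-1 *: row j phi)
  (- (2^-1 *: (row j (F (rsubmx v)))^T))
  ((A v)^T *m (2^-1 *: row j phi) + (Chr h j (rsubmx v) + (2^-1 * A v 0 j) *: phi)).
Proof.
by rewrite mulmx_block !(mul0mx, mulmx0, mul1mx, mulmx1, add0r, addr0).
Qed.

Lemma kaluza_klein_unit : G v0 \in unitmx /\ smx G v0.
Proof.
have GE' : \forall v \near v0, G v = Psi v *m hh v *m (Psi v)^T.
  apply: filterS GE => v ->.
  rewrite tr_row_mx mul_col_row !mulmx_block tr_block_mx !mulmx_block trmxK add_block_mx.
  by rewrite !(trmx1, trmx0, mul0mx, mulmx0, mul1mx, mulmx1, add0r, addr0).
have uhh : hh v0 \in unitmx by rewrite unitmxE det_ublock det1 mul1r -unitmxE.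
have uPsi : Psi v0 \in unitmx by rewrite unitmxE det_lblock !det1 mul1r unitr1.
split; first exact: (frame_unit uPsi uhh GE').
exact: (frame_smooth (smx_Psi sA) (smx_hh sh) GE').
Qed.

(** Since [A] vanishes at [v0], the frame agrees there with the coordinate vectors, and the two
    curvatures are equal rather than merely conjugate. *)
Let frame_ok i0 j0 : curv (Chr G) i0 j0 v0 = curv O i0 j0 v0.
Proof.
have Psi0 : Psi v0 = 1%:M by rewrite /Psi A0 trmx0 -scalar_mx_block.
have GE' : \forall v \near v0, G v = Psi v *m hh v *m (Psi v)^T.
  apply: filterS GE => v ->.
  rewrite tr_row_mx mul_col_row !mulmx_block tr_block_mx !mulmx_block trmxK add_block_mx.
  by rewrite !(trmx1, trmx0, mul0mx, mulmx0, mul1mx, mulmx1, add0r, addr0).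
have uhh : hh v0 \in unitmx by rewrite unitmxE det_ublock det1 mul1r -unitmxE.
have hsym' := near_z (near_join hsym).
have sh' := near_z (smx_near sh); have uh' := near_z (smx_unit_near sh uh).
have Fa := near_z F_antisym; have sA' := smx_near sA.
rewrite -[LHS]mulmx1 -[RHS]mul1mx -Psi0.
apply: (@frame_curv R _ G hh Psi O v0 (smx_Psi sA) (smx_hh sh) smx_O _ _ uhh GE').
- by rewrite Psi0 unitmx1.
- by apply: filterS (near_z hsym) => v hs; rewrite /hh tr_block_mx !trmx0 trmx1 hs.
(* Compatibility: the terms added to the base connection cancel against their transposes, by the
   opposite signs of the off-diagonal blocks and, in the base block, by the antisymmetry of [F]. *)
- near=> v.
  have sv : smx h (rsubmx v) by near: v; exact: sh'.
  have Fv : (F (rsubmx v))^T = - F (rsubmx v) by near: v; exact: Fa.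
  have hs : \forall z \near rsubmx v, (h z)^T = h z by near: v; exact: hsym'.
  have uv : h (rsubmx v) \in unitmx by near: v; exact: uh'.
  have [m0 mj] := mder_rsub sv.
  elim/ord_case => [|j].
    rewrite O_l mder_block !mder_cst m0 mulmx_block.
    rewrite !(mul0mx, mulmx0, mul1mx, mulmx1, add0r, addr0) tr_block_mx add_block_mx.
    rewrite -scalemxAl -/(F _) linearZ /= Fv scalerN subrr.
    by rewrite !trmx0 !addr0.
  rewrite O_r mder_block !mder_cst mj /hh /Oj mulmx_block.
  rewrite !(mul0mx, mulmx0, mul1mx, mulmx1, add0r, addr0) tr_block_mx add_block_mx.
  have -> : 2^-1 *: row j phi *m h (rsubmx v) = 2^-1 *: row j (F (rsubmx v)).
    by rewrite -scalemxAl -row_mul.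
  have [_ met] := Chr_levi_civita hs uv.
  rewrite trmx0 addr0 (met j); congr block_mx.
  - by rewrite linearN linearZ /= trmxK subrr.
  - by apply/matrixP => p r; rewrite !mxE addNr.
  rewrite mulmxDl -scalemxAl -/(F _) linearD /= linearZ /= Fv scalerN.
  by rewrite addrACA subrr addr0.
(* Torsion: [A] does not vary along the fibre, and the halves of [F] in the off-diagonal blocks
   account for its antisymmetrized derivative. *)
near=> v.
have Av : mder (lshift K 0) A v = 0 by near: v; exact: A_vert.
have Ac j k : mder (rshift 1 j) A v 0 k - mder (rshift 1 k) A v 0 j = F (rsubmx v) j k.
  by move: j k; near: v; exact: A_curv.
have Fv : (F (rsubmx v))^T = - F (rsubmx v) by near: v; exact: Fa.
have hs : \forall z \near rsubmx v, (h z)^T = h z by near: v; exact: hsym'.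
have uv : h (rsubmx v) \in unitmx by near: v; exact: uh'.
have [tor _] := Chr_levi_civita hs uv.
pose N i := mder i Psi v + Psi v *m O i v.
suff HN : forall i k, row k (N i) = row i (N k) by exact: HN.
have M0 : N (lshift K 0) = O0.
  by rewrite /N mder_Psi Av trmx0 O_l Psi_O0 -[block_mx 0 0 0 0]/(block_mx 0 0 0 0) block_mx0 add0r.
have Mj j : N (rshift 1 j) =
   block_mx 0 (2^-1 *: row j phi)
     ((mder (rshift 1 j) A v)^T - 2^-1 *: (row j (F (rsubmx v)))^T)
     ((A v)^T *m (2^-1 *: row j phi) + (Chr h j (rsubmx v) + (2^-1 * A v 0 j) *: phi)).
  by rewrite /N mder_Psi O_r Psi_Oj add_block_mx !add0r.
clearbody N.
have rE p q (B : 'M[R]_(p, q)) u c : row u B 0 c = B u c by rewrite mxE.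
have row_eq p q (B B' : 'M[R]_(p, q)) u w : (forall c, B u c = B' w c) -> row u B = row w B'.
  by move=> H; apply/rowP => c; rewrite !mxE.
have neg (r : 'rV[R]_K) e : (- (2^-1 *: r^T)) e 0 = - (2^-1 * r 0 e) by rewrite !mxE.
elim/ord_case => [|i]; elim/ord_case => [//|k].
- rewrite M0 Mj; apply: row_eq => c.
  elim/ord_case: c => [|c].
    by rewrite /O0 block_mxEdl block_mxEul !mxE.
  by rewrite /O0 block_mxEdr block_mxEur !mxE.
- rewrite M0 Mj; apply: row_eq => c.
  elim/ord_case: c => [|c].
    by rewrite /O0 block_mxEdl block_mxEul !mxE.
  by rewrite /O0 block_mxEdr block_mxEur !mxE.
rewrite !Mj; apply: row_eq => c.
elim/ord_case: c => [|c].
  rewrite !block_mxEdl [LHS]mxE [RHS]mxE [_^T k 0]mxE [_^T i 0]mxE !neg 2!rE.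
  have Fs : F (rsubmx v) k i = - F (rsubmx v) i k.
    by have /matrixP/(_ i k) := Fv; rewrite mxE [RHS]mxE.
  have := Ac i k; rewrite Fs => e; lra.
have /rowP/(_ c) := tor i k; rewrite [LHS]mxE [RHS]mxE => torc.
have outer (u w : 'I_K) : ((A v)^T *m (2^-1 *: row u phi)) w c = 2^-1 * (A v 0 w * phi u c).
  by rewrite mxE big_ord_recl big_ord0 addr0 !mxE; ring.
rewrite !block_mxEdr [LHS]mxE [RHS]mxE !outer.
rewrite [(Chr _ _ _ + _) _ _]mxE [X in _ = _ + X]mxE torc.
rewrite [(_ *: phi) _ _]mxE [X in _ = _ + (_ + X)]mxE; ring.
Unshelve. all: by end_near. Qed.

(** As [phi] is parallel, the mixed entries become differences of two sums exchanged by the symmetry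
    of the Christoffel symbols. As [phi] is trace free, the term proportional to [F] itself
    disappears from the horizontal block. *)
Lemma kaluza_klein_ricci : ricci G v0 =
  block_mx (- (4^-1 * \tr (phi *m phi)))%:M 0 0
    (ricci h z0 + 2^-1 *: (phi *m phi *m h z0)).
Proof.
have hs := hsym; have [tor _] := Chr_levi_civita hs uh.
have Fz : (F z0)^T = - F z0 by exact: (nbhs_singleton F_antisym).
have par k : phi *m Chr h k z0 = Chr h k z0 *m phi by exact: (nbhs_singleton phi_parallel).
have d0 i : mder i (O (lshift K 0)) v0 = 0.
  rewrite (_ : O (lshift K 0) = fun=> O0) ?mder_cst //.
  by apply/funext => v; rewrite O_l.
have zj j : (0 : 'rV[R]_K) 0 j = 0 by rewrite mxE.
have zz a c : (0 : 'M[R]_(1 + K)) a c = 0 by rewrite mxE.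
have z1 : (0 : 'M[R]_1) 0 0 = 0 by rewrite mxE.
have OjE j : O (rshift 1 j) = Oj j by apply/funext => v; rewrite O_r.
have sC j : smx (fun v : 'rV[R]_(1 + K) => Chr h j (rsubmx v)) v0.
  exact: (smx_comp (smx_rsub v0) (Chr_smooth j sh uh)).
have sa j : smooth_germ (fun v => 2^-1 * A v 0 j) v0 by apply: sgZ; exact: sA.
have dOj i j : mder i (O (rshift 1 j)) v0 = block_mx 0 0
    (mder i (fun v : 'rV[R]_(1 + K) => - (2^-1 *: (row j (F (rsubmx v)))^T)) v0)
    (mder i (fun v : 'rV[R]_(1 + K) => Chr h j (rsubmx v)) v0 +
      (2^-1 * mder i A v0 0 j) *: phi).
  rewrite OjE mder_block !mder_cst; congr block_mx.
  rewrite (mderD i (sC j) (smx_scale (sa j) (smx_cst phi v0))).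
  rewrite (mder_scale i (sa j) (smx_cst phi v0)) mder_cst scaler0 addr0.
  by rewrite (pderM i (sg_cst 2^-1 v0) (sA 0 j)) pder_cst mul0r add0r mderE.
have d0Oj j : mder (lshift K 0) (O (rshift 1 j)) v0 = 0.
  rewrite dOj (nbhs_singleton A_vert) zj mulr0 scale0r addr0.
  rewrite (mder_rsub (Chr_smooth j sh uh)).1.
  have sf : smx (fun z => - (2^-1 *: (row j (F z))^T)) (rsubmx v0).
    apply: smxN; apply: smxZ; apply: smx_tr; split=> a c.
    by under eq_fun do rewrite mxE; exact: smx_F sh j c.
  by rewrite (mder_rsub sf).1 block_mx0.
have O00 : O (lshift K 0) v0 = O0 by exact: O_l.
have OjV j : O (rshift 1 j) v0 = block_mx 0 (2^-1 *: row j phi)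
    (- (2^-1 *: (row j (F z0))^T)) (Chr h j z0).
  by rewrite O_r /Oj A0 zj mulr0 scale0r addr0.
have F_entry j k : F z0 j k = - F z0 k j.
  by have /matrixP/(_ k j) := Fz; rewrite mxE [RHS]mxE.
have c00 : curv O (lshift K 0) (lshift K 0) v0 = 0.
  by rewrite curvE !subrr add0r subrr.
have cj0 j : curv O (rshift 1 j) (lshift K 0) v0 =
    block_mx 0 (- (4^-1 *: (row j phi *m phi))) (- (4^-1 *: (phi *m (row j (F z0))^T))) 0.
  rewrite curvE d0 d0Oj subrr add0r O00 OjV /O0 !mulmx_block.
  rewrite !(mul0mx, mulmx0, add0r, addr0) opp_block_mx add_block_mx.
  rewrite !(oppr0, add0r, addr0); congr block_mx.
  - by rewrite -scalemxAl -scalemxAr scalerA -invfM -natrM.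
  - by rewrite mulmxN -scalemxAl -scalemxAr scalerA -invfM -natrM.
  - by rewrite -scalemxAl -scalemxAr par subrr.
have c0j j : curv O (lshift K 0) (rshift 1 j) v0 = - curv O (rshift 1 j) (lshift K 0) v0.
  by rewrite !curvE d0 d0Oj !subrr !add0r opprB.
have urij i j l : curv O (rshift 1 i) (rshift 1 j) v0 (lshift K 0) (rshift 1 l) =
    2^-1 * ((row j phi *m Chr h i z0) 0 l - (row i phi *m Chr h j z0) 0 l).
  rewrite curvE !dOj !OjV !mulmx_block !(opp_block_mx, add_block_mx) block_mxEur.
  rewrite !(mul0mx, add0r, oppr0) -!scalemxAl -scalerBr mxE.
  have sub (M N : 'rV[R]_K) : (M - N) 0 l = M 0 l - N 0 l by rewrite !mxE.
  by rewrite sub.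
have drij i j k l : curv O (rshift 1 i) (rshift 1 j) v0 (rshift 1 k) (rshift 1 l) =
    curv (Chr h) i j z0 k l + 2^-1 * F z0 i j * phi k l
    - 4^-1 * (F z0 j k * phi i l - F z0 i k * phi j l).
  rewrite curvE !dOj !OjV !mulmx_block !(opp_block_mx, add_block_mx) block_mxEdr.
  rewrite (mder_rsub (Chr_smooth j sh uh)).2 (mder_rsub (Chr_smooth i sh uh)).2 -/z0.
  have ac := nbhs_singleton A_curv i j; rewrite -/z0 in ac.
  have out (u w : 'I_K) : (- (2^-1 *: (row u (F z0))^T) *m (2^-1 *: row w phi)) k l =
     - (4^-1 * (F z0 u k * phi w l)).
    by move: (F z0) => FF; rewrite mxE big_ord_recl big_ord0 addr0 !mxE; field.
  have gen (M1 M2 M3 M4 N1 N2 : 'M[R]_K) (s t : R) :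
      (M1 + s *: phi - (M2 + t *: phi) + (N1 + M3) - (N2 + M4)) k l =
      (M1 - M2 + M3 - M4) k l + (s - t) * phi k l + N1 k l - N2 k l.
    by rewrite !mxE; ring.
  rewrite gen -curvE !out -mulrBr ac; ring.
have trp : \sum_i phi i i = 0 by exact: phi_tr.
pose X := phi *m F z0.
have XE : X = phi *m phi *m h z0 by rewrite /X /F mulmxA.
have Xsym j k : X j k = X k j.
  have : X^T = X.
    rewrite XE !trmx_mul (nbhs_singleton hsym).
    have e : h z0 *m phi^T = - F z0.
      by rewrite -Fz /F trmx_mul (nbhs_singleton hsym).
    by rewrite [LHS]mulmxA e mulNmx /F -[phi *m h z0 *m _]mulmxA e mulmxN opprK /F mulmxA.
  by move=> /matrixP/(_ k j); rewrite mxE.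
have XkE j k : X k j = \sum_i F z0 i j * phi k i.
  by rewrite /X mxE; apply: eq_bigr => i _; rewrite mulrC.
have negZ p q (B : 'M[R]_(p, q)) s a c : (- (s *: B)) a c = - (s * B a c).
  by rewrite !mxE.
have opE (B : 'M[R]_(1 + K)) a c : (- B) a c = - B a c by rewrite mxE.
have ric a c : ricci G v0 a c = \sum_i curv O i a v0 c i.
  by rewrite mxE; apply: eq_bigr => i _; rewrite riemannE frame_ok.
apply/matrixP => a c; rewrite ric big_split_ord big_ord1 /=.
rewrite (_ : lshift K ord0 = lshift K 0) //.
elim/ord_case: a => [|j]; elim/ord_case: c => [|k].
- rewrite c00 zz add0r block_mxEul mxE eqxx mulr1n.
  transitivity (\sum_i - (4^-1 * (phi *m phi) i i)).
    apply: eq_bigr => i _; rewrite cj0 block_mxEur negZ -row_mul.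
    by congr (- (_ * _)); rewrite mxE.
  by rewrite sumrN -mulr_sumr.
- rewrite c00 zz add0r block_mxEur mxE big1 // => i _.
  by rewrite cj0 block_mxEdr mxE.
- rewrite c0j cj0 opE block_mxEul z1 oppr0 add0r block_mxEdl [RHS]mxE.
  transitivity (\sum_i 2^-1 * ((row j phi *m Chr h i z0) 0 i - (row i phi *m Chr h j z0) 0 i)).
    by apply: eq_bigr => i _; rewrite urij.
  have rp u (B : 'M[R]_K) l : (row u phi *m B) 0 l = (phi *m B) u l.
    by rewrite -row_mul mxE.
  rewrite -mulr_sumr sumrB.
  have E1 i : (row j phi *m Chr h i z0) 0 i = \sum_l Chr h i z0 j l * phi l i.
    by rewrite rp par mxE.
  have E2 i : (row i phi *m Chr h j z0) 0 i = \sum_l Chr h j z0 i l * phi l i.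
    by rewrite rp par mxE.
  rewrite (eq_bigr _ (fun i _ => E1 i)) [X in _ - X](eq_bigr _ (fun i _ => E2 i)).
  apply/eqP; rewrite mulf_eq0 subr_eq0; apply/orP; right; apply/eqP.
  apply: eq_bigr => i _; apply: eq_bigr => l _.
  by have /rowP/(_ l) := tor i j; rewrite [LHS]mxE [RHS]mxE => ->.
rewrite c0j cj0 opE block_mxEdl negZ opprK block_mxEdr.
rewrite (_ : 4^-1 * (phi *m (row j (F z0))^T) k 0 = - (4^-1 * X k j)); last first.
  rewrite mxE XkE -mulrN -sumrN; congr (_ * _).
  apply: eq_bigr => i _; rewrite (F_entry i j) mulNr opprK.
  by rewrite [_^T i 0]mxE [row _ _ _ _]mxE mulrC.
(* The fibre direction contributes [- X / 4], and the horizontal directions contribute [X / 2] and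
   [X / 4] besides the Ricci tensor of [h]; together they give the coefficient one half. *)
transitivity (- (4^-1 * X k j) + \sum_i (riemann h i i j k z0 +
   (2^-1 * (F z0 i j * phi k i) + (- (4^-1 * F z0 j k) * phi i i
     + 4^-1 * (F z0 i k * phi j i))))).
  congr (_ + _); apply: eq_bigr => i _; rewrite drij riemannE; ring.
have spl (f f1 f2 f3 : 'I_K -> R) : \sum_i (f i + (f1 i + (f2 i + f3 i))) =
    \sum_i f i + (\sum_i f1 i + (\sum_i f2 i + \sum_i f3 i)) by rewrite !big_split.
have addZ (B C : 'M[R]_K) s u w : (B + s *: C) u w = B u w + s * C u w by rewrite !mxE.
rewrite spl -!mulr_sumr -XkE trp mulr0 add0r -XkE addZ [ricci h z0 j k]mxE -XE (Xsym j k).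
have : 4^-1 + 4^-1 = 2^-1 :> R by lra.
move: (\sum_(i < K) _) (X k j) => S x; lra.
Qed.

End KaluzaKlein.

(** * Charts *)
Section ManifoldBasics.
Context {R : realType}.

Lemma prod_continuous (T : topologicalType) (I : eqType) (K : I -> topologicalType)
    (f : T -> prod_topology K) (x : T) :
  (forall i, {for x, continuous (fun y => f y i)}) -> {for x, continuous f}.
Proof.
move=> cf; apply/cvg_sup => i P; rewrite nbhsE => -[U [oU Ux] UP].
apply: filterS (UP) _; have [B oB BU] := oU.
have : B (f x i) by move: Ux; rewrite -BU.
move=> Bx; have H : \forall y \near x, B (f y i).
  exact: cf i B (open_nbhs_nbhs (conj oB Bx)).
have : \forall y \near x, U (f y) by apply: filterS H => y By; rewrite -BU.
by [].
Qed.

Section OneManifold.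
Context {n : nat} {T : topologicalType} (A : atlas (R := R) n T).
Hypothesis MA : smooth_manifold A.

Lemma chart_at_charts x : charts A (chart_at A x).
Proof. by have [] := chart_at_mem MA x. Qed.

Lemma chart_at_dom x : chart_dom (chart_at A x) x.
Proof. by have [] := chart_at_mem MA x. Qed.

Lemma near_chart c x : charts A c -> chart_dom c x ->
  \forall v \near chart_coord c x,
    chart_dom c (chart_param c v) /\ chart_coord c (chart_param c v) = v.
Proof.
move=> Ac cx; have oI := chart_image_open MA Ac.
have : nbhs (chart_coord c x) (chart_coord c @` chart_dom c).
  by apply: open_nbhs_nbhs; split=> //; exists x.
by apply: filterS => v [y cy <-]; rewrite (chart_coordK MA Ac cy).
Qed.

Lemma near_dom c x : charts A c -> chart_dom c x -> \forall y \near x, chart_dom c y.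
Proof. by move=> Ac cx; exact: open_nbhs_nbhs (conj (chart_dom_open MA Ac) cx). Qed.

Lemma near_coord c x (Q : 'rV[R]_n -> Prop) : charts A c -> chart_dom c x ->
  (\forall v \near chart_coord c x, Q v) -> \forall y \near x, Q (chart_coord c y).
Proof. by move=> Ac cx; exact: (chart_coord_continuous MA Ac cx). Qed.

Lemma near_param c x (Q : T -> Prop) : charts A c -> chart_dom c x ->
  (\forall y \near x, Q y) -> \forall v \near chart_coord c x, Q (chart_param c v).
Proof.
move=> Ac cx Qx; have := chart_param_continuous MA Ac cx.
by rewrite /prop_for /continuous_at (chart_coordK MA Ac cx); exact.
Qed.

End OneManifold.

Section SmoothMap.
Context {n k : nat} {T S : topologicalType} (A : atlas (R := R) n T)
  (B : atlas (R := R) k S).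
Implicit Types (f : T -> S).

Lemma smooth_at_smx f x c d : smooth_at A B f x -> charts A c -> charts B d ->
  chart_dom c x -> chart_dom d (f x) ->
  smx (fun v => chart_coord d (f (chart_param c v))) (chart_coord c x).
Proof. by move=> sf Ac Bd cx dx; apply: smx_row; have [_] := sf c d Ac Bd cx dx. Qed.

Lemma smooth_at_dom f x c d : smooth_at A B f x -> charts A c -> charts B d ->
  chart_dom c x -> chart_dom d (f x) ->
  \forall v \near chart_coord c x, chart_dom d (f (chart_param c v)).
Proof. by move=> sf Ac Bd cx dx; have [] := sf c d Ac Bd cx dx. Qed.

End SmoothMap.

Section Transition.
Context {n : nat} {T : topologicalType} (A : atlas (R := R) n T).
Hypothesis MA : smooth_manifold A.
Variables (c d : chart (R := R) n T) (x : T).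
Hypotheses (Ac : charts A c) (Ad : charts A d) (cx : chart_dom c x) (dx : chart_dom d x).

Lemma transition_smx : smx (chart_coord d \o chart_param c) (chart_coord c x).
Proof.
have [_ h] := transition_smooth MA Ac Ad cx dx.
by apply: smx_row; exact: h.
Qed.

Lemma transition_dom : \forall v \near chart_coord c x, chart_dom d (chart_param c v).
Proof. by have [h _] := transition_smooth MA Ac Ad cx dx. Qed.

End Transition.

Lemma transition_jacobianK n (T : topologicalType) (A : atlas (R := R) n T) c d x :
  smooth_manifold A -> charts A c -> charts A d -> chart_dom c x -> chart_dom d x ->
  'J (chart_coord d \o chart_param c) (chart_coord c x) *m
  'J (chart_coord c \o chart_param d) (chart_coord d x) = 1%:M.
Proof.
move=> MA Ac Ad cx dx.
have E : (chart_coord d \o chart_param c) (chart_coord c x) = chart_coord d x.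
  by rewrite /= (chart_coordK MA Ac cx).
have s1 := transition_smx MA Ac Ad cx dx.
have s2 := transition_smx MA Ad Ac dx cx; rewrite -E in s2.
rewrite -E -(jacobian_comp s1 s2).
have id1 : \forall v \near chart_coord c x,
    v = (chart_coord c \o chart_param d) ((chart_coord d \o chart_param c) v).
  apply: filterS2 (transition_dom MA Ac Ad cx dx) (near_chart MA Ac cx) => v /= dv [cv vE].
  by rewrite (chart_coordK MA Ad dv) vE.
rewrite -(jacobian_eq id1 (smx_id _)) (jacobianE (smx_id _)).
apply/matrixP => i j; rewrite !mxE /pder.
have D : derivable (@id 'rV[R]_n) (chart_coord c x) (delta_mx 0 i) by exact: derivable_id.
have := derive_mx D.
by rewrite derive_id => /matrixP/(_ 0 j); rewrite !mxE eqxx /= eq_sym => ->.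
Qed.

Lemma transition_unit n (T : topologicalType) (A : atlas (R := R) n T) c d x :
  smooth_manifold A -> charts A c -> charts A d -> chart_dom c x -> chart_dom d x ->
  'J (chart_coord d \o chart_param c) (chart_coord c x) \in unitmx.
Proof.
move=> MA Ac Ad cx dx.
by case/mulmx1_unit: (transition_jacobianK MA Ac Ad cx dx) => u _; exact: u.
Qed.

(** [pullback] evaluates in the chart chosen at the image point, which changes abruptly with the
    point. Covariance replaces it by a fixed chart [e], and only then can the pullback be
    differentiated. *)
Lemma pullback_chart n k (T : Type) (S : topologicalType) (B : atlas (R := R) k S)
    (h : tensor2 k S) (f : T -> S) (c : chart n T) (e : chart k S) v :
  smooth_manifold B -> covariant2 B h -> charts B e ->
  chart_dom e (f (chart_param c v)) ->
  smx (fun w => chart_coord e (f (chart_param c w))) v ->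
  (\forall w \near v, chart_dom e (f (chart_param c w))) ->
  let J := 'J (fun w => chart_coord e (f (chart_param c w))) v in
  pullback B f h c v = J *m h e (chart_coord e (f (chart_param c v))) *m J^T.
Proof.
move=> MB ch Be ey se near_e J; rewrite /pullback.
set y := f (chart_param c v) in ey *; set d := chart_at B y.
have Bd : charts B d := chart_at_charts MB y.
have dy : chart_dom d y := chart_at_dom MB y.
have st := transition_smx MB Be Bd ey dy.
have E : \forall w \near v, (chart_coord d \o chart_param e)
    (chart_coord e (f (chart_param c w))) = chart_coord d (f (chart_param c w)).
  by apply: filterS near_e => w ew /=; rewrite (chart_coordK MB Be ew).
have sd : smx (fun w => (chart_coord d \o chart_param e)
    (chart_coord e (f (chart_param c w)))) v by exact: smx_comp.
rewrite -(jacobian_eq E sd) (jacobian_comp se st) (ch.2 e d y) //.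
by rewrite trmx_mul !mulmxA.
Qed.

Section KahlerForm.
Context {n : nat} {T : topologicalType} (A : atlas (R := R) (n + n) T).

(** Jacobians of holomorphic transitions commute with [std_J n], which can therefore be moved past
    them. *)
Lemma kahler_form_covariant g : covariant2 A g -> holomorphic_atlas A ->
  covariant2 A (kahler_form g).
Proof.
move=> [sg cg] hol; split=> [c x j k Ac cx|c d x Ac Ad cx dx J].
  rewrite /kahler_form; under eq_fun do rewrite mxE.
  by apply: sg_sum => l; apply: sgZ; exact: sg.
rewrite /kahler_form (cg c d x) // !mulmxA; congr (_ *m _ *m _).
exact: (hol c d x).
Qed.

End KahlerForm.

Section ProductCharts.
Context {m : nat} {d : 'I_m -> nat}.

(** Column blocks of the identity matrix: the concrete inclusions that serve as [E i] in the product
    formulas. *)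
Definition coord_block (i : 'I_m) : 'M[R]_(\sum_i d i, d i) := submxrow 1%:M i.

Lemma submxrowE p (M : 'M[R]_(p, \sum_i d i)) i : submxrow M i = M *m coord_block i.
Proof. by rewrite mul_submxrow mulmx1. Qed.

Lemma coord_block_full : \sum_i coord_block i *m (coord_block i)^T = 1%:M.
Proof.
rewrite -mul_mxrow_mxcol -tr_mxrow.
have -> : \mxrow_i coord_block i = 1%:M by rewrite submxrowK.
by rewrite trmx1 mulmx1.
Qed.

Lemma coord_block_orthE i j :
  (coord_block i)^T *m coord_block j = submxblock 1%:M i j.
Proof.
rewrite /coord_block mul_submxrow mulmx1 tr_submxrow trmx1.
by apply/matrixP => a b; rewrite !mxE.
Qed.

Lemma coord_block_orth i : (coord_block i)^T *m coord_block i = 1%:M.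
Proof. by rewrite coord_block_orthE -(mxdiagZ (p_ := d) 1) /mxdiag mxblockK eqxx conform_mx_id. Qed.

Lemma coord_block_orth0 i j : i != j -> (coord_block i)^T *m coord_block j = 0.
Proof.
move=> ij; rewrite coord_block_orthE -(mxdiagZ (p_ := d) 1) /mxdiag mxblockK.
by rewrite (negbTE ij).
Qed.

Context {T : 'I_m -> topologicalType} (A : forall i, atlas (R := R) (d i) (T i)).
Hypothesis MA : forall i, smooth_manifold (A i).
Variables (e : forall i, chart (R := R) (d i) (T i)) (b : prod_topology T).
Hypotheses (Ae : forall i, charts (A i) (e i)) (eb : forall i, chart_dom (e i) (b i)).
Let X0 := product_chart e.
Let zb := chart_coord X0 b.

Lemma product_chart_charts : charts (product_atlas A) X0.
Proof. by exists e. Qed.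

Lemma product_chart_dom : chart_dom X0 b. Proof. exact: eb. Qed.

Lemma product_coord_block (y : prod_topology T) i :
  chart_coord X0 y *m coord_block i = chart_coord (e i) (y i).
Proof. by rewrite -submxrowE mxrowK. Qed.

Lemma product_near_block i (Q : 'rV[R]_(d i) -> Prop) :
  (\forall w \near chart_coord (e i) (b i), Q w) ->
  \forall z \near zb, Q (z *m coord_block i).
Proof.
rewrite -product_coord_block => H.
have c : {for zb, continuous (fun z : 'rV[R]_(\sum_i d i) => z *m coord_block i)}.
  by apply: smx_continuous; exact: smx_proj.
exact: (c Q H).
Qed.

Lemma product_param_continuous (Q : prod_topology T -> Prop) :
  (\forall y \near b, Q y) -> \forall z \near zb, Q (chart_param X0 z).
Proof.
move=> Qb; have bE : chart_param X0 zb = b.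
  apply/functional_extensionality_dep => i; rewrite /X0 /zb /= mxrowK.
  exact: (chart_coordK (MA i) (Ae i) (eb i)).
have : {for zb, continuous (chart_param X0)}.
  apply: prod_continuous => i P iP; have {iP} : nbhs (b i) P by rewrite -bE.
  move=> /(near_param (Q := P) (MA i) (Ae i) (eb i)) /product_near_block.
  by apply: filterS => z; rewrite -submxrowE.
by rewrite /prop_for /continuous_at bE; exact.
Qed.

Lemma product_near_coord (Q : 'rV[R]_(\sum_i d i) -> Prop) :
  (\forall z \near zb, Q z) -> \forall y \near b, Q (chart_coord X0 y).
Proof.
have : {for b, continuous (chart_coord X0)}; last exact.
apply: cont_mx => i k; rewrite ord1.
have -> : (fun y => chart_coord X0 y 0 k) =
    (fun y : prod_topology T => chart_coord (e (tagnat.sig1 k)) (y (tagnat.sig1 k)) 0 (tagnat.sig2 k)).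
  by apply/funext => y; rewrite mxE.
apply: (cont_entry (F := fun y : prod_topology T => chart_coord (e (tagnat.sig1 k)) (y (tagnat.sig1 k)))).
apply: (@continuous_comp _ _ _ (fun y : prod_topology T => y (tagnat.sig1 k))
  (chart_coord (e (tagnat.sig1 k)))).
  exact: (@proj_continuous _ T (tagnat.sig1 k) b).
exact: (chart_coord_continuous (MA _) (Ae _) (eb _)).
Qed.

Lemma product_coordK (y : prod_topology T) :
  (forall i, chart_dom (e i) (y i)) -> chart_param X0 (chart_coord X0 y) = y.
Proof.
move=> ey; apply/functional_extensionality_dep => i; rewrite /X0 /= mxrowK.
exact: (chart_coordK (MA i) (Ae i) (ey i)).
Qed.

Lemma product_near_dom : \forall y \near b, chart_dom X0 y.
Proof.
apply: (near_fin (P := fun i (y : prod_topology T) => chart_dom (e i) (y i))) => i.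
apply: (@proj_continuous _ T i b).
exact: (near_dom (MA i) (Ae i) (eb i)).
Qed.

End ProductCharts.
End ManifoldBasics.

(** * The Einstein equation at a point where the connection form need not vanish *)

Section KaluzaKleinEinstein.
Context {R : realType} {K : nat}.
Variables (h : 'rV[R]_K -> 'M[R]_K) (phi : 'M[R]_K).
Variables (A : 'rV[R]_(1 + K) -> 'rV[R]_K) (G : 'rV[R]_(1 + K) -> 'M[R]_(1 + K)).
Variable v0 : 'rV[R]_(1 + K).
Let z0 := rsubmx v0.
Hypotheses (sh : smx h z0) (uh : h z0 \in unitmx)
  (hsym : \forall z \near z0, (h z)^T = h z)
  (phi_parallel : \forall z \near z0, forall k : 'I_K, phi *m Chr h k z = Chr h k z *m phi)
  (F_antisym : \forall z \near z0, (phi *m h z)^T = - (phi *m h z))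
  (phi_tr : \tr phi = 0) (sA : smx A v0)
  (A_vert : \forall v \near v0, mder (lshift K 0) A v = 0)
  (A_curv : \forall v \near v0, forall j k : 'I_K,
     mder (rshift 1 j) A v 0 k - mder (rshift 1 k) A v 0 j = (phi *m h (rsubmx v)) j k)
  (GE : \forall v \near v0, G v = (row_mx 1%:M (A v))^T *m row_mx 1%:M (A v) +
     block_mx 0 0 0 (h (rsubmx v))).

Let alpha := A v0.
Let JS : 'M[R]_(1 + K) := block_mx 1%:M 0 (- alpha^T) 1%:M.
Let S (v : 'rV[R]_(1 + K)) := v *m JS - v0 *m JS + v0.

Let S_fix : S v0 = v0. Proof. by rewrite /S subrr add0r. Qed.

Let S_smooth v : smx S v.
Proof.
by apply: smxD (smx_cst _ _); apply: smxB (smx_cst _ _); apply: smxM (smx_cst _ _); exact: smx_id.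
Qed.

Let S_jacobian v : 'J S v = JS.
Proof.
rewrite (jacobianE (S_smooth v)).
have E i j : pder i (fun w => S w 0 j) v = mder i S v 0 j by rewrite mderE.
apply/matrixP => i j; rewrite mxE E /S mderD; last 2 first.
- by apply: smxB (smx_cst _ _); apply: smxM (smx_cst _ _); exact: smx_id.
- exact: smx_cst.
rewrite mderB; last 2 first.
- by apply: smxM (smx_cst _ _); exact: smx_id.
- exact: smx_cst.
rewrite !mder_cst addr0 subr0 mderM; [|exact: smx_id|exact: smx_cst].
rewrite mder_cst mulmx0 addr0.
have -> : mder i id v = delta_mx 0 i.
  apply/matrixP => a b; rewrite mderE ord1 /pder.
  have D : derivable (@id 'rV[R]_(1 + K)) v (delta_mx 0 i) by exact: derivable_id.
  have := derive_mx D; rewrite derive_id => /matrixP/(_ 0 b).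
  by rewrite [X in _ = X -> _]mxE => <-.
by rewrite -rowE mxE.
Qed.

Let S_rsub v : rsubmx (S v) = rsubmx v.
Proof.
have E (w : 'rV[R]_(1 + K)) : rsubmx (w *m JS) = rsubmx w.
  by rewrite -[w in LHS]hsubmxK /JS mul_row_block row_mxKr mulmx0 add0r mulmx1.
by rewrite /S -mulmxBl linearD /= E linearB /= subrK.
Qed.

Let near_S Q : (\forall v \near v0, Q v) -> \forall v \near v0, Q (S v).
Proof. by move=> H; have := smx_continuous (S_smooth v0); apply; rewrite S_fix. Qed.

Let JS_unit : JS \in unitmx.
Proof. by rewrite unitmxE det_lblock !det1 mulr1 unitr1. Qed.

(* The shear [S] fixes [v0] and makes the connection form vanish there. *)
Lemma kaluza_klein_einstein lambda :
  - (4^-1 * \tr (phi *m phi)) = lambda ->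
  ricci h z0 + 2^-1 *: (phi *m phi *m h z0) = lambda *: h z0 ->
  ricci G v0 = lambda *: G v0.
Proof.
move=> l1 l2.
have [uG sG] := kaluza_klein_unit sh uh sA GE.
pose A' v := A (S v) - alpha; pose G' v := JS *m G (S v) *m JS^T.
have sAS : smx (fun v => A (S v)) v0 by apply: smx_comp (S_smooth v0) _ _ _ _; rewrite S_fix.
have mA i v : smx A (S v) -> mder i A' v = \sum_k JS i k *: mder k A (S v).
  move=> s; rewrite mderB; [|exact: smx_comp (S_smooth v) _ _ _ s|exact: smx_cst].
  by rewrite mder_cst subr0 (mder_comp (S_smooth v)) // S_jacobian.
have mA0 v : smx A (S v) -> mder (lshift K 0) A' v = mder (lshift K 0) A (S v).
  move=> s; rewrite mA // big_split_ord /= big_ord1 big1 => [|k _].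
    by rewrite /JS block_mxEul mxE eqxx scale1r addr0.
  by rewrite /JS block_mxEur mxE scale0r.
have mAr j v : smx A (S v) -> mder (lshift K 0) A (S v) = 0 ->
    mder (rshift 1 j) A' v = mder (rshift 1 j) A (S v).
  move=> s v0A; rewrite mA // big_split_ord /= big_ord1 v0A scaler0 add0r (bigD1 j) //=.
  rewrite big1 => [|k kj]; first by rewrite /JS block_mxEdr mxE eqxx scale1r addr0.
  by rewrite /JS block_mxEdr mxE eq_sym (negbTE kj) scale0r.
have GE' : \forall v \near v0, G' v = (row_mx 1%:M (A' v))^T *m row_mx 1%:M (A' v) +
     block_mx 0 0 0 (h (rsubmx v)).
  apply: filterS (near_S GE) => v; rewrite /G' S_rsub => ->.
  have row_JS : row_mx 1%:M (A (S v)) *m JS^T = row_mx 1%:M (A' v).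
    rewrite /JS tr_block_mx mul_row_block !trmx1 !trmx0 !mulmx0 addr0 !mulmx1.
    by rewrite linearN /= trmxK mulmxN mul1mx addrC.
  rewrite mulmxDr mulmxDl !mulmxA -row_JS trmx_mul trmxK -!mulmxA row_JS; congr (_ + _).
  rewrite /JS tr_block_mx !mulmx_block !trmx1 !trmx0.
  by rewrite !(mulmx0, mul0mx, addr0, add0r, mulmx1, mul1mx).
have A'0 : A' v0 = 0 by rewrite /A' S_fix subrr.
have sA' : smx A' v0 by apply: smxB (smx_cst _ _).
have near_A : \forall v \near v0, smx A (S v) by exact: near_S (smx_near sA).
have A'_vert : \forall v \near v0, mder (lshift K 0) A' v = 0.
  by apply: filterS2 near_A (near_S A_vert) => v s E; rewrite mA0.
have A'_curv : \forall v \near v0, forall j k : 'I_K,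
     mder (rshift 1 j) A' v 0 k - mder (rshift 1 k) A' v 0 j = (phi *m h (rsubmx v)) j k.
  apply: filterS3 near_A (near_S A_vert) (near_S A_curv) => v s E C j k.
  by rewrite !mAr // C S_rsub.
have KK := kaluza_klein_ricci sh uh hsym phi_parallel F_antisym phi_tr sA' A'0 A'_vert A'_curv GE'.
have Gsym : \forall v \near v0, (G v)^T = G v.
  have hs : \forall v \near v0, (h (rsubmx v))^T = h (rsubmx v).
    have c := smx_continuous (smx_rsub v0).
    exact: (c (fun z => (h z)^T = h z) hsym).
  apply: filterS2 GE hs => v -> hv; rewrite linearD /= trmx_mul trmxK; congr (_ + _).
  by rewrite tr_block_mx !trmx0 hv.
have NR : ricci G' v0 = JS *m ricci G v0 *m JS^T.
  rewrite -{2}S_fix -(S_jacobian v0); apply: natural_ricci; rewrite ?S_fix ?S_jacobian //.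
  by near=> v; rewrite S_jacobian.
have EG' : G' v0 = block_mx 1%:M 0 0 (h z0).
  have := nbhs_singleton GE'; rewrite A'0 => ->.
  by rewrite tr_row_mx mul_col_row !trmx1 !trmx0 !(mulmx0, mul0mx, mulmx1) add_block_mx !(addr0, add0r).
have : JS *m ricci G v0 *m JS^T = JS *m (lambda *: G v0) *m JS^T.
  rewrite -NR KK l1 l2 -scalemxAr -scalemxAl -[in RHS]S_fix -/(G' v0) EG'.
  by rewrite scale_block_mx !scaler0 scale_scalar_mx mulr1.
by move=> /(can_inj (mulmxK _)) H; apply: (can_inj (mulKmx JS_unit)); apply: H; rewrite unitmx_tr.
Unshelve. all: by end_near. Qed.

End KaluzaKleinEinstein.

(** * Coordinates adapted to the circle bundle *)
Section AdaptedChart.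
Context {R : realType} {m : nat} {d : 'I_m -> nat} {M : 'I_m -> topologicalType}.
Variable A : forall i, atlas (R := R) (d i) (M i).
Hypothesis MA : forall i, smooth_manifold (A i).
Let K := (\sum_i d i)%N.
Context {P : topologicalType} (AP : atlas (R := R) (1 + \sum_i d i) P).
Variables (act : R -> P -> P) (proj : P -> prod_topology M).
Hypothesis P_bundle : principal_circle_bundle AP (product_atlas A) act proj.
Variable sigma : tensor1 (R := R) (1 + \sum_i d i) P.
Hypothesis sigma_conn : principal_connection AP act sigma.

Lemma proj_act t x : proj (act t x) = proj x.
Proof. by apply/esym/(pcb_fibre P_bundle); exists t. Qed.

(* [psi (r, z)] is the coordinate vector of [act (t0 + r) (s z)], where [s] is a
   local section over a product chart and [x0 = act t0 (s (proj x0))]. *)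
Lemma adapted_chart c x0 : charts AP c -> chart_dom c x0 ->
  let e i := chart_at (A i) (proj x0 i) in
  exists (psi : 'rV[R]_(1 + K) -> 'rV[R]_(1 + K)) (v0 : 'rV[R]_(1 + K)),
  [/\ psi v0 = chart_coord c x0,
      forall i, rsubmx v0 *m coord_block i = chart_coord (e i) (proj x0 i),
      smx psi v0 &
      \forall v \near v0,
        [/\ exists x, [/\ chart_dom c x, chart_coord c x = psi v & forall i,
              proj x i = chart_param (e i) (rsubmx v *m coord_block i)] &
            lsubmx (sigma c (psi v) *m ('J psi v)^T) = 1%:M]].
Proof.
move=> Ac cx0 e.
have MP := pcb_manifold P_bundle.
set b := proj x0.
pose X0 := product_chart e; pose zb := chart_coord X0 b.
have Ae i : charts (A i) (e i) by exact: chart_at_charts.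
have eb i : chart_dom (e i) (b i) by exact: chart_at_dom.
have [U [oU Ub] [s [_ [_ [sU _ _]]]]] := pcb_trivial P_bundle b.
have [ss sb] := sU b Ub.
have [t0 x0E] : exists t, x0 = act t (s b) by apply/(pcb_fibre P_bundle).
pose dP := chart_at AP (s b).
have Ad : charts AP dP := chart_at_charts MP _.
have dsb : chart_dom dP (s b) := chart_at_dom MP _.
pose v0 : 'rV[R]_(1 + K) := row_mx 0 zb.
pose xv (v : 'rV[R]_(1 + K)) := act (t0 + lsubmx v 0 0) (s (chart_param X0 (rsubmx v))).
pose psi v := chart_coord c (xv v).
have v0r : rsubmx v0 = zb by rewrite row_mxKr.
have v0l : lsubmx v0 = 0 by rewrite row_mxKl.
have bE : chart_param X0 zb = b by exact: product_coordK.
have xv0 : xv v0 = x0 by rewrite /xv v0r v0l mxE addr0 bE.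
have near_r (Q : 'rV[R]_K -> Prop) : (\forall z \near zb, Q z) -> \forall v \near v0, Q (rsubmx v).
  move=> H; have c0 := smx_continuous (smx_rsub v0).
  by apply: (c0 Q); rewrite v0r.
have near_b (Q : prod_topology M -> Prop) : (\forall y \near b, Q y) ->
    \forall v \near v0, Q (chart_param X0 (rsubmx v)).
  move=> /(product_param_continuous MA Ae eb) H.
  exact: (near_r (fun z => Q (chart_param X0 z)) H).
have nU : \forall v \near v0, U (chart_param X0 (rsubmx v)).
  exact: near_b (open_nbhs_nbhs (conj oU Ub)).
(* Near [v0] the map [psi] factors as [F \o w] through the cylinder chart around [(t0, s b)]: the
   smoothness of the section gives that of [w], the smoothness of the action that of [F]. *)
pose w (v : 'rV[R]_(1 + K)) : 'rV[R]_(1 + (1 + K)) :=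
  row_mx (t0%:M + lsubmx v) (chart_coord dP (s (chart_param X0 (rsubmx v)))).
pose F (u : 'rV[R]_(1 + (1 + K))) : 'rV[R]_(1 + K) :=
  chart_coord c (act (lsubmx u 0 0) (chart_param dP (rsubmx u))).
have w0 : w v0 = row_mx (const_mx t0) (chart_coord dP (s b)).
  rewrite /w v0r v0l bE addr0; congr row_mx.
  by apply/matrixP => i j; rewrite !ord1 !mxE.
have cX0 : charts (product_atlas A) X0 by exact: product_chart_charts.
have sw : smx w v0.
  apply: smx_row_mx.
    apply: smxD; first exact: smx_cst.
    exact: (smx_linear (lsubmx : {linear 'rV[R]_(1 + K) -> 'rV[R]_1})).
  have h : smx (fun z => chart_coord dP (s (chart_param X0 z))) (rsubmx v0).
    by rewrite v0r; exact: (smooth_at_smx ss cX0 Ad).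
  exact: (smx_comp (smx_rsub v0) h).
have cz : charts (cylinder_atlas AP) (cylinder_chart dP) by exists dP.
have sact : smooth_at (cylinder_atlas AP) AP (fun z => act z.1 z.2) (t0, s b).
  exact: (pcb_act_smooth P_bundle).
have cF : chart_dom c ((fun z : R * P => act z.1 z.2) (t0, s b)) by rewrite /= -x0E.
have domF : \forall u \near w v0, chart_dom c (act (lsubmx u 0 0) (chart_param dP (rsubmx u))).
  by rewrite w0; exact: (smooth_at_dom sact cz Ac dsb cF).
have sF : smx F (w v0) by rewrite w0; exact: (smooth_at_smx sact cz Ac dsb cF).
have ndP : \forall v \near v0, chart_param dP (rsubmx (w v)) = s (chart_param X0 (rsubmx v)).
  have := near_r _ (smooth_at_dom ss cX0 Ad (product_chart_dom eb) dsb).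
  apply: filterS => v dv; rewrite row_mxKr.
  exact: (chart_coordK MP Ad dv).
have xvE v : chart_param dP (rsubmx (w v)) = s (chart_param X0 (rsubmx v)) ->
    act (lsubmx (w v) 0 0) (chart_param dP (rsubmx (w v))) = xv v.
  by move=> ->; rewrite row_mxKl mxE [t0%:M 0 0]mxE eqxx.
have ndc : \forall v \near v0, chart_dom c (xv v).
  have H : \forall v \near v0, chart_dom c (act (lsubmx (w v) 0 0) (chart_param dP (rsubmx (w v)))).
    have cw := smx_continuous sw.
    exact: (cw (fun u => chart_dom c (act (lsubmx u 0 0) (chart_param dP (rsubmx u)))) domF).
  by apply: filterS2 ndP H => v /xvE ->.
have spsi : smx psi v0.
  apply: (smx_eq _ (smx_comp sw sF)); apply: filterS ndP => v /xvE.
  by rewrite /F => ->.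
exists psi, v0; split=> //; first by rewrite /psi xv0.
- by move=> i; rewrite v0r product_coord_block.
have near_psi := smx_near spsi.
near=> v.
have cv : chart_dom c (xv v) by near: v.
have Uv : U (chart_param X0 (rsubmx v)) by near: v.
have sv : smx psi v by near: v.
split.
  exists (xv v); split=> // i.
  by rewrite proj_act (sU _ Uv).2 /= submxrowE.
apply/matrixP => i j; rewrite !ord1 mxE [RHS]mxE eqxx.
rewrite -[RHS](conn_vertical sigma_conn Ac cv) mxE; apply: eq_bigr => k _.
congr (_ * _); rewrite mxE (jacobianE sv) mxE /pder derive1E /derive.
(* Moving along the first coordinate is the circle action, so the first row of the Jacobian is the
   generator of the action, on which [sigma] takes the value 1. *)
have E h : psi (h *: delta_mx 0 (lshift K 0) + v) = chart_coord c (act h (xv v)).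
  rewrite /psi /xv -(pcb_actD P_bundle) !linearD !linearZ /= .
  have -> : rsubmx (delta_mx 0 (lshift K 0) : 'rV[R]_(1 + K)) = 0.
    by apply/matrixP => a l; rewrite !mxE eq_rlshift andbF.
  rewrite scaler0 add0r; congr (chart_coord c (act _ _)).
  by rewrite !mxE eqxx mulr1 addrCA.
rewrite (_ : (fun h : R => h^-1 *: (((fun v1 => psi v1 0 k) \o shift v)
    (h *: delta_mx 0 (lshift K 0)) - psi v 0 k)) = (fun h : R => h^-1 *:
    (((fun t : R => chart_coord c (act t (xv v)) 0 k) \o shift 0) (h *: (1 : R)) -
     chart_coord c (act 0 (xv v)) 0 k))) //.
apply/funext => h /=.
by rewrite E addr0 [h *: 1]mulr1 (pcb_act0 P_bundle).
Unshelve. all: by end_near. Qed.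
End AdaptedChart.

(** * The exterior derivative of one-forms under pullback *)

Section ExteriorDerivative.
Context {R : realType} {p n : nat}.

Definition d1 k (s : 'rV[R]_k -> 'rV[R]_k) (x : 'rV[R]_k) : 'M[R]_k :=
  \matrix_(i, j) (mder i s x 0 j - mder j s x 0 i).

Lemma d1E k (s : 'rV[R]_k -> 'rV[R]_k) x i j :
  d1 s x i j = mder i s x 0 j - mder j s x 0 i.
Proof. by rewrite mxE. Qed.

Lemma d1_pullback (s : 'rV[R]_p -> 'rV[R]_p) (psi : 'rV[R]_n -> 'rV[R]_p)
    (mu : 'rV[R]_n -> 'rV[R]_n) x : smx psi x -> smx s (psi x) ->
  (\forall v \near x, mu v = s (psi v) *m ('J psi v)^T) ->
  d1 mu x = 'J psi x *m d1 s (psi x) *m ('J psi x)^T.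
Proof.
move=> spsi ss muE.
have sJ := smx_J spsi.
have mE i j : mder i mu x 0 j =
    (\sum_k (\sum_l 'J psi x i l * mder l s (psi x) 0 k) * 'J psi x j k) +
    \sum_k s (psi x) 0 k * mder i (jacobian psi) x j k.
  rewrite (mder_eq i muE) mderM; [|exact: smx_comp spsi _ _ _ ss|exact: smx_tr].
  rewrite mxE mder_tr; congr (_ + _); rewrite mxE; apply: eq_bigr => k _; rewrite [X in _ * X]mxE //.
  rewrite (mder_comp spsi _ ss) summxE; congr (_ * _).
  by apply: eq_bigr => l _; rewrite mxE.
apply/matrixP => i j; rewrite mxE !mE.
have -> : \sum_k s (psi x) 0 k * mder i (jacobian psi) x j k =
    \sum_k s (psi x) 0 k * mder j (jacobian psi) x i k.
  by apply: eq_bigr => k _; congr (_ * _); exact: (mder_jacobian_sym spsi).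
rewrite opprD addrACA subrr addr0 mxE.
have -> : \sum_k (\sum_l 'J psi x j l * mder l s (psi x) 0 k) * 'J psi x i k =
   \sum_k (\sum_l 'J psi x i l * mder k s (psi x) 0 l) * 'J psi x j k.
  under eq_bigr do rewrite mulr_suml; rewrite exchange_big /=; apply: eq_bigr => k _.
  by rewrite mulr_suml; apply: eq_bigr => l _; rewrite mulrAC [in RHS]mulrAC -!mulrA [X in _ * X]mulrC; ring.
rewrite -sumrB; apply: eq_bigr => k _; rewrite [X in _ = _ * X]mxE -mulrBl; congr (_ * _).
rewrite mxE -sumrB; apply: eq_bigr => l _; rewrite [X in _ = _ * X]mxE.
by rewrite mulrBr.
Qed.

Lemma exterior_d1E k (T : Type) (s : tensor1 (R := R) k T) c v :
  exterior_d1 s c v = d1 (s c) v.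
Proof. by apply/matrixP => i j; rewrite !mxE !mderE. Qed.

End ExteriorDerivative.

Lemma block_dr_sum (R : realType) (I : finType) a b (F : I -> 'M[R]_b) :
  block_mx (0 : 'M[R]_a) 0 0 (\sum_i F i) = \sum_i block_mx 0 0 0 (F i).
Proof.
apply: (big_morph (fun X : 'M[R]_b => block_mx (0 : 'M[R]_a) 0 0 X)) => [X Z|].
  by rewrite add_block_mx !addr0.
exact: block_mx_const.
Qed.

Section AdaptedFrame.
Context {R : realType} {m : nat} {d : 'I_m -> nat} {M : 'I_m -> topologicalType}.
Variable A : forall i, atlas (R := R) (d i) (M i).
Hypothesis MA : forall i, smooth_manifold (A i).
Let K := (\sum_i d i)%N.
Context {P : topologicalType} (AP : atlas (R := R) (1 + \sum_i d i) P).
Variables (act : R -> P -> P) (proj : P -> prod_topology M).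
Hypothesis P_bundle : principal_circle_bundle AP (product_atlas A) act proj.
Variable sigma : tensor1 (R := R) (1 + \sum_i d i) P.
Hypothesis sigma_conn : principal_connection AP act sigma.
Let MP := pcb_manifold P_bundle.
Let E i : 'M[R]_(\sum_i d i, d i) := coord_block i.

Section ProjCoord.
Variables (c : chart (R := R) (1 + K) P) (x : P) (e : forall i, chart (R := R) (d i) (M i)).
Hypotheses (Ac : charts AP c) (cx : chart_dom c x)
  (Ae : forall i, charts (A i) (e i)) (ex : forall i, chart_dom (e i) (proj x i)).

Definition proj_coord i (w : 'rV[R]_(1 + K)) : 'rV[R]_(d i) :=
  chart_coord (e i) (proj (chart_param c w) i).

Lemma proj_smx i : smx (proj_coord i) (chart_coord c x).
Proof.
have cX := product_chart_charts Ae.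
have sp : smooth_at AP (product_atlas A) proj x by exact: (pcb_proj_smooth P_bundle).
have s := smooth_at_smx sp Ac cX cx ex.
have h := smx_comp s (smx_proj (fun i => E i) i _).
apply: smx_eq h; near=> w.
by rewrite /proj_coord /E -submxrowE mxrowK.
Unshelve. all: by end_near. Qed.

Lemma proj_dom : \forall w \near chart_coord c x, forall i, chart_dom (e i) (proj (chart_param c w) i).
Proof.
have cX := product_chart_charts Ae.
have sp : smooth_at AP (product_atlas A) proj x by exact: (pcb_proj_smooth P_bundle).
exact: (smooth_at_dom sp Ac cX cx ex).
Qed.

Lemma pullback_proj : \forall w \near chart_coord c x,
  forall i (h : tensor2 (R := R) (d i) (M i)), covariant2 (A i) h ->
  pullback (A i) (fun y => proj y i) h c w =
  'J (proj_coord i) w *m h (e i) (proj_coord i w) *m ('J (proj_coord i) w)^T.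
Proof.
have s : \forall w \near chart_coord c x, forall i, smx (proj_coord i) w.
  by apply: near_fin => i; exact: smx_near (proj_smx i).
have nd := near_join proj_dom.
near=> w.
have sw : forall i, smx (proj_coord i) w by near: w; exact: s.
have dw : \forall w \near w, forall i, chart_dom (e i) (proj (chart_param c w) i).
  by near: w; exact: nd.
move=> i h ch; apply: pullback_chart => //.
- exact: (nbhs_singleton dw).
- by apply: filterS dw => v; apply.
Unshelve. all: by end_near. Qed.

End ProjCoord.

(** In these coordinates [sigma] is dr + [mu] and tensors pulled back from a factor live in its
    block. The last clause is stated for every covariant tensor because it serves both for the
    metrics and for the Kaehler forms. *)
Lemma adapted_frame c x0 : charts AP c -> chart_dom c x0 ->
  let e i := chart_at (A i) (proj x0 i) in
  exists (psi : 'rV[R]_(1 + K) -> 'rV[R]_(1 + K)) (v0 : 'rV[R]_(1 + K))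
    (mu : 'rV[R]_(1 + K) -> 'rV[R]_K),
  [/\ psi v0 = chart_coord c x0,
      forall i, rsubmx v0 *m coord_block i = chart_coord (e i) (proj x0 i),
      smx psi v0, smx mu v0 &
      \forall v \near v0,
        [/\ 'J psi v \in unitmx, exists2 x, chart_dom c x & chart_coord c x = psi v,
            sigma c (psi v) *m ('J psi v)^T = row_mx 1%:M (mu v) &
            forall i (h : tensor2 (R := R) (d i) (M i)), covariant2 (A i) h ->
              'J psi v *m pullback (A i) (fun y => proj y i) h c (psi v) *m ('J psi v)^T =
              block_mx 0 0 0 (coord_block i *m h (e i) (rsubmx v *m coord_block i) *m
                              (coord_block i)^T)]].
Proof.
move=> Ac cx0 e.
have [psi [v0 [psi0 v0E spsi psiP]]] := adapted_chart MA P_bundle sigma_conn Ac cx0.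
exists psi, v0, (fun v => rsubmx (sigma c (psi v) *m ('J psi v)^T)).
have Ae i : charts (A i) (e i) by exact: chart_at_charts.
have eb i : chart_dom (e i) (proj x0 i) by exact: chart_at_dom.
have ssig : smx (sigma c) (psi v0).
  by rewrite psi0; apply: smx_row => j; exact: (conn_form sigma_conn).1.
have sJ := smx_J spsi.
split=> //.
  have h : smx (fun v => sigma c (psi v) *m ('J psi v)^T) v0.
    by apply: smxM; [exact: smx_comp spsi _ _ _ ssig|exact: smx_tr].
  exact: (smx_comp h (smx_rsub _)).
have near_psi (Q : 'rV[R]_(1 + K) -> Prop) : (\forall w \near chart_coord c x0, Q w) ->
    \forall v \near v0, Q (psi v).
  by move=> H; have cpsi := smx_continuous spsi; apply: (cpsi Q); rewrite psi0.
have npb := near_psi _ (pullback_proj Ac cx0 Ae eb).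
have ns : \forall v \near v0, forall i, smx (proj_coord c e i) (psi v).
  apply: (near_psi (fun w => forall i, smx (proj_coord c e i) w)).
  by apply: near_fin => i; exact: smx_near (proj_smx Ac cx0 Ae eb i).
have nspsi := smx_near spsi.
have nchart : \forall v \near v0, forall i,
    chart_dom (e i) (chart_param (e i) (rsubmx v *m coord_block i)) /\
    chart_coord (e i) (chart_param (e i) (rsubmx v *m coord_block i)) = rsubmx v *m coord_block i.
  apply: near_fin => i.
  have h : smx (fun v : 'rV[R]_(1 + K) => rsubmx v *m E i) v0.
    exact: (smx_comp (smx_rsub v0) (smx_proj (fun i => E i) i _)).
  have ch := smx_continuous h.
  apply: (ch (fun z => chart_dom (e i) (chart_param (e i) z) /\
    chart_coord (e i) (chart_param (e i) z) = z)).
  by rewrite v0E; exact: (near_chart (MA i) (Ae i) (eb i)).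
have nprE : \forall v \near v0, forall i, proj_coord c e i (psi v) = rsubmx v *m E i.
  apply: filterS2 psiP nchart => v [[x [cx xE px]] _] cv i.
  rewrite /proj_coord -xE (chart_coordK MP Ac cx) px.
  by have [_ ->] := cv i.
have nnprE := near_join nprE.
have nJ : \forall v \near v0, forall i,
    'J psi v *m 'J (proj_coord c e i) (psi v) = col_mx 0 (E i).
  near=> v => i.
  have sv : smx psi v by near: v.
  have sp : forall i, smx (proj_coord c e i) (psi v) by near: v; exact: ns.
  have nE : \forall v \near v, forall i, proj_coord c e i (psi v) = rsubmx v *m E i.
    by near: v; exact: nnprE.
  rewrite -(jacobian_comp sv (sp i)).
  have sE := smx_proj (fun i => E i) i (rsubmx v).
  have -> : 'J (fun v => proj_coord c e i (psi v)) v = 'J (fun v : 'rV[R]_(1 + K) => rsubmx v *m E i) v.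
    by apply: jacobian_eq (smx_comp sv (sp i)); apply: filterS nE => w; apply.
  rewrite (jacobian_comp (smx_rsub v) sE) jacobian_rsub jacobian_proj.
  by rewrite mul_col_mx mul0mx mul1mx.
near=> v.
have [[x [cx xE px]] s1] : [/\ exists x, [/\ chart_dom c x, chart_coord c x = psi v & forall i,
              proj x i = chart_param (e i) (rsubmx v *m coord_block i)] &
            lsubmx (sigma c (psi v) *m ('J psi v)^T) = 1%:M] by near: v; exact: psiP.
have Jv : forall i, 'J psi v *m 'J (proj_coord c e i) (psi v) = col_mx 0 (E i).
  by near: v; exact: nJ.
have prE : forall i, proj_coord c e i (psi v) = rsubmx v *m E i by near: v; exact: nprE.
have pb : forall i (h : tensor2 (R := R) (d i) (M i)), covariant2 (A i) h ->
  pullback (A i) (fun y => proj y i) h c (psi v) =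
  'J (proj_coord c e i) (psi v) *m h (e i) (proj_coord c e i (psi v)) *m
  ('J (proj_coord c e i) (psi v))^T by near: v; exact: npb.
have s2 : sigma c (psi v) *m ('J psi v)^T =
    row_mx 1%:M (rsubmx (sigma c (psi v) *m ('J psi v)^T)) by rewrite -s1 hsubmxK.
split=> //; last 2 first.
- by exists x.
- move=> i h ch; rewrite pb // !mulmxA Jv -mulmxA -trmx_mul Jv prE.
  rewrite mul_col_mx mul0mx tr_col_mx trmx0 mul_col_row !(mul0mx, mulmx0).
  by [].
(* A row killed by ['J psi v] is also killed after composing with the projections, so it has no base
   part; pairing with [sigma] then shows that it has no fibre part. *)
rewrite -row_free_unit -kermx_eq0; apply/rowV0P => u /sub_kermxP u0.
have ur : rsubmx u = 0.
  rewrite -[rsubmx u]mulmx1 -coord_block_full mulmx_sumr big1 // => i _.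
  have : u *m 'J psi v *m 'J (proj_coord c e i) (psi v) = 0 by rewrite u0 mul0mx.
  rewrite -mulmxA Jv -[u in u *m _]hsubmxK mul_row_col mulmx0 add0r mulmxA => ->.
  by rewrite mul0mx.
have : sigma c (psi v) *m ('J psi v)^T *m u^T = 0.
  by rewrite -mulmxA -trmx_mul u0 trmx0 mulmx0.
rewrite s2 -{1}[u]hsubmxK tr_row_mx mul_row_col mul1mx ur trmx0 mulmx0 addr0.
move=> /(congr1 trmx); rewrite trmxK trmx0 => ul.
by rewrite -[u]hsubmxK ul ur row_mx0.
Unshelve. all: by end_near. Qed.

(** The fibre component of [sigma] is constantly 1, so the mixed entries of its exterior derivative
    are the fibre derivatives of [mu]. They vanish because the curvature comes from the base, and
    the remaining entries are the curl of [mu]. *)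
Lemma adapted_curvature c psi v0 (mu : 'rV[R]_(1 + K) -> 'rV[R]_K)
    (e : forall i, chart (R := R) (d i) (M i)) (q : 'I_m -> R)
    (om : forall i, tensor2 (R := R) (d i) (M i)) :
  charts AP c -> smx psi v0 -> smx (sigma c) (psi v0) -> smx mu v0 ->
  (\forall v \near v0,
     [/\ 'J psi v \in unitmx, exists2 x, chart_dom c x & chart_coord c x = psi v,
         sigma c (psi v) *m ('J psi v)^T = row_mx 1%:M (mu v) &
         forall i (h : tensor2 (R := R) (d i) (M i)), covariant2 (A i) h ->
           'J psi v *m pullback (A i) (fun y => proj y i) h c (psi v) *m ('J psi v)^T =
           block_mx 0 0 0 (coord_block i *m h (e i) (rsubmx v *m coord_block i) *m
                           (coord_block i)^T)]) ->
  (forall i, covariant2 (A i) (om i)) ->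
  (forall c x, charts AP c -> chart_dom c x ->
    exterior_d1 sigma c (chart_coord c x) =
    \sum_i q i *: pullback (A i) (fun y => proj y i) (om i) c (chart_coord c x)) ->
  \forall v \near v0, mder (lshift K 0) mu v = 0 /\
    forall j k, mder (rshift 1 j) mu v 0 k - mder (rshift 1 k) mu v 0 j =
      (\sum_i q i *: (coord_block i *m om i (e i) (rsubmx v *m coord_block i) *m
                       (coord_block i)^T)) j k.
Proof.
move=> Ac spsi ssig smu psiP com curv.
pose nu v := sigma c (psi v) *m ('J psi v)^T.
have nspsi := smx_near spsi; have nsmu := smx_near smu.
have nssig : \forall v \near v0, smx (sigma c) (psi v).
  have cpsi := smx_continuous spsi.
  exact: (cpsi (fun w => smx (sigma c) w) (smx_near ssig)).
have npsiP := near_join psiP.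
near=> v.
have sv : smx psi v by near: v.
have smv : smx mu v by near: v.
have ssv : smx (sigma c) (psi v) by near: v.
have near_v : \forall v \near v,
     [/\ 'J psi v \in unitmx, exists2 x, chart_dom c x & chart_coord c x = psi v,
         sigma c (psi v) *m ('J psi v)^T = row_mx 1%:M (mu v) &
         forall i (h : tensor2 (R := R) (d i) (M i)), covariant2 (A i) h ->
           'J psi v *m pullback (A i) (fun y => proj y i) h c (psi v) *m ('J psi v)^T =
           block_mx 0 0 0 (coord_block i *m h (e i) (rsubmx v *m coord_block i) *m
                           (coord_block i)^T)] by near: v; exact: npsiP.
have [_ [x cx xE] _ pb] := nbhs_singleton near_v.
have nuE : \forall w \near v, row_mx 1%:M (mu w) = nu w.
  by apply: filterS near_v => w [].
have ml i : mder i nu v 0 (lshift K 0) = 0.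
  rewrite -(mder_eq i nuE) mderE.
  have H : \forall w \near v, (fun=> 1 : R) w = (row_mx (1%:M : 'M[R]_1) (mu w)) 0 (lshift K 0).
    by near=> w; rewrite row_mxEl mxE eqxx.
  by rewrite -(pder_eq i H) pder_cst.
have mr i k : mder i nu v 0 (rshift 1 k) = mder i mu v 0 k.
  rewrite -(mder_eq i nuE) !mderE; apply: pder_eq; near=> w.
  by rewrite row_mxEr.
pose Phi := \sum_i q i *: (coord_block i *m om i (e i) (rsubmx v *m coord_block i) *m
                       (coord_block i)^T).
have dE : d1 nu v = block_mx 0 0 0 Phi.
  have H : \forall w \near v, nu w = nu w by near=> w.
  rewrite (d1_pullback sv ssv H) -exterior_d1E -xE curv // xE.
  rewrite mulmx_sumr mulmx_suml.
  have -> : block_mx 0 0 0 Phi = \sum_i q i *: block_mx (0 : 'M[R]_1) 0 0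
      (coord_block i *m om i (e i) (rsubmx v *m coord_block i) *m (coord_block i)^T).
    by rewrite block_dr_sum; apply: eq_bigr => i _; rewrite scale_block_mx !scaler0.
  by apply: eq_bigr => i _; rewrite -scalemxAr -scalemxAl pb.
split.
  apply/matrixP => i k; rewrite ord1 [RHS]mxE.
  have E1 : d1 nu v (lshift K 0) (rshift 1 k) = mder (lshift K 0) mu v 0 k.
    exact: etrans (d1E _ _ _ _) (etrans (congr2 (fun a b => a - b) (mr _ k) (ml _)) (subr0 _)).
  by rewrite -E1 dE block_mxEur mxE.
move=> j k.
have E1 : d1 nu v (rshift 1 j) (rshift 1 k) =
    mder (rshift 1 j) mu v 0 k - mder (rshift 1 k) mu v 0 j.
  exact: etrans (d1E _ _ _ _) (congr2 (fun a b => a - b) (mr _ k) (mr _ j)).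
by rewrite -E1 dE block_mxEdr.
Unshelve. all: by end_near. Qed.

End AdaptedFrame.

(** * The bundle metric *)
Section BundleMetric.
Context {R : realType} {m : nat} {n : 'I_m -> nat} {M : 'I_m -> topologicalType}.
Variable A : forall i, atlas (R := R) (n i + n i) (M i).
Hypothesis MA : forall i, smooth_manifold (A i).
Let K := (\sum_i (n i + n i))%N.
Context {P : topologicalType} (AP : atlas (R := R) (1 + \sum_i (n i + n i)) P).
Variables (act : R -> P -> P) (proj : P -> prod_topology M).
Hypothesis P_bundle : principal_circle_bundle AP (product_atlas A) act proj.
Variable sigma : tensor1 (R := R) (1 + \sum_i (n i + n i)) P.
Hypothesis sigma_conn : principal_connection AP act sigma.
Unset Implicit Arguments.
Variable g : forall i, tensor2 (R := R) (n i + n i) (M i).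
Set Implicit Arguments.
Hypothesis g_metric : forall i, riemannian_metric (A i) (g i).
Let MP := pcb_manifold P_bundle.
Let G s t := bundle_metric A proj g sigma s t.
Let gcov i := metric_covariant (g_metric i).

Lemma pullback_proj_smx i c x (h : tensor2 (R := R) (n i + n i) (M i)) :
  covariant2 (A i) h -> charts AP c -> chart_dom c x ->
  smx (pullback (A i) (fun y => proj y i) h c) (chart_coord c x).
Proof.
move=> ch Ac cx.
pose e i := chart_at (A i) (proj x i).
have Ae j : charts (A j) (e j) by exact: chart_at_charts.
have eb j : chart_dom (e j) (proj x j) by exact: chart_at_dom.
have sp := proj_smx P_bundle Ac cx Ae eb i.
have pE := pullback_proj MA P_bundle Ac cx Ae eb.
have pE' : \forall w \near chart_coord c x, 'J (proj_coord proj c e i) w *m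
    h (e i) (proj_coord proj c e i w) *m ('J (proj_coord proj c e i) w)^T =
    pullback (A i) (fun y => proj y i) h c w.
  by apply: filterS pE => w H; rewrite H.
apply: smx_eq pE' _.
have sh : smx (fun w => h (e i) (proj_coord proj c e i w)) (chart_coord c x).
  apply: smx_comp sp _ _ _ _; split=> j k; rewrite /proj_coord (chart_coordK MP Ac cx).
  exact: (ch.1 (e i) (proj x i) j k (Ae i) (eb i)).
apply: smxM; last by apply: smx_tr; exact: smx_J.
by apply: smxM sh; exact: smx_J.
Qed.

(** The chart of the factor is chosen at [proj x i], hence is the same for both charts of the total
    space, and the chain rule suffices. *)
Lemma pullback_proj_change i c c' x (h : tensor2 (R := R) (n i + n i) (M i)) :
  covariant2 (A i) h -> charts AP c -> charts AP c' -> chart_dom c x -> chart_dom c' x ->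
  let J := 'J (chart_coord c' \o chart_param c) (chart_coord c x) in
  pullback (A i) (fun y => proj y i) h c (chart_coord c x) =
  J *m pullback (A i) (fun y => proj y i) h c' (chart_coord c' x) *m J^T.
Proof.
move=> ch Ac Ac' cx cx' J.
pose e i := chart_at (A i) (proj x i).
have Ae j : charts (A j) (e j) by exact: chart_at_charts.
have eb j : chart_dom (e j) (proj x j) by exact: chart_at_dom.
have E := nbhs_singleton (pullback_proj MA P_bundle Ac cx Ae eb).
have E' := nbhs_singleton (pullback_proj MA P_bundle Ac' cx' Ae eb).
rewrite E // E' // {E E'} /proj_coord !(chart_coordK MP) // -/(proj_coord proj c e i) -/(proj_coord proj c' e i).
have st := transition_smx MP Ac Ac' cx cx'.
have tE : (chart_coord c' \o chart_param c) (chart_coord c x) = chart_coord c' x.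
  by rewrite /= (chart_coordK MP).
have sp' := proj_smx P_bundle Ac' cx' Ae eb i; rewrite -tE in sp'.
have -> : 'J (proj_coord proj c e i) (chart_coord c x) = J *m 'J (proj_coord proj c' e i) (chart_coord c' x).
  rewrite -tE -(jacobian_comp st sp').
  apply: jacobian_eq (proj_smx P_bundle Ac cx Ae eb i).
  apply: filterS (transition_dom MP Ac Ac' cx cx') => w dw.
  by rewrite /proj_coord /= (chart_coordK MP Ac' dw).
by rewrite trmx_mul !mulmxA.
Qed.

Lemma sigma_smx c x : charts AP c -> chart_dom c x -> smx (sigma c) (chart_coord c x).
Proof. by move=> Ac cx; apply: smx_row => j; exact: (conn_form sigma_conn).1. Qed.

Lemma bundle_smx s t c x : charts AP c -> chart_dom c x -> smx (G s t c) (chart_coord c x).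
Proof.
move=> Ac cx; have ss := sigma_smx Ac cx.
apply: smxD; first by apply: smxZ; apply: smxM => //; exact: smx_tr.
by apply: smx_sum => i; apply: smxZ; exact: pullback_proj_smx.
Qed.

Lemma bundle_covariant s t : covariant2 AP (G s t).
Proof.
split=> [c x j k Ac cx|c c' x Ac Ac' cx cx' J]; first exact: (bundle_smx s t Ac cx).
rewrite /G /bundle_metric mulmxDr mulmxDl; congr (_ + _).
  rewrite -scalemxAr -scalemxAl; congr (_ *: _).
  rewrite ((conn_form sigma_conn).2 c c' x Ac Ac' cx cx') -/J.
  by rewrite trmx_mul trmxK !mulmxA.
rewrite mulmx_sumr mulmx_suml; apply: eq_bigr => i _.
by rewrite -scalemxAr -scalemxAl (@pullback_proj_change i c c' x (g i) (gcov i) Ac Ac' cx cx').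
Qed.

Lemma posdef_unit k (S : 'M[R]_k) :
  (forall v : 'rV_k, v != 0 -> 0 < (v *m S *m v^T) 0 0) -> S \in unitmx.
Proof.
move=> pS; rewrite -row_free_unit -kermx_eq0; apply/rowV0P => u /sub_kermxP u0.
by apply/eqP/negP => /negP /pS; rewrite u0 mul0mx mxE ltxx.
Qed.

Lemma bundle_sym s t c x : charts AP c -> chart_dom c x ->
  (G s t c (chart_coord c x))^T = G s t c (chart_coord c x).
Proof.
move=> Ac cx; rewrite /G /bundle_metric linearD linearZ /= trmx_mul trmxK; congr (_ + _).
rewrite raddf_sum; apply: eq_bigr => i _ /=; rewrite linearZ /=; congr (_ *: _).
rewrite /pullback !trmx_mul trmxK mulmxA; congr (_ *m _ *m _).
set y := proj _ i.
have H := Defs.metric_sym (g_metric i) (chart_at_charts (MA i) y) (chart_at_dom (MA i) y).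
exact: H.
Qed.

(** In an adapted frame the quadratic form is a multiple of the square of the [sigma] component plus
    weighted squares of the blocks of the base part. If the base part vanishes, the first square is
    that of the nonzero fibre coordinate; otherwise some block is nonzero. *)
Lemma bundle_pos s t c x (v : 'rV_(1 + K)) : 0 < s -> (forall i, 0 < t i) ->
  charts AP c -> chart_dom c x -> v != 0 ->
  0 < (v *m G s t c (chart_coord c x) *m v^T) 0 0.
Proof.
move=> s0 t0 Ac cx v0.
have [psi [w0 [mu [psi0 w0E spsi smu psiP]]]] := adapted_frame MA P_bundle sigma_conn Ac cx.
have [uJ _ sJ pJ] := nbhs_singleton psiP.
rewrite psi0 in sJ pJ; set J := 'J psi w0 in uJ sJ pJ.
pose u := v *m invmx J; have vE : v = u *m J by rewrite /u mulmxKV.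
have u0 : u != 0 by apply: contraNneq v0 => u0; rewrite vE u0 mul0mx.
have -> : v *m G s t c (chart_coord c x) *m v^T =
    u *m (J *m G s t c (chart_coord c x) *m J^T) *m u^T by rewrite vE trmx_mul !mulmxA.
have -> : J *m G s t c (chart_coord c x) *m J^T =
    s *: ((row_mx 1%:M (mu w0))^T *m row_mx 1%:M (mu w0)) +
    \sum_i t i *: block_mx 0 0 0 (coord_block i *m
      g i (chart_at (A i) (proj x i)) (chart_coord (chart_at (A i) (proj x i)) (proj x i)) *m
        (coord_block i)^T).
  rewrite /G /bundle_metric mulmxDr mulmxDl; congr (_ + _).
    by rewrite -scalemxAr -scalemxAl -sJ trmx_mul trmxK !mulmxA.
  rewrite mulmx_sumr mulmx_suml; apply: eq_bigr => i _.
  by rewrite -scalemxAr -scalemxAl (pJ i (g i) (gcov i)) w0E.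
rewrite mulmxDr mulmxDl mxE -scalemxAr -scalemxAl mxE mulmx_sumr mulmx_suml summxE.
pose a : R := (u *m ((row_mx 1%:M (mu w0))^T *m row_mx 1%:M (mu w0)) *m u^T) 0 0.
rewrite -/a.
have aE : a = (u *m (row_mx 1%:M (mu w0))^T) 0 0 ^+ 2.
  have E (z w : 'rV[R]_(1 + K)) : z *m (w^T *m w) *m z^T = (z *m w^T) *m (z *m w^T)^T.
    by rewrite trmx_mul trmxK !mulmxA.
  by rewrite /a E [LHS]mxE big_ord1 [X in _ * X]mxE expr2.
pose q i := (rsubmx u *m coord_block i *m
   g i (chart_at (A i) (proj x i)) (chart_coord (chart_at (A i) (proj x i)) (proj x i)) *m
   (rsubmx u *m coord_block i)^T) 0 0.
have qE i : (u *m (t i *: block_mx 0 0 0 (coord_block i *m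
      g i (chart_at (A i) (proj x i)) (chart_coord (chart_at (A i) (proj x i)) (proj x i)) *m
        (coord_block i)^T)) *m u^T) 0 0 = t i * q i.
  rewrite -scalemxAr -scalemxAl mxE -{1 2}[u]hsubmxK mul_row_block !mulmx0 !add0r.
  by rewrite tr_row_mx mul_row_col mul0mx add0r /q trmx_mul !mulmxA.
rewrite (eq_bigr (fun i => t i * q i)) => [|i _]; last exact: qE.
have q0 i : rsubmx u *m coord_block i != 0 -> 0 < q i.
  by apply: (metric_pos (g_metric i)); [exact: chart_at_charts|exact: chart_at_dom].
have q0' i : 0 <= q i.
  case: (eqVneq (rsubmx u *m coord_block i) 0) => [z|/q0 /ltW //].
  by rewrite /q z !mul0mx mxE.
have sum0 : 0 <= \sum_i t i * q i by apply: sumr_ge0 => i _; rewrite mulr_ge0 // ltW.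
have a_ge0 : 0 <= a by rewrite aE; exact: sqr_ge0.
have sa0 : 0 <= s * a by rewrite mulr_ge0 // ltW.
case: (eqVneq (rsubmx u) 0) => [r0|rn0].
  rewrite ltr_wpDr // mulr_gt0 // aE exprn_even_gt0 //= -[u]hsubmxK r0 tr_row_mx mul_row_col.
  rewrite trmx1 mulmx1 mul0mx addr0; apply: contraNneq u0 => l0.
  rewrite -[u]hsubmxK r0; apply/eqP; rewrite -[RHS]row_mx0; congr row_mx.
  by apply/matrixP => i j; rewrite !ord1 l0 mxE.
have [i qi] : exists i, rsubmx u *m coord_block i != 0.
  apply/existsP; apply: contraNT rn0; rewrite negb_exists => /forallP H.
  rewrite -[rsubmx u]mulmx1 -coord_block_full mulmx_sumr; apply/eqP; apply: big1 => i _.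
  by have := H i; rewrite negbK mulmxA => /eqP ->; rewrite mul0mx.
rewrite ltr_wpDl // (bigD1 i) //= ltr_pwDl ?mulr_gt0 ?q0 // sumr_ge0 // => j _.
by rewrite mulr_ge0 // ltW.
Qed.

Lemma bundle_riemannian s t : 0 < s -> (forall i, 0 < t i) -> riemannian_metric AP (G s t).
Proof.
move=> s0 t0; split; [exact: bundle_covariant|exact: bundle_sym|].
by move=> c x v; exact: bundle_pos.
Qed.

Section Einstein.
Variable p : 'I_m -> nat.
Hypothesis KE : forall i, kahler_einstein (A i) (g i) (p i)%:R.

Section AtPoint.
Variables (i : 'I_m) (e : chart (R := R) (n i + n i) (M i)) (y : M i).
Hypotheses (Ae : charts (A i) e) (ey : chart_dom e y).
Let z := chart_coord e y.

Lemma factor_smx : smx (g i e) z.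
Proof. by split=> j k; exact: (gcov i).1. Qed.

Lemma factor_unit : g i e z \in unitmx.
Proof. by apply: posdef_unit => v; exact: (metric_pos (g_metric i) Ae ey). Qed.

Lemma factor_near (Q : 'rV[R]_(n i + n i) -> Prop) :
  (forall y', chart_dom e y' -> Q (chart_coord e y')) -> \forall w \near z, Q w.
Proof.
move=> H; apply: filterS (near_chart (MA i) Ae ey) => w [dw <-].
exact: H.
Qed.

Lemma factor_sym : \forall w \near z, (g i e w)^T = g i e w.
Proof. by apply: factor_near => y' ey'; exact: (Defs.metric_sym (g_metric i) Ae ey'). Qed.

Lemma factor_hermitian : \forall w \near z, std_J (n i) *m g i e w *m (std_J (n i))^T = g i e w.
Proof. by apply: factor_near => y' ey'; exact: (ke_hermitian (KE i) Ae ey'). Qed.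

Lemma factor_commute : std_J (n i) *m g i e z = g i e z *m std_J (n i).
Proof.
have H := ke_hermitian (KE i) Ae ey; rewrite -/z in H.
rewrite -[in RHS]H -mulmxA tr_std_J mulNmx std_JJ opprK mulmx1.
by [].
Qed.

Lemma factor_parallel k : std_J (n i) *m Chr (g i e) k z = Chr (g i e) k z *m std_J (n i).
Proof.
apply: kahler_parallel factor_smx factor_unit factor_sym factor_hermitian _ => a b c.
exact: (ke_closed (KE i) a b c Ae ey).
Qed.

Lemma factor_ricci : ricci (g i e) z = (p i)%:R *: g i e z.
Proof. exact: (ke_einstein (KE i) Ae ey). Qed.

End AtPoint.

Variable q : 'I_m -> int.
Hypothesis sigma_curv : connection_curvature A proj q g AP sigma.
Variable xi : 'rV[R]_m.
Hypothesis xi_gt0 : forall i, 0 < xi 0 i.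
Hypothesis xi_root : forall i, flowF n p q i xi = 0.
Let G_xi := G 1 (fun i => (xi 0 i)^-1).
Let E_xi := flowE n q xi.

Lemma bundle_einstein : einstein AP G_xi (E_xi / 2).
Proof.
move=> c x Ac cx.
have [psi [v0 [mu [psi0 v0E spsi smu psiP]]]] := adapted_frame MA P_bundle sigma_conn Ac cx.
pose e i := chart_at (A i) (proj x i).
have Ae i : charts (A i) (e i) by exact: chart_at_charts.
have eb i : chart_dom (e i) (proj x i) by exact: chart_at_dom.
pose z0 := rsubmx v0.
pose E i : 'M[R]_(K, n i + n i) := coord_block i.
pose h := product_metric E (fun i => g i (e i)) (fun i => (xi 0 i)^-1).
(* The weight [xi 0 i] compensates the factor [(xi 0 i)^-1] of the metric [h], so that [phi *m h] is
   the curvature form, the sum of the [q i] times the Kaehler forms. *)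
pose Jq i : 'M[R]_(n i + n i) := ((q i)%:~R * xi 0 i) *: std_J (n i).
pose phi := diag_blocks E Jq.
have E_orth i : (E i)^T *m E i = 1%:M by exact: coord_block_orth.
have E_orth0 i j : i != j -> (E i)^T *m E j = 0 by exact: coord_block_orth0.
have E_full : \sum_i E i *m (E i)^T = 1%:M by exact: coord_block_full.
have xi_neq0 i : xi 0 i != 0 by rewrite gt_eqF.
have xiV_neq0 i : (xi 0 i)^-1 != 0 by rewrite invr_neq0.
have sg i : smx (g i (e i)) (z0 *m E i) by rewrite v0E; exact: factor_smx.
have ug i : g i (e i) (z0 *m E i) \in unitmx by rewrite v0E; exact: factor_unit.
have gsym i : \forall w \near z0 *m E i, (g i (e i) w)^T = g i (e i) w.
  by rewrite v0E; exact: factor_sym.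
have sh : smx h z0 by exact: product_smooth.
have uh : h z0 \in unitmx by exact: product_unit.
have hsym : \forall w \near z0, (h w)^T = h w by exact: product_sym.
have hE w : h w = \sum_i (xi 0 i)^-1 *: (coord_block i *m g i (e i) (w *m coord_block i) *m (coord_block i)^T).
  by apply: eq_bigr => i _; rewrite -scalemxAr -scalemxAl.
have phihE w : phi *m h w = diag_blocks E (fun i => (q i)%:~R *: (std_J (n i) *m g i (e i) (w *m E i))).
  rewrite /phi /h /product_metric diag_blocksM //; apply: diag_blocks_eq => i.
  by rewrite -scalemxAl -scalemxAr scalerA mulfK.
have near_e i (Q : 'rV[R]_(n i + n i) -> Prop) :
    (forall y', chart_dom (e i) y' -> Q (chart_coord (e i) y')) ->
    \forall w \near z0, Q (w *m E i).
  move=> H; apply: product_proj_near; rewrite v0E.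
  exact: factor_near.
have phi_parallel : \forall w \near z0, forall k, phi *m Chr h k w = Chr h k w *m phi.
  have P1 := product_Chr E_orth E_orth0 E_full xiV_neq0 sg ug gsym.
  have P2 : \forall w \near z0, forall i k, std_J (n i) *m Chr (g i (e i)) k (w *m E i) =
      Chr (g i (e i)) k (w *m E i) *m std_J (n i).
    apply: near_fin => i; apply: (near_e i (fun w => forall k, std_J (n i) *m Chr (g i (e i)) k w =
      Chr (g i (e i)) k w *m std_J (n i))) => y' ey' k.
    exact: factor_parallel.
  apply: filterS2 P1 P2 => w P1 P2 k; rewrite P1 /phi !diag_blocksM //.
  apply: diag_blocks_eq => i; rewrite -scalemxAl -scalemxAr; congr (_ *: _).
  rewrite mulmx_sumr mulmx_suml; apply: eq_bigr => a _.
  by rewrite -scalemxAl -scalemxAr P2.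
have F_antisym : \forall w \near z0, (phi *m h w)^T = - (phi *m h w).
  have P1 : \forall w \near z0, forall i, (g i (e i) (w *m E i))^T = g i (e i) (w *m E i) /\
     std_J (n i) *m g i (e i) (w *m E i) = g i (e i) (w *m E i) *m std_J (n i).
    apply: near_fin => i; apply: (near_e i (fun w => (g i (e i) w)^T = g i (e i) w /\
     std_J (n i) *m g i (e i) w = g i (e i) w *m std_J (n i))) => y' ey'; split.
      exact: (Defs.metric_sym (g_metric i) (Ae i) ey').
    exact: factor_commute.
  apply: filterS P1 => w P1; rewrite phihE tr_diag_blocks diag_blocksN.
  apply: diag_blocks_eq => i; have [s c'] := P1 i.
  by rewrite linearZ /= trmx_mul s tr_std_J mulmxN -c' scalerN.
have phi_tr : \tr phi = 0.
  by rewrite mxtrace_diag_blocks // big1 // => i _; rewrite mxtraceZ mxtrace_std_J mulr0.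
have curvP : \forall v \near v0, mder (lshift K 0) mu v = 0 /\
    forall j k, mder (rshift 1 j) mu v 0 k - mder (rshift 1 k) mu v 0 j =
      (\sum_i (q i)%:~R *: (coord_block i *m kahler_form (g i) (e i) (rsubmx v *m coord_block i) *m
                       (coord_block i)^T)) j k.
  apply: (adapted_curvature (om := fun i => kahler_form (g i)) Ac spsi _ smu psiP).
  - by rewrite psi0; exact: sigma_smx.
  - by move=> i; apply: kahler_form_covariant (gcov i) (ke_holomorphic (KE i)).
  - exact: sigma_curv.
have mu_vert : \forall v \near v0, mder (lshift K 0) mu v = 0 by apply: filterS curvP => v [].
have mu_curv : \forall v \near v0, forall j k : 'I_K,
     mder (rshift 1 j) mu v 0 k - mder (rshift 1 k) mu v 0 j = (phi *m h (rsubmx v)) j k.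
  apply: filterS curvP => v [_ H] j k; rewrite H phihE; congr (fun_of_matrix _ j k).
  by apply: eq_bigr => i _; rewrite -scalemxAr -scalemxAl.
pose H v := 'J psi v *m G_xi c (psi v) *m ('J psi v)^T.
have HE : \forall v \near v0, H v = (row_mx 1%:M (mu v))^T *m row_mx 1%:M (mu v) +
     block_mx 0 0 0 (h (rsubmx v)).
  apply: filterS psiP => v [_ _ sJ pJ].
  rewrite /H /G_xi /G /bundle_metric mulmxDr mulmxDl scale1r; congr (_ + _).
    by rewrite -sJ trmx_mul trmxK !mulmxA.
  rewrite mulmx_sumr mulmx_suml hE block_dr_sum; apply: eq_bigr => i _.
  by rewrite -scalemxAr -scalemxAl (pJ i (g i) (gcov i)) scale_block_mx !scaler0.
have phi2E : phi *m phi = diag_blocks E (fun i => - (((q i)%:~R * xi 0 i) ^+ 2)%:M).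
  rewrite /phi diag_blocksM //; apply: diag_blocks_eq => i.
  by rewrite -scalemxAl -scalemxAr std_JJ scalerN scalerN scalerA -expr2 scale_scalar_mx mulr1.
(* Each factor has real dimension [n i + n i], so the trace of [phi *m phi] is [- 2 * E_xi]. *)
have l1 : - (4^-1 * \tr (phi *m phi)) = E_xi / 2.
  rewrite phi2E mxtrace_diag_blocks // /E_xi /flowE mulr_sumr -sumrN mulr_suml.
  apply: eq_bigr => i _.
  have trE (u : R) k : \tr (- u%:M : 'M[R]_k) = - (u * k%:R).
    by rewrite linearN /= mxtrace_scalar mulr_natr.
  rewrite trE natrD exprMn.
  by move: ((q i)%:~R ^+ 2 : R) (xi 0 i ^+ 2) => ? ?; field.
(* On the block [i], multiplication by [2 * xi 0 i] turns the equation into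
   [flowF n p q i xi = 0]. *)
have l2 : ricci h z0 + 2^-1 *: (phi *m phi *m h z0) = (E_xi / 2) *: h z0.
  have hR : ricci h z0 = diag_blocks E (fun i => ricci (g i (e i)) (z0 *m E i)).
    exact: product_ricci.
  rewrite hR phi2E /h /product_metric diag_blocksM // !diag_blocksZ diag_blocksD.
  apply: diag_blocks_eq => i; rewrite v0E factor_ricci //.
  rewrite mulNmx mul_scalar_mx !scalerA -scaleNr scalerA -scalerDl; congr (_ *: _).
  have := xi_root i; rewrite /flowF -/E_xi => root.
  apply: (mulIf (xi_neq0 i)); rewrite mulrVK ?unitfE // mulrDl.
  rewrite (_ : 2^-1 * _ * _ = - 2^-1 * ((q i)%:~R ^+ 2 * xi 0 i ^+ 2)); first lra.
  by rewrite exprMn mulrN mulNr; field.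
have EH := kaluza_klein_einstein sh uh hsym phi_parallel F_antisym phi_tr smu mu_vert mu_curv HE l1 l2.
have uJ : 'J psi v0 \in unitmx by have [] := nbhs_singleton psiP.
have NR : ricci H v0 = 'J psi v0 *m ricci (G_xi c) (psi v0) *m ('J psi v0)^T.
  apply: natural_ricci => //; rewrite ?psi0.
  - exact: bundle_smx.
  - apply: filterS (near_chart MP Ac cx) => w [dw <-]; exact: bundle_sym.
  - by apply: posdef_unit => v; apply: bundle_pos => // i; rewrite invr_gt0.
  - by near=> w.
rewrite -psi0; move: NR; rewrite EH /H => NR.
have uJT : ('J psi v0)^T \in unitmx by rewrite unitmx_tr.
apply: (can_inj (mulKmx uJ)); apply: (can_inj (mulmxK uJT)).
by rewrite -NR -scalemxAr -scalemxAl.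
Unshelve. all: by end_near. Qed.

(** The trace of the Einstein equation is [E_xi / 2] times one plus twice the sum of the [n i].
    Weighting the equations [flowF i xi = 0] by [n i] and adding them shows that [E_xi] times that
    sum is twice the sum of the [n i * p i * xi_i], minus [E_xi]. *)
Lemma bundle_scalar c x : charts AP c -> chart_dom c x ->
  scalar_curvature (G_xi c) (chart_coord c x) =
  2 * (\sum_i (n i)%:R * (p i)%:R * xi 0 i) - E_xi / 2.
Proof.
move=> Ac cx; rewrite /scalar_curvature (bundle_einstein Ac cx) -scalemxAr mulVmx; last first.
  by apply: posdef_unit => v; apply: bundle_pos => // i; rewrite invr_gt0.
rewrite mxtraceZ mxtrace1 natrD natr_sum mulrDr mulr_sumr mulr_sumr.
have -> : \sum_i E_xi / 2 * (n i + n i)%:R =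
    \sum_i (2 * ((n i)%:R * (p i)%:R * xi 0 i) - (n i)%:R * (q i)%:~R ^+ 2 * xi 0 i ^+ 2).
  apply: eq_bigr => i _; have := xi_root i; rewrite /flowF -/E_xi natrD => root.
  have -> : E_xi = 2 * (p i)%:R * xi 0 i - (q i)%:~R ^+ 2 * xi 0 i ^+ 2 by lra.
  by field.
rewrite sumrB -/(flowE n q xi) -/E_xi; lra.
Qed.

End Einstein.
End BundleMetric.

(** * The reduced flow *)
Section RealFunctions.
Context {R : realType}.

Lemma is_derive_homo (f df : R -> R) (x y : R) :
  (forall z, is_derive z (1 : R) f (df z)) -> (forall z, x <= z <= y -> 0 <= df z) ->
  x <= y -> f x <= f y.
Proof.
move=> fdf df0 xy.
have cf z : {for z, continuous f}.
  by apply: differentiable_continuous; apply/derivable1_diffP; have [] := fdf z.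
have [|c cxy E] := @MVT_segment R f df x y xy (fun z _ => fdf z).
  by apply: continuous_subspaceT => z; exact: cf.
 rewrite -subr_ge0 E mulr_ge0 ?subr_ge0 // df0 //.
Qed.

Lemma is_derive_oriented_integral (f : R -> R) (x : R) :
  (forall y, {for y, continuous f}) ->
  is_derive x (1 : R) (oriented_integral f) (f x).
Proof.
move=> cf.
have intf (u v : R) : lebesgue_measure.-integrable `[u, v] (EFin \o f).
  apply: continuous_compact_integrable; first exact: segment_compact.
  exact: continuous_subspaceT.
(* A base point to the left of both [x] and 0: near [x], both branches of [oriented_integral] become
   the same difference [F y - F 0] of ordinary integrals from [c]. *)
pose c := Num.min x 0 - 1; pose F y := Rintegral lebesgue_measure `[c, y] f.
have c0 : c < 0 by rewrite /c; case: (ltP x 0); lra.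
have cx : c < x by rewrite /c; case: (ltP x 0); lra.
have x1 : x < x + 1 by lra.
have [dF F'] := continuous_FTC1_closed x1 (intf c (x + 1)) cx (cf x).
have FE u v : c <= u -> u <= v -> Rintegral lebesgue_measure `[u, v] f = F v - F u.
  move=> cu uv; rewrite /F Rintegral_itvB //.
  by rewrite Rintegral_itv_obnd_cbnd //; apply: integrableS (intf u v) => //; exact: subset_itv_oc_cc.
have E : {near x, (fun y => F y - F 0) =1 oriented_integral f}.
  have H : \forall y \near x, c < y by exact: lt_nbhsr.
  apply: filterS H => y cy; rewrite /oriented_integral; case: ltP => y0.
    by rewrite FE ?opprB // ltW.
  by rewrite FE // ltW.
have D : is_derive x (1 : R) (fun y => F y - F 0) (f x).
  rewrite -[f x]subr0; apply: is_deriveB; rewrite -F' derive1E; exact: derivableP.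
exact: (near_eq_is_derive E D).
Qed.

Lemma oriented_integral0 (f : R -> R) : oriented_integral f 0 = 0.
Proof. by rewrite /oriented_integral lexx set_itv1 Rintegral_set1. Qed.

Lemma is_derive_continuous (f : R -> R) (df x : R) :
  is_derive x (1 : R) f df -> {for x, continuous f}.
Proof. by move=> [d _]; apply: differentiable_continuous; apply/derivable1_diffP. Qed.

Lemma cvg_ninfty_nbhs (f : R -> R) (l e : R) : f u @[u --> -oo] --> l -> 0 < e ->
  exists u0, forall u, u <= u0 -> `|l - f u| < e.
Proof.
move=> /cvgrPdist_lt fl e0; have [u0 [_ H]] := fl e e0.
by exists (u0 - 1) => u uu0; apply: H => /=; lra.
Qed.

Lemma cvg_ninfty_ge (f : R -> R) (l x : R) : f u @[u --> -oo] --> l ->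
  (exists u0, forall u, u <= u0 -> x <= f u) -> x <= l.
Proof.
move=> fl [u0 H]; rewrite leNgt; apply/negP => lx.
have [|u1 H1] := cvg_ninfty_nbhs fl (e := x - l); first by rewrite subr_gt0.
have := H1 (Num.min u0 u1); have := H (Num.min u0 u1).
rewrite !ge_min !lexx orbT => /(_ isT) a /(_ isT); rewrite distrC.
by move=> /(le_lt_trans (ler_norm _)); lra.
Qed.

Lemma cvg_ninfty_le (f : R -> R) (l x : R) : f u @[u --> -oo] --> l ->
  (exists u0, forall u, u <= u0 -> f u <= x) -> l <= x.
Proof.
move=> fl [u0 H]; rewrite leNgt; apply/negP => lx.
have [|u1 H1] := cvg_ninfty_nbhs fl (e := l - x); first by rewrite subr_gt0.
have := H1 (Num.min u0 u1); have := H (Num.min u0 u1).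
rewrite !ge_min !lexx orbT => /(_ isT) a /(_ isT).
by move=> /(le_lt_trans (ler_norm _)); lra.
Qed.

End RealFunctions.

Section Flow.
Context {R : realType} {m : nat}.
Variables (n p : 'I_m -> nat) (q : 'I_m -> int).
Variables (xi : 'rV[R]_m) (Y : R -> 'rV[R]_m).
Hypothesis xi_gt0 : forall i, 0 < xi 0 i.
Hypothesis Y_ode : forall (u : R) (i : 'I_m),
  is_derive u (1 : R) (fun s : R => Y s 0 i) (- Y u 0 i * flowF n p q i (Y u)).
Hypothesis Y_Omega : forall u, Omega_plus n p q (Y u).
Hypothesis Y_lim : Y u @[u --> -oo] --> xi.
Let E : 'rV[R]_m -> R := flowE n q.
Let E_xi := E xi.

Lemma Y_coord_lim i : Y u 0 i @[u --> -oo] --> xi 0 i.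
Proof. exact: (cvg_comp _ _ Y_lim (@coord_continuous _ _ _ 0 i xi)). Qed.

Lemma Y_nincr i u v : u <= v -> Y v 0 i <= Y u 0 i.
Proof.
move=> uv; rewrite -lerN2.
have dY z : is_derive z (1 : R) (fun s => - Y s 0 i) (- (- Y z 0 i * flowF n p q i (Y z))).
  by have := is_deriveN (Y_ode z i).
apply: (is_derive_homo dY _ uv) => z _.
by have [Y0 F0] := Y_Omega z i; rewrite mulNr opprK mulr_ge0.
Qed.

Lemma Y_le_xi i u : Y u 0 i <= xi 0 i.
Proof. by apply: (cvg_ninfty_ge (Y_coord_lim (i := i))); exists u => v; exact: Y_nincr. Qed.

Lemma flowE_ge0 y : 0 <= E y.
Proof. by apply: sumr_ge0 => i _; rewrite mulr_ge0 ?sqr_ge0 // mulr_ge0 ?sqr_ge0. Qed.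

(* [Y_i exp (k u)] is nondecreasing as soon as [k] bounds [F_i (Y u)]. *)
Lemma Y_gt0 i u : 0 < Y u 0 i.
Proof.
have [u1 H1] := cvg_ninfty_nbhs (Y_coord_lim (i := i)) (xi_gt0 i).
have Yu1 v : v <= u1 -> 0 < Y v 0 i.
  by move=> /H1 /(le_lt_trans (ler_norm _)); lra.
case: (leP u u1) => [/Yu1 //|/ltW uu1].
pose k := 2 * (p i)%:R * xi 0 i.
suff : Y u1 0 i * expR (k * u1) <= Y u 0 i * expR (k * u).
  have := Yu1 u1 (lexx _) => Y1 H.
  have : 0 < Y u 0 i * expR (k * u) by apply: lt_le_trans H; rewrite mulr_gt0 // expR_gt0.
  by rewrite pmulr_lgt0 // expR_gt0.
apply: (is_derive_homo (f := fun s => Y s 0 i * expR (k * s))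
  (df := fun s => Y s 0 i * (k - flowF n p q i (Y s)) * expR (k * s))) uu1 => z.
  have d1 : is_derive z (1 : R) (fun s : R => k * s) k.
    by have := is_deriveZ k (@is_derive_id R R z 1); rewrite /GRing.scale /= mulr1.
  have d2 := is_derive1_comp (is_derive_expR (k * z)) d1.
  have := is_deriveM (Y_ode z i) d2.
  by move=> D; apply: (is_derive_eq D); rewrite /GRing.scale /=; ring.
move=> _; have [Y0 F0] := Y_Omega z i.
rewrite !mulr_ge0 ?expR_ge0 // subr_ge0 /flowF /k.
have := Y_le_xi i z; have := flowE_ge0 (Y z); rewrite /E => E0 Yx.
have h1 : 0 <= (q i)%:~R ^+ 2 * Y z 0 i ^+ 2 by rewrite mulr_ge0 // sqr_ge0.
have h2 : (p i)%:R * Y z 0 i <= (p i)%:R * xi 0 i by rewrite ler_wpM2l.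
lra.
Qed.

Lemma flowE_continuous v : {for v, continuous E}.
Proof.
apply: cont_sum => i; apply: contM; first exact: cont_cst.
by apply: contM; exact: coord_continuous.
Qed.

Lemma flowE_lim : E (Y u) @[u --> -oo] --> E_xi.
Proof. exact: (cvg_comp _ _ Y_lim (flowE_continuous (v := xi))). Qed.

Lemma flowE_nincr u v : u <= v -> E (Y v) <= E (Y u).
Proof.
move=> uv; apply: ler_sum => i _; rewrite ler_wpM2l //; first by rewrite mulr_ge0 ?sqr_ge0.
by have := Y_gt0 i v; have := Y_gt0 i u; have := Y_nincr i uv; nra.
Qed.

Lemma flowE_le_xi u : E (Y u) <= E_xi.
Proof. by apply: (cvg_ninfty_ge flowE_lim); exists u => v; exact: flowE_nincr. Qed.

Section Tau.
Variables (a0 T1 : R).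
Hypothesis a0_gt0 : 0 < a0.
Let aY := a_of n q a0 Y.
Let tau := tau_of n q a0 Y.
Hypothesis T1_lim : tau u @[u --> -oo] --> - T1.

Lemma EY_continuous u : {for u, continuous (fun u => E (Y u))}.
Proof.
apply: cont_sum => i; apply: contM; first exact: cont_cst.
by apply: contM; exact: is_derive_continuous (Y_ode u i).
Qed.

Lemma is_derive_aY u : is_derive u (1 : R) aY (E (Y u) * aY u).
Proof.
have d1 := is_derive_oriented_integral u EY_continuous.
have d2 := is_derive1_comp (is_derive_expR (oriented_integral (fun z => E (Y z)) u)) d1.
have D := is_deriveZ a0 d2.
by apply: (is_derive_eq D); rewrite /aY /a_of /GRing.scale /=; ring.
Qed.

Lemma is_derive_tau u : is_derive u (1 : R) tau (aY u).
Proof.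
apply: is_derive_oriented_integral => y.
exact: is_derive_continuous (is_derive_aY y).
Qed.

Lemma aY_gt0 u : 0 < aY u.
Proof. by rewrite /aY /a_of mulr_gt0 // expR_gt0. Qed.

Lemma aY_ndecr u v : u <= v -> aY u <= aY v.
Proof.
move=> uv; apply: (is_derive_homo is_derive_aY _ uv) => z _.
by rewrite mulr_ge0 ?flowE_ge0 // ltW // aY_gt0.
Qed.

(** A nonnegative derivative gives only weak monotonicity. Strictness comes from subtracting the
    line of slope [aY u], which stays below the derivative to the right of [u]. *)
Lemma tau_incr u v : u < v -> tau u < tau v.
Proof.
move=> uv; rewrite -subr_gt0.
have H : tau u - aY u * u <= tau v - aY u * v.
  apply: (is_derive_homo (f := fun s => tau s - aY u * s) (df := fun s => aY s - aY u)) (ltW uv) => z.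
    have d1 : is_derive z (1 : R) (fun s : R => aY u * s) (aY u).
      by have := is_deriveZ (aY u) (@is_derive_id R R z 1); rewrite /GRing.scale /= mulr1.
    by have := is_deriveB (is_derive_tau z) d1.
  by move=> /andP[uz _]; rewrite subr_ge0 aY_ndecr.
have : 0 < aY u * (v - u) by rewrite mulr_gt0 ?aY_gt0 // subr_gt0.
by move: H; rewrite mulrBr; lra.
Qed.

Lemma tau_homo u v : u <= v -> tau u <= tau v.
Proof. by rewrite le_eqVlt => /predU1P[->//|/tau_incr /ltW]. Qed.

Lemma tau_gt u : - T1 < tau u.
Proof.
apply: (@le_lt_trans _ _ (tau (u - 1))); last by apply: tau_incr; lra.
apply: (cvg_ninfty_le T1_lim); exists (u - 1) => v; exact: tau_homo.
Qed.

Lemma tau_eq0 : tau 0 = 0. Proof. exact: oriented_integral0. Qed.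

Lemma T1_gt0 : 0 < T1. Proof. by have := tau_gt 0; rewrite tau_eq0; lra. Qed.

Lemma tau_small e : 0 < e -> exists u0, forall u, u <= u0 -> tau u < - T1 + e.
Proof.
move=> /(cvg_ninfty_nbhs T1_lim)[u0 H]; exists u0 => u /H.
by rewrite distrC => /(le_lt_trans (ler_norm _)); lra.
Qed.

Lemma tau_surj t : - T1 < t -> t <= 0 -> exists2 u, u <= 0 & tau u = t.
Proof.
move=> t1 t0; have [|u0 H] := @tau_small (t + T1); first lra.
have ct : {within `[Num.min u0 0, 0], continuous tau}.
  by apply: continuous_subspaceT => z; exact: is_derive_continuous (is_derive_tau z).
have u00 : Num.min u0 0 <= 0 by rewrite ge_min lexx orbT.
suff [u ul ut] : exists2 u, u \in `[Num.min u0 0, 0]%R & tau u = t.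
  by exists u => //; move: ul; rewrite in_itv /= => /andP[].
apply: (IVT u00 ct).
have := H (Num.min u0 0); rewrite ge_min lexx => /(_ isT) ht.
have := tau_homo u00; rewrite tau_eq0 => h0.
by rewrite (min_idPl h0) (max_idPr h0) t0 andbT; lra.
Qed.

(** Transfers statements about [u] near -oo to times just after [- T1]: [tau] is strictly increasing
    and takes every value in the interval from [- T1] to 0. *)
Lemma near_tau (Q : R -> Prop) u0 : (forall u, u <= u0 -> Q (tau u)) ->
  \forall t \near (- T1)^'+, Q t.
Proof.
move=> H; pose v := Num.min u0 0.
have v0 : v <= 0 by rewrite /v ge_min lexx orbT.
near=> t.
have t1 : - T1 < t by near: t; exact: nbhs_right_gt.
have tv : t < tau v by near: t; exact: nbhs_right_lt (tau_gt v).
have t0 : t <= 0 by rewrite -tau_eq0 (le_trans (ltW tv)) // tau_homo.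
have [u _ ut] := tau_surj t1 t0; rewrite -ut; apply: H.
have : v <= u0 by rewrite /v ge_min lexx.
apply: le_trans; rewrite leNgt; apply/negP => /tau_incr.
by rewrite ut; move: tv; lra.
Unshelve. all: by end_near. Qed.

(** If [aY] stayed above [e], then [tau u] would lie below [e * u] for negative [u], and so reach
    [- T1] at [u = - T1 / e]; but [tau] always exceeds [- T1]. *)
Lemma aY_small e : 0 < e -> exists u0, forall u, u <= u0 -> aY u < e.
Proof.
move=> e0; case: (pselect (exists u, aY u < e)) => [[u0 H]|H].
  by exists u0 => u uu0; apply: le_lt_trans H; exact: aY_ndecr.
have ae u : e <= aY u by rewrite leNgt; apply/negP => h; apply: H; exists u.
have te u : u <= 0 -> tau u <= e * u.
  move=> u0; suff : tau u - e * u <= tau 0 - e * 0 by rewrite tau_eq0; lra.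
  have D z : is_derive z (1 : R) (fun s => tau s - e * s) (aY z - e).
    have d1 : is_derive z (1 : R) (fun s : R => e * s) e.
      by have := is_deriveZ e (@is_derive_id R R z 1); rewrite /GRing.scale /= mulr1.
    by have := is_deriveB (is_derive_tau z) d1.
  by apply: (is_derive_homo D _ u0) => z _; rewrite subr_ge0.
have := tau_gt (- (T1 / e)).
have T0 := T1_gt0; have := te (- (T1 / e)); rewrite oppr_le0 divr_ge0 ?(ltW T0) ?(ltW e0) //.
move=> /(_ isT); rewrite mulrN mulrCA divff ?mulr1 ?gt_eqF //; lra.
Qed.

Lemma aY_le u : aY u <= E_xi * (T1 + tau u).
Proof.
apply/ler_addgt0Pr => e /aY_small[u0 H].
have D z : is_derive z (1 : R) (fun s => E_xi * tau s - aY s) (E_xi * aY z - E (Y z) * aY z).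
  have d1 : is_derive z (1 : R) (fun s : R => E_xi * tau s) (E_xi * aY z).
    by have := is_deriveZ E_xi (is_derive_tau z).
  by have := is_deriveB d1 (is_derive_aY z).
have uu : Num.min u u0 <= u by rewrite ge_min lexx.
have := H (Num.min u u0); rewrite ge_min lexx orbT => /(_ isT) h1.
have : E_xi * tau (Num.min u u0) - aY (Num.min u u0) <= E_xi * tau u - aY u.
  apply: (is_derive_homo D _ uu) => z _.
  by rewrite -mulrBl mulr_ge0 ?subr_ge0 ?flowE_le_xi // ltW // aY_gt0.
have h2 : E_xi * - T1 <= E_xi * tau (Num.min u u0).
  by rewrite ler_wpM2l ?flowE_ge0 // ltW // tau_gt.
move: h1 h2; rewrite mulrN mulrDr.
move: (aY _) (aY _) (E_xi * _) (E_xi * _) (E_xi * _) => ? ? ? ? ?; lra.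
Qed.

Lemma aY_ge c u : 0 <= c -> (forall s, s <= u -> c <= E (Y s)) -> c * (T1 + tau u) <= aY u.
Proof.
move=> c0 H; apply/ler_addgt0Pr => e e0.
(* Dividing by [c + 1] rather than by [c] covers [c = 0], and the error is still at most [e] after
   multiplication by [c]. *)
have [|u0 H0] := @tau_small (e / (c + 1)); first by rewrite divr_gt0 // ltr_wpDl.
have D z : is_derive z (1 : R) (fun s => aY s - c * tau s) (E (Y z) * aY z - c * aY z).
  have d1 : is_derive z (1 : R) (fun s : R => c * tau s) (c * aY z).
    by have := is_deriveZ c (is_derive_tau z).
  by have := is_deriveB (is_derive_aY z) d1.
have uu : Num.min u u0 <= u by rewrite ge_min lexx.
have := H0 (Num.min u u0); rewrite ge_min lexx orbT => /(_ isT) h1.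
have : aY (Num.min u u0) - c * tau (Num.min u u0) <= aY u - c * tau u.
  apply: (is_derive_homo D _ uu) => z.
  by move=> /andP[_ zu]; rewrite -mulrBl mulr_ge0 ?subr_ge0 ?H // ltW // aY_gt0.
have h2 : c * tau (Num.min u u0) <= c * (- T1 + e / (c + 1)) by rewrite ler_wpM2l // ltW.
have h3 : c * (e / (c + 1)) <= e.
  rewrite mulrA ler_pdivrMr ?ltr_wpDl // mulrDr mulr1 [c * e]mulrC lerDl ltW //.
have := aY_gt0 (Num.min u u0).
move: h2 h3; rewrite !mulrDr mulrN.
move: (c * (e / (c + 1))) (aY _) (aY _) (c * T1) (c * _) (c * _) => ? ? ? ? ? ?; lra.
Qed.

(** Positivity is extracted from the dynamics: if [E] vanished at [Y 0], whose components are
    positive, all its coefficients would vanish, [aY] would be constant, and it could not become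
    small. *)
Lemma flowE_gt0 : 0 < E (Y 0).
Proof.
rewrite lt_neqAle flowE_ge0 andbT eq_sym; apply/eqP => E0.
have Ei i : (n i)%:R * (q i)%:~R ^+ 2 = 0 :> R.
  have : (n i)%:R * (q i)%:~R ^+ 2 * Y 0 0 i ^+ 2 = 0.
    move: E0; rewrite /E /flowE => /eqP; rewrite psumr_eq0 => [/allP/(_ i)|j _]; last first.
      by rewrite mulr_ge0 ?sqr_ge0 // mulr_ge0 ?sqr_ge0.
    by rewrite mem_index_enum => /(_ isT) /eqP.
  by move/eqP; rewrite mulf_eq0 expf_eq0 /= (gt_eqF (Y_gt0 i 0)) orbF => /eqP.
have EY u : E (Y u) = 0 by apply: big1 => i _; rewrite Ei mul0r.
have [u0 H] := aY_small (aY_gt0 0).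
have D z : is_derive z (1 : R) (fun s => - aY s) (- (E (Y z) * aY z)).
  by have := is_deriveN (is_derive_aY z).
have u00 : Num.min u0 0 <= 0 by rewrite ge_min lexx orbT.
have := H (Num.min u0 0); rewrite ge_min lexx => /(_ isT) h1.
have : - aY (Num.min u0 0) <= - aY 0.
  apply: (is_derive_homo D _ u00) => z _.
  by rewrite EY mul0r oppr0.
by move: h1; move: (aY _) (aY _) => ? ?; lra.
Qed.

Variables (a : R -> R) (b : R -> 'I_m -> R).
Hypothesis a_def : forall u, a (tau u) = aY u.
Hypothesis b_def : forall u i, b (tau u) i = aY u / Y u 0 i.

Lemma a_gt0 : \forall t \near (- T1)^'+, 0 < a t.
Proof. by apply: (near_tau (u0 := 0)) => u _; rewrite a_def aY_gt0. Qed.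

Lemma a_lim : a t @[t --> (- T1)^'+] --> (0 : R).
Proof.
apply/cvgrPdist_lt => e /aY_small[u0 H]; apply: (near_tau (u0 := u0)) => u /H.
by rewrite a_def sub0r normrN gtr0_norm // aY_gt0.
Qed.

Lemma ratio_lim i : (a t / b t i) @[t --> (- T1)^'+] --> xi 0 i.
Proof.
apply/cvgrPdist_lt => e /(cvg_ninfty_nbhs (Y_coord_lim (i := i)))[u0 H].
apply: (near_tau (u0 := u0)) => u /H.
by rewrite a_def b_def invf_div mulrCA divff ?mulr1 // gt_eqF // aY_gt0.
Qed.

Lemma b_lim i : b t i @[t --> (- T1)^'+] --> (0 : R).
Proof.
have : (a t * (a t / b t i)^-1) @[t --> (- T1)^'+] --> 0 * (xi 0 i)^-1.
  by apply: cvgM a_lim _; apply: (cvgV _ (ratio_lim (i := i))); rewrite gt_eqF.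
rewrite mul0r; apply: cvg_trans; apply: near_eq_cvg.
apply: filterS a_gt0 => t t0; rewrite invf_div mulrCA divff ?mulr1 // gt_eqF //.
Qed.

Lemma a_rate : (a t / (T1 + t)) @[t --> (- T1)^'+] --> E_xi.
Proof.
apply/cvgrPdist_lt => e e0; have [u0 H] := cvg_ninfty_nbhs flowE_lim e0.
have [u1 H1] : exists u1, forall u, u <= u1 -> E_xi - e / 2 <= E (Y u).
  have [|u1 H1] := cvg_ninfty_nbhs flowE_lim (e := e / 2); first by rewrite divr_gt0.
  by exists u1 => u /H1 /(le_lt_trans (ler_norm _)); lra.
apply: (near_tau (u0 := u1)) => u uu1.
have t0 : 0 < T1 + tau u by have := tau_gt u; lra.
have r1 : aY u / (T1 + tau u) <= E_xi by rewrite ler_pdivrMr // aY_le.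
have r2 : E_xi - e / 2 <= aY u / (T1 + tau u).
  (* [aY_ge] compares with lines of nonnegative slope only; a negative lower bound is immediate from
     positivity. *)
  case: (leP 0 (E_xi - e / 2)) => [c0|c0]; last first.
    by rewrite (le_trans (ltW c0)) // divr_ge0 // ltW // aY_gt0.
  by rewrite ler_pdivlMr // aY_ge // => s su; apply: H1; exact: le_trans uu1.
by rewrite a_def ger0_norm ?subr_ge0 //; lra.
Qed.

Lemma b_rate i : (b t i / (T1 + t)) @[t --> (- T1)^'+] --> E_xi / xi 0 i.
Proof.
have : (a t / (T1 + t) * (a t / b t i)^-1) @[t --> (- T1)^'+] --> E_xi * (xi 0 i)^-1.
  by apply: cvgM a_rate _; apply: (cvgV _ (ratio_lim (i := i))); rewrite gt_eqF.
apply: cvg_trans; apply: near_eq_cvg; apply: filterS a_gt0 => t t0.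
by rewrite invf_div mulrC mulrA divfK // gt_eqF.
Qed.

(** The input of the type I estimate: nonpositive times correspond to [u <= 0], where [Y] lies
    between [Y 0] and [xi]. Thus the ratios [b / a] stay in a compact box of positive numbers, and
    the elapsed time is controlled by [a] through the smallest growth rate [E (Y 0)]. *)
Lemma flow_bounds t : - T1 < t -> t <= 0 ->
  [/\ 0 < a t, (T1 + t) / a t <= (E (Y 0))^-1 &
      forall i, 0 < b t i /\ (xi 0 i)^-1 <= b t i / a t <= (Y 0 0 i)^-1].
Proof.
move=> t1 t0; have [u u0 <-] := tau_surj t1 t0; rewrite a_def.
have a1 := aY_gt0 u; have E0 := flowE_gt0; split=> // [|i].
  rewrite ler_pdivrMr // mulrC ler_pdivlMr // mulrC aY_ge ?ltW // => s su.
  by rewrite flowE_nincr // (le_trans su).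
rewrite b_def divr_gt0 ?Y_gt0 //; split=> //.
rewrite mulrAC divff ?gt_eqF // mul1r !lef_pV2 ?posrE ?Y_gt0 //.
by rewrite Y_le_xi Y_nincr.
Qed.

End Tau.
End Flow.

(** * Smooth convergence of linear combinations of fixed tensors *)

Section SmoothConvergence.
Context {R : realType}.

(** Local boundedness is assumed instead of continuity so that the lemma can be applied to a
    supremum of curvature norms. *)
Lemma compact_locally_bounded (T : topologicalType) (K : set T) (f : T -> R) :
  compact K -> (forall x, K x -> exists B, \forall y \near x, f y <= B) ->
  exists2 B, 0 < B & forall x, K x -> f x <= B.
Proof.
move=> /compact_near_coveringP cK H.
have : \forall B \near +oo, K `<=` (fun x => f x <= B).
  apply: cK => x Kx; have [B0 HB] := H x Kx.
  exists ([set y | f y <= B0], [set B | B0 < B]).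
    by split => //=; apply: nbhs_pinfty_gt; rewrite num_real.
  by move=> [y B] [/= h1 h2]; exact: le_trans h1 (ltW h2).
move=> [B0 [_ HB]]; exists (Num.max B0 0 + 1).
  by rewrite ltr_wpDl // le_max lexx orbT.
move=> x Kx; apply: HB => //=; rewrite ltr_pwDr // le_max lexx //.
Qed.

Lemma pders_smooth n (s : seq 'I_n) (f : 'rV[R]_n -> R) x :
  smooth_germ f x -> smooth_germ (pders s f) x.
Proof. by move=> sf; elim: s => [//|i s IH] /=; exact: sg_pder. Qed.

Lemma pders_lincomb n (I : finType) (s : seq 'I_n) (c : I -> R) (f : I -> 'rV[R]_n -> R) x :
  (forall k, smooth_germ (f k) x) ->
  \forall y \near x, pders s (fun w => \sum_k c k * f k w) y = \sum_k c k * pders s (f k) y.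
Proof.
move=> sf; have nsf : \forall y \near x, forall k, smooth_germ (f k) y.
  by apply: near_fin => k; exact: sg_near.
elim: s => [|i s IH] /=; first by near=> y.
apply: filterS2 nsf (near_join IH) => y sy h.
rewrite (pder_eq i h) pder_sum => [|k]; last by apply: sgZ; exact: pders_smooth.
apply: eq_bigr => k _; rewrite pderM; [|exact: sg_cst|exact: pders_smooth].
by rewrite pder_cst mul0r add0r.
Unshelve. all: by end_near. Qed.

(** Only the coefficients depend on [t], so every iterated derivative is a combination, with these
    same coefficients, of fixed continuous functions, which are bounded on [K]. Convergence of the
    coefficients is then uniform there. *)
Lemma smooth_cvg_lincomb n (T : topologicalType) (A : atlas (R := R) n T) (I : finType)
    (F : set_system R) (FF : Filter F) (S : I -> tensor2 (R := R) n T) (gam : I -> R -> R) (l : I -> R) :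
  (forall k c x, charts A c -> chart_dom c x -> smx (S k c) (chart_coord c x)) ->
  (forall k, gam k t @[t --> F] --> l k) ->
  smooth_cvg A F (fun t c v => \sum_k gam k t *: S k c v) (fun c v => \sum_k l k *: S k c v).
Proof.
move=> sS gl c K s i j e Ac cK Kc e0.
have sf k v : K v -> smooth_germ (fun w => S k c w i j) v.
  by move=> /Kc[x cx <-]; exact: (sS k c x Ac cx).
have [B B0 HB] : exists2 B, 0 < B & forall v, K v ->
    \sum_k `|pders s (fun w => S k c w i j) v| <= B.
  apply: compact_locally_bounded => // v Kv.
  have cs : {for v, continuous (fun v => \sum_k `|pders s (fun w => S k c w i j) v|)}.
    apply: cont_sum => k; apply: (@continuous_comp _ _ _ (pders s (fun w => S k c w i j)) Num.norm).
      exact: sg_continuous (pders_smooth s (sf k v Kv)).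
    exact: norm_continuous.
  exists (\sum_k `|pders s (fun w => S k c w i j) v| + 1).
  apply: filterS (cont_dist (ltr01 : 0 < 1 :> R) cs) => y.
  by rewrite distrC => /(le_lt_trans (ler_norm _)); lra.
have near_l : \forall t \near F, forall k, `|l k - gam k t| < e / 2 / B.
  by apply: filter_forall => k; move/cvgrPdist_lt: (gl k); apply; rewrite !divr_gt0.
apply: filterS near_l => t Ht v Kv.
have E (cc : I -> R) : pders s (fun w => (\sum_k cc k *: S k c w) i j) v =
    \sum_k cc k * pders s (fun w => S k c w i j) v.
  have -> : (fun w => (\sum_k cc k *: S k c w) i j) = (fun w => \sum_k cc k * S k c w i j).
    by apply/funext => w; rewrite summxE; apply: eq_bigr => k _; rewrite mxE.
  exact: nbhs_singleton (pders_lincomb s cc (fun k => sf k v Kv)).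
rewrite !E -sumrB; under eq_bigr do rewrite -mulrBl.
apply: (@le_lt_trans _ _ (e / 2)); last by lra.
apply: le_trans (ler_norm_sum _ _ _) _.
apply: (@le_trans _ _ (\sum_k (e / 2 / B) * `|pders s (fun w => S k c w i j) v|)).
  by apply: ler_sum => k _; rewrite normrM distrC ler_wpM2r // ltW.
rewrite -mulr_sumr -[leRHS](divfK (lt0r_neq0 B0)) ler_wpM2l ?HB //.
by rewrite !divr_ge0 // ltW.
Qed.

End SmoothConvergence.

Section BundleConvergence.
Context {R : realType} {m : nat} {n : 'I_m -> nat} {M : 'I_m -> topologicalType}.
Variable A : forall i, atlas (R := R) (n i + n i) (M i).
Hypothesis MA : forall i, smooth_manifold (A i).
Context {P : topologicalType} (AP : atlas (R := R) (1 + \sum_i (n i + n i)) P).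
Variables (act : R -> P -> P) (proj : P -> prod_topology M).
Hypothesis P_bundle : principal_circle_bundle AP (product_atlas A) act proj.
Variable sigma : tensor1 (R := R) (1 + \sum_i (n i + n i)) P.
Hypothesis sigma_conn : principal_connection AP act sigma.
Unset Implicit Arguments.
Variable g : forall i, tensor2 (R := R) (n i + n i) (M i).
Set Implicit Arguments.
Hypothesis g_metric : forall i, riemannian_metric (A i) (g i).

Lemma bundle_smooth_cvg (F : set_system R) (FF : Filter F) (r a : R -> R) (b : R -> 'I_m -> R)
    (l : R) (k : 'I_m -> R) :
  (r t * a t) @[t --> F] --> l -> (forall i, (r t * b t i) @[t --> F] --> l * k i) ->
  smooth_cvg AP F (fun t c v => r t *: bundle_metric A proj g sigma (a t) (b t) c v)
    (fun c v => l *: bundle_metric A proj g sigma 1 k c v).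
Proof.
move=> al bl.
pose S (j : unit + 'I_m) : tensor2 (R := R) (1 + \sum_i (n i + n i)) P := fun c v =>
  match j with inl _ => (sigma c v)^T *m sigma c v
             | inr i => pullback (A i) (fun y => proj y i) (g i) c v end.
pose gam (j : unit + 'I_m) t := match j with inl _ => r t * a t | inr i => r t * b t i end.
pose lim (j : unit + 'I_m) := match j with inl _ => l | inr i => l * k i end.
have E (c : R) (s : R) (t : 'I_m -> R) ch v :
    c *: bundle_metric A proj g sigma s t ch v =
    \sum_j (match j with inl _ => c * s | inr i => c * t i end) *: S j ch v.
  rewrite big_sumType /= (big_pred1 tt) => [|[] //].
  rewrite /bundle_metric scalerDr scalerA; congr (_ + _).
  by rewrite scaler_sumr; apply: eq_bigr => i _; rewrite scalerA.
have -> : (fun t c v => r t *: bundle_metric A proj g sigma (a t) (b t) c v) =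
    (fun t c v => \sum_j gam j t *: S j c v).
  by apply/funext => t; apply/funext => c; apply/funext => v; rewrite E; apply: eq_bigr => -[].
have -> : (fun c v => l *: bundle_metric A proj g sigma 1 k c v) =
    (fun c v => \sum_j lim j *: S j c v).
  by apply/funext => c; apply/funext => v; rewrite E; apply: eq_bigr => -[[]|i] //; rewrite mulr1.
apply: smooth_cvg_lincomb => [[[]|i] c x Ac cx|[[]|i]] //; last exact: bl.
  by apply: smxM; [apply: smx_tr|]; exact: (sigma_smx sigma_conn).
exact: (pullback_proj_smx MA P_bundle (metric_covariant (g_metric i))).
Qed.

End BundleConvergence.

(** * Compactness and connectedness of the bundle *)
Section Chained.

(** Connectedness as it is used: an equivalence relation whose classes are neighbourhoods of their
    points has a single class. In this form it passes to products and bundles by chaining, and it is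
    finally applied to the relation of being joined by a curve of finite length. *)
Definition chained (T : topologicalType) := forall r : T -> T -> Prop,
  (forall x, r x x) -> (forall x y, r x y -> r y x) ->
  (forall x y z, r x y -> r y z -> r x z) ->
  (forall x, \forall y \near x, r x y) -> forall x y, r x y.

(** The part of [A] related to [x] is cut out by an open set and also by a closed one, the
    complement of the points with a neighbourhood unrelated to [x]. *)
Lemma connected_chained_in (T : topologicalType) (A : set T) : connected A ->
  forall r : T -> T -> Prop, (forall x y, r x y -> r y x) ->
  (forall x y z, r x y -> r y z -> r x z) ->
  (forall x, A x -> \forall y \near x, r x y) ->
  forall x y, A x -> A y -> r x y.
Proof.
move=> cA r rs rt rl x y Ax Ay.
have rr z : A z -> r z z by move=> /rl/nbhs_singleton.
pose B := [set z | A z /\ r x z].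
suff : B = A by move=> BA; have [] : B y by rewrite BA.
apply: cA; first by exists x; split=> //; exact: rr.
- exists [set z | \forall v \near z, r x v].
    rewrite openE => z /= h; exact: near_join h.
  apply/seteqP; split=> z /= [Az h]; split=> //; last exact: nbhs_singleton h.
  by apply: filterS (rl z Az) => v; exact: rt.
- exists (~` [set z | \forall v \near z, ~ r x v]).
    by apply: open_closedC; rewrite openE => z /= h; exact: near_join h.
  apply/seteqP; split=> z /= [Az h]; split=> //; first by move/nbhs_singleton; exact.
  apply: contrapT => nr; apply: h; apply: filterS (rl z Az) => v zv xv; apply: nr.
  by apply: rt xv _; exact: rs.
Qed.

Lemma connected_chained (T : topologicalType) : connected [set: T] -> chained T.
Proof.
by move=> cT r rr rs rt rl x y; apply: (connected_chained_in cT rs rt) => // z _; exact: rl.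
Qed.

(** Pass from [x] to [y] by replacing one coordinate at a time; each replacement stays in a single
    factor. *)
Lemma product_chained (m : nat) (T : 'I_m -> topologicalType) :
  (forall i, chained (T i)) -> chained (prod_topology T).
Proof.
move=> cT r rr rs rt rl x y.
have one (z : prod_topology T) i (w : T i) : r z (dfwith z i w).
  have zE : dfwith z i (z i) = z by apply: functional_extensionality_dep => j; case: dfwithP.
  rewrite -{1}zE.
  apply: (cT i (fun u v => r (dfwith z i u) (dfwith z i v))) => [u|u v|u v s|u] //.
  - exact: rs.
  - exact: rt.
  have c : {for u, continuous (fun v => dfwith z i v : prod_topology T)}.
    apply: prod_continuous => j; case: (eqVneq i j) => [<-|ij].
      have -> : (fun v => dfwith z i v i) = id by apply/funext => v; rewrite dfwithin.
      by [].
    have -> : (fun v => dfwith z i v j) = (fun=> z j).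
      by apply/funext => v; rewrite dfwithout.
    exact: cst_continuous.
  exact: (c (r (dfwith z i u)) (rl _)).
pose f (s : seq 'I_m) : prod_topology T := fun i => if i \in s then y i else x i.
have fs s : r x (f s).
  elim: s => [|i s IH]; first exact: rr.
  apply: rt IH _; have -> : f (i :: s) = dfwith (f s) i (y i); last exact: one.
  apply: functional_extensionality_dep => j; rewrite /f in_cons; case: dfwithP => [|k ik]; first by rewrite eqxx.
  by rewrite eq_sym (negbTE ik).
have -> : y = f (enum 'I_m) by apply: functional_extensionality_dep => i; rewrite /f mem_enum.
exact: fs.
Qed.

End Chained.

Section BundleTopology.
Context {R : realType} {m : nat} {d : 'I_m -> nat} {M : 'I_m -> topologicalType}.
Variable A : forall i, atlas (R := R) (d i) (M i).
Hypothesis MA : forall i, smooth_manifold (A i).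
Context {P : topologicalType} (AP : atlas (R := R) (1 + \sum_i d i) P).
Variables (act : R -> P -> P) (proj : P -> prod_topology M).
Hypothesis P_bundle : principal_circle_bundle AP (product_atlas A) act proj.
Let MP := pcb_manifold P_bundle.

(* Applied to [product_atlas] and [cylinder_atlas], hence no manifold hypothesis on
   the source. *)
Lemma smooth_at_continuous_chart n k (T S : topologicalType) (B : atlas (R := R) n T)
    (C : atlas (R := R) k S) (f : T -> S) x (c : chart n T) :
  smooth_manifold C -> charts B c -> {for x, continuous (chart_coord c)} ->
  (\forall y \near x, chart_dom c y /\ chart_param c (chart_coord c y) = y) ->
  smooth_at B C f x -> {for x, continuous f}.
Proof.
move=> MC Bc cc near_c sf Q Qx.
have [cx xE] := nbhs_singleton near_c.
set e := chart_at C (f x); have Ce : charts C e := chart_at_charts MC _.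
have ex : chart_dom e (f x) := chart_at_dom MC _.
have s := smx_continuous (smooth_at_smx sf Bc Ce cx ex).
have H : \forall v \near chart_coord c x,
    Q (chart_param e (chart_coord e (f (chart_param c v)))).
  by apply: (s (fun w => Q (chart_param e w))); rewrite xE; exact: (near_param (Q := Q) MC Ce ex Qx).
have H' : \forall v \near chart_coord c x, Q (f (chart_param c v)).
  apply: filterS2 H (smooth_at_dom sf Bc Ce cx ex) => v + ev /=.
  by rewrite (chart_coordK MC Ce ev).
have : \forall y \near x, Q (f (chart_param c (chart_coord c y))) by exact: (cc _ H').
by apply: filterS2 near_c => y [_ ->].
Qed.

Lemma section_continuous (s : prod_topology M -> P) b :
  smooth_at (product_atlas A) AP s b -> {for b, continuous s}.
Proof.
pose e i := chart_at (A i) (b i).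
have Ae i : charts (A i) (e i) by exact: chart_at_charts.
have eb i : chart_dom (e i) (b i) by exact: chart_at_dom.
apply: (smooth_at_continuous_chart (c := product_chart e)) => //.
- exact: product_chart_charts.
- move=> Q; exact: (product_near_coord MA Ae eb).
- apply: filterS (product_near_dom MA Ae eb) => y ey; split=> //.
  exact: product_coordK.
Qed.

Lemma act_continuous t x : {for (t, x), continuous (fun z : R * P => act z.1 z.2)}.
Proof.
have sact : smooth_at (cylinder_atlas AP) AP (fun z => act z.1 z.2) (t, x).
  exact: (pcb_act_smooth P_bundle).
pose c := chart_at AP x.
have Ac : charts AP c by exact: chart_at_charts.
have cx : chart_dom c x by exact: chart_at_dom.
apply: (smooth_at_continuous_chart (c := cylinder_chart c) MP _ _ _ sact).
- by exists c.
- apply: cont_mx => i j; rewrite ord1 -[j]splitK; case: (fintype.split j) => k /=.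
    rewrite (_ : (fun y => _) = fst); first exact: cvg_fst.
    by apply/funext => y; rewrite row_mxEl mxE.
  rewrite (_ : (fun y => _) = (fun z : R * P => chart_coord c z.2 0 k)); last first.
    by apply/funext => y; rewrite row_mxEr.
  apply: (cont_entry (F := fun z : R * P => chart_coord c z.2)).
  apply: (@continuous_comp _ _ _ snd (chart_coord c)); first exact: cvg_snd.
  exact: (chart_coord_continuous MP Ac cx).
- exists (setT, chart_dom c); first by split; [exact: filterT|exact: (near_dom MP Ac cx)].
  move=> [r y] [_ cy] /=; split=> //.
  by rewrite row_mxKl row_mxKr mxE (chart_coordK MP Ac cy).
Qed.

Lemma act_orbit_reduce t x : exists2 s, s \in `[0, 2 * pi]%R & act t x = act s x.
Proof.
have p0 : 0 < 2 * pi :> R by rewrite mulr_gt0 // pi_gt0.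
pose k : int := Num.floor (t / (2 * pi)).
exists (t - k%:~R * (2 * pi)).
  rewrite in_itv /= subr_ge0 -ler_pdivlMr // floor_le_tmp /=.
  have : t / (2 * pi) < (k + 1)%:~R by exact: floorD1_gt.
  by rewrite intrD ltr_pdivrMr // mulrDl mul1r; lra.
have fixk : act (k%:~R * (2 * pi)) x = x by apply/(pcb_free P_bundle); exists k.
by rewrite -[in RHS]fixk -(pcb_actD P_bundle) subrK.
Qed.

(** Over a trivializing set the bundle is the image of the section under translations in the compact
    interval from 0 to 2 pi. Covering compactness is used twice: for the translations, uniformly in
    base points near [b], and then for the base. *)
Lemma bundle_compact : (forall i, compact [set: M i]) -> compact [set: P].
Proof.
move=> cM; apply/compact_near_coveringP => I F Q FF HQ.
have cB : compact [set: prod_topology M].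
  have := tychonoff cM; congr compact; exact/seteqP.
have {}HQ (x : P) := HQ x Logic.I.
have cI : compact `[0, 2 * pi : R] by exact: segment_compact.
have : \forall i \near F, [set: prod_topology M] `<=`
    (fun y => forall x, proj x = y -> Q i x).
  move/compact_near_coveringP: cB; apply=> b _.
  have [U [oU Ub] [s [_ [_ [sU _ _]]]]] := pcb_trivial P_bundle b.
  have cs := section_continuous (sU b Ub).1.
  have H : \forall z \near (nbhs b, F), `[0, 2 * pi] `<=` (fun t : R => Q z.2 (act t (s z.1))).
    have cov := (compact_near_coveringP _).1 cI.
    apply: (cov (prod_topology M * I)%type (filter_prod (nbhs b) F)
      (fun z t => Q z.2 (act t (s z.1)))) => t _.
    have [[V W] /= [nV nW] VW] := HQ (act t (s b)).
    have [[T1 V1] /= [nT nV1] TV] := act_continuous (t := t) (x := s b) nV.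
    exists (T1, [set z : prod_topology M * I | V1 (s z.1) /\ W z.2]).
      split=> //=; exists (s @^-1` V1, W); first by split => //; exact: cs.
      by move=> [y i] [/= h1 h2].
    move=> [t' [y i]] [/= Tt [V1y Wi]]; apply: (VW (act t' (s y), i)); split=> //=.
    exact: (TV (t', s y)).
  have nU : \forall z \near (nbhs b, F), U z.1.
    exists (U, setT) => /=; first by split; [exact: open_nbhs_nbhs|exact: filterT].
    by move=> [y i] [].
  apply: filterS2 H nU => -[y i] /= H Uy x px.
  have [t ->] : exists t, x = act t (s y).
    by apply/(pcb_fibre P_bundle); rewrite (sU y Uy).2.
  have [r r01 ->] := act_orbit_reduce t (s y); exact: H.
by apply: filterS => i H x _; exact: (H (proj x)).
Qed.

(** An orbit is a continuous image of the line, so points of one fibre are related. The relation on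
    the base demanding that all points over [b] be related to all points over [b'] is then again an
    equivalence, and local sections make it locally reflexive. *)
Lemma bundle_chained : (forall i, connected [set: M i]) -> chained P.
Proof.
move=> cM r rr rs rt rl.
have ra t x : r x (act t x).
  have cT : connected `[Num.min 0 t, Num.max 0 t] by exact: segment_connected.
  rewrite -{1}[x](pcb_act0 P_bundle).
  apply: (connected_chained_in cT (r := fun u v => r (act u x) (act v x))).
  - by move=> u v; exact: rs.
  - by move=> u v w; exact: rt.
  - move=> u _.
    have c : {for u, continuous (fun v => act v x)}.
      apply: (@continuous_comp _ _ _ (fun v : R => (v, x)) (fun z : R * P => act z.1 z.2)).
        exact: (cvg_pair cvg_id (cvg_cst x)).
      exact: act_continuous.
    exact: (c _ (rl _)).
  - by rewrite /= in_itv /= ge_min le_max !lexx.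
  - by rewrite /= in_itv /= ge_min le_max !lexx !orbT.
have rfib x y : proj x = proj y -> r x y by move=> /(pcb_fibre P_bundle)[t ->].
have cB : chained (prod_topology M).
  by apply: product_chained => i; exact: connected_chained.
move=> x y.
suff : forall z w, proj z = proj x -> proj w = proj y -> r z w by exact.
apply: (cB (fun b b' => forall z w, proj z = b -> proj w = b' -> r z w)) => //.
- by move=> b z w zb wb; apply: rfib; rewrite zb.
- by move=> b b' h z w zb wb; apply: rs; exact: h.
- move=> b1 b2 b3 h12 h23 z w zb wb.
  have [U [oU Ub] [s [_ [_ [sU _ _]]]]] := pcb_trivial P_bundle b2.
  have sb := (sU b2 Ub).2.
  exact: rt (h12 z (s b2) zb sb) (h23 (s b2) w sb wb).
- move=> b; have [U [oU Ub] [s [_ [_ [sU _ _]]]]] := pcb_trivial P_bundle b.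
  have cs := section_continuous (sU b Ub).1.
  have H : \forall b' \near b, r (s b) (s b') by exact: (cs _ (rl (s b))).
  have nU : \forall b' \near b, U b' by exact: open_nbhs_nbhs.
  apply: filterS2 H nU => b' h Ub' z w zb wb.
  apply: (rt _ (s b)); first by apply: rfib; rewrite (sU b Ub).2.
  by apply: (rt _ (s b')) => //; apply: rfib; rewrite (sU b' Ub').2.
Qed.

End BundleTopology.

(** * Riemannian distances *)
Section Curves.
Context {R : realType}.

Lemma Rintegral_rev (f : R -> R) : {within `[0, 1], continuous f} ->
  Rintegral lebesgue_measure `[0, 1] f = Rintegral lebesgue_measure `[0, 1] (fun s => f (1 - s)).
Proof.
move=> cf; have r01 : 0 <= (1 : R) <= 1 by rewrite lexx ler01.
have H : Rintegral lebesgue_measure `[0, 1] f =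
    Rintegral lebesgue_measure `[1 - 1, 1] (fun s => f (1 - s)).
  exact: Rintegration_by_substitution_onem r01 cf.
by rewrite H subrr.
Qed.

Lemma le_Rintegral_scale (f1 f2 : R -> R) (c : R) :
  lebesgue_measure.-integrable `[0, 1] (EFin \o f1) ->
  lebesgue_measure.-integrable `[0, 1] (EFin \o f2) ->
  (forall t, 0 <= t <= 1 -> f2 t <= c * f1 t) ->
  Rintegral lebesgue_measure `[0, 1] f2 <= c * Rintegral lebesgue_measure `[0, 1] f1.
Proof.
move=> i1 i2 H; rewrite -RintegralZl //; apply: le_Rintegral => //.
  have -> : EFin \o (fun t => c * f1 t) = (fun t => c%:E * (EFin \o f1) t)%E.
    by apply/funext => t; rewrite /= EFinM.
  exact: integrableZl.
Qed.

Lemma curve_chain p (f : 'rV[R]_p -> R) (phi : R -> 'rV[R]_p) (t : R) :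
  differentiable f (phi t) -> (forall j, derivable (fun s => phi s 0 j) t 1) ->
  is_derive t (1 : R) (fun s => f (phi s))
    (\sum_j derive1 (fun s => phi s 0 j) t * pder j f (phi t)).
Proof.
move=> df dphi.
have E : phi = \sum_(j < p) (fun v => phi v 0 j *: (delta_mx 0 j : 'rV[R]_p)).
  by apply/funext => v; rewrite fct_sumE; exact: row_sum_delta.
have D : differentiable phi t.
  rewrite E; apply: differentiable_sum => j; apply: differentiableZl.
  by apply/derivable1_diffP; exact: dphi.
have Dc : differentiable (f \o phi) t by exact: differentiable_comp.
split; first exact: diff_derivable.
rewrite -[fun v => f (phi v)]/(f \o phi) deriveE // diff_comp //=.
have -> : 'd phi t 1 = \row_j derive1 (fun s => phi s 0 j) t.
  rewrite -(deriveE _ D) (derive_mx (diff_derivable D)).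
  by apply/rowP => j; rewrite !mxE derive1E.
rewrite [X in 'd f _ X]row_sum_delta linear_sum; apply: eq_bigr => j _.
by rewrite mxE linearZ /= -(deriveE _ df).
Qed.

Context {n : nat} {T : topologicalType} (A : atlas (R := R) n T).
Hypothesis MA : smooth_manifold A.
Variable j0 : 'I_n.
Implicit Types (c d : chart (R := R) n T) (y : R -> T) (t : R).

Definition velocity c y t : 'rV[R]_n :=
  \row_j derive1 (fun s : R => chart_coord c (y s) 0 j) t.

Definition derivable_in c y t := (\forall s \near t, chart_dom c (y s)) /\
  forall j, derivable (fun s : R => chart_coord c (y s) 0 j) t 1.

Lemma C1_near c y t : C1_at A y t -> charts A c -> chart_dom c (y t) ->
  \forall s \near t, derivable_in c y s.
Proof.
move=> yt Ac cy; have H j := (yt c Ac cy j).1.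
(* [C1_at] states the domain condition once for each component, so an index [j0] is needed to read
   it off. *)
have nd : \forall s \near t, chart_dom c (y s) by apply: filterS (H j0) => s [].
have nD : \forall s \near t, forall j, derivable (fun s : R => chart_coord c (y s) 0 j) s 1.
  by apply: near_fin => j; apply: filterS (H j) => s [].
by apply: filterS2 (near_join nd) nD => s ? ?; split.
Qed.

Lemma coord_continuous_in c y t : derivable_in c y t ->
  {for t, continuous (fun s => chart_coord c (y s))}.
Proof.
move=> [_ dy]; apply: cont_mx => i j; rewrite ord1.
by apply: differentiable_continuous; apply/derivable1_diffP; exact: dy.
Qed.

Lemma velocity_change c d y t : charts A c -> charts A d -> derivable_in c y t ->
  chart_dom d (y t) ->
  velocity d y t =
  velocity c y t *m 'J (chart_coord d \o chart_param c) (chart_coord c (y t)).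
Proof.
move=> Ac Ad [nd dy] dyt; have cyt := nbhs_singleton nd.
have sT := transition_smx MA Ac Ad cyt dyt.
apply/rowP => j; rewrite mxE [RHS]mxE derive1E.
have df : differentiable (fun v => (chart_coord d \o chart_param c) v 0 j) (chart_coord c (y t)).
  by have /smooth_germP[U [oU Ux CU]] := sT 0 j; exact: (Ck1_differentiable oU (CU 1%N) Ux).
have [_ D] := curve_chain (phi := fun s => chart_coord c (y s)) df dy.
have E : \forall s \near t, (chart_coord d \o chart_param c) (chart_coord c (y s)) 0 j =
    chart_coord d (y s) 0 j.
  by apply: filterS nd => s cs /=; rewrite (chart_coordK MA Ac cs).
rewrite -(near_eq_derive _ E) D; apply: eq_bigr => k _.
by rewrite mxE (jacobianE sT) mxE.
Qed.

Section Metric.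
Variable g : tensor2 (R := R) n T.
Hypothesis gR : riemannian_metric A g.

Definition sqnorm (v : 'rV[R]_n) (S : 'M[R]_n) : R := (v *m S *m v^T) 0 0.

(** [speed] switches charts along the curve; in one fixed chart it becomes a formula whose
    continuity can be checked. *)
Lemma speed_chart c y t : charts A c -> derivable_in c y t ->
  speed A g y t = Num.sqrt (sqnorm (velocity c y t) (g c (chart_coord c (y t)))).
Proof.
move=> Ac dy; have cyt := nbhs_singleton dy.1.
set d := chart_at A (y t).
have Ad : charts A d := chart_at_charts MA _.
have dyt : chart_dom d (y t) := chart_at_dom MA _.
rewrite /speed -/d -/(velocity d y t) (velocity_change Ac Ad dy dyt) /sqnorm.
by rewrite ((metric_covariant gR).2 c d (y t)) // trmx_mul !mulmxA.
Qed.

Lemma sqnormE v S : sqnorm v S = \sum_i \sum_j v 0 i * S i j * v 0 j.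
Proof.
rewrite /sqnorm mxE exchange_big /=; apply: eq_bigr => j _.
by rewrite mxE mulr_suml; apply: eq_bigr => i _; rewrite [X in _ * X]mxE.
Qed.

Lemma speed_continuous y t : C1_at A y t -> {for t, continuous (speed A g y)}.
Proof.
move=> yt; set c := chart_at A (y t).
have Ac : charts A c := chart_at_charts MA _.
have cyt : chart_dom c (y t) := chart_at_dom MA _.
have nD := C1_near yt Ac cyt.
have E : \forall s \near t,
    Num.sqrt (sqnorm (velocity c y s) (g c (chart_coord c (y s)))) = speed A g y s.
  by apply: filterS nD => s ds; rewrite (speed_chart Ac ds).
apply: cont_eq E _.
apply: (@continuous_comp _ _ _ (fun s => sqnorm (velocity c y s) (g c (chart_coord c (y s)))) Num.sqrt);
  last exact: sqrt_continuous.
rewrite (_ : (fun s => _) = (fun s => \sum_i \sum_j velocity c y s 0 i *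
    g c (chart_coord c (y s)) i j * velocity c y s 0 j)); last first.
  by apply/funext => s; rewrite sqnormE.
have cv i : {for t, continuous (fun s => velocity c y s 0 i)}.
  rewrite (_ : (fun s => _) = derive1 (fun s : R => chart_coord c (y s) 0 i)).
    exact: (yt c Ac cyt i).2.
  by apply/funext => s; rewrite mxE.
apply: cont_sum => i; apply: cont_sum => j; apply: contM (cv j).
apply: contM; first exact: cv.
apply: (@continuous_comp _ _ _ (fun s => chart_coord c (y s)) (fun v => g c v i j)).
  exact: coord_continuous_in (nbhs_singleton nD).
exact: sg_continuous ((metric_covariant gR).1 c (y t) i j Ac cyt).
Qed.

Lemma speed_within y : (forall t, 0 <= t <= 1 -> C1_at A y t) ->
  {within `[0, 1], continuous (speed A g y)}.
Proof.
move=> yC; apply/continuous_within_itvP => //; split.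
- by move=> t; rewrite in_itv /= => /andP[t0 t1]; apply: speed_continuous; apply: yC; rewrite !ltW.
- by apply: cvg_at_right_filter; apply: speed_continuous; apply: yC; rewrite lexx ler01.
- by apply: cvg_at_left_filter; apply: speed_continuous; apply: yC; rewrite lexx ler01.
Qed.

Lemma speed_integrable y : (forall t, 0 <= t <= 1 -> C1_at A y t) ->
  lebesgue_measure.-integrable `[0, 1] (EFin \o speed A g y).
Proof.
move=> yC; apply: continuous_compact_integrable; first exact: segment_compact.
exact: speed_within.
Qed.

Lemma speed_ge0 y t : 0 <= speed A g y t. Proof. exact: sqrtr_ge0. Qed.

Lemma curve_length_ge0 y : 0 <= curve_length A g y.
Proof. by apply: Rintegral_ge0 => t _; exact: speed_ge0. Qed.

Lemma joined_ge0 x z L : joined A g x z L -> 0 <= L.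
Proof. by elim=> // y w L' _ _; apply: addr_ge0; exact: curve_length_ge0. Qed.

Lemma joined_trans x z w L L' : joined A g x z L -> joined A g z w L' ->
  joined A g x w (L + L').
Proof.
elim=> [u|y u L1 yC _ IH]; first by rewrite add0r.
by move=> /IH h; rewrite -addrA; exact: joined_cons.
Qed.

Lemma joined_curve y : (forall t, 0 <= t <= 1 -> C1_at A y t) ->
  joined A g (y 0) (y 1) (curve_length A g y).
Proof.
by move=> yC; rewrite -[curve_length _ _ _]addr0; apply: joined_cons => //; exact: joined_refl.
Qed.

Let rev y s : T := y (1 - s).

Let is_derive_rev (f : R -> R) (t : R) : derivable f (1 - t) 1 ->
  is_derive t (1 : R) (fun s => f (1 - s)) (- derive1 f (1 - t)).
Proof.
move=> df; have d1 : is_derive t (1 : R) (fun s : R => 1 - s) (-1).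
  by have := is_deriveB (is_derive_cst (1 : R) t (1 : R)) (is_derive_id t (1 : R)); rewrite sub0r.
have d2 : is_derive ((fun s : R => 1 - s) t) (1 : R) f (derive1 f (1 - t)).
  by rewrite derive1E; exact: derivableP.
by have := @is_derive1_comp R f (fun s : R => 1 - s) t _ _ d2 d1; rewrite mulrN1.
Qed.

Let near_rev (Q : R -> Prop) t : (\forall s \near 1 - t, Q s) -> \forall s \near t, Q (1 - s).
Proof.
have c : {for t, continuous (fun s : R => 1 - s)}.
  by apply: continuousB; [exact: cst_continuous|exact: cvg_id].
exact: (c Q).
Qed.

Lemma rev_C1 y t : C1_at A y (1 - t) -> C1_at A (rev y) t.
Proof.
move=> yt c Ac cyt j; have [H cH] := yt c Ac cyt j; split.
  apply: filterS (near_rev H) => s [cs ds].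
  by split; [exact: cs|have [] := is_derive_rev ds].
have E : \forall s \near t, - derive1 (fun s => chart_coord c (y s) 0 j) (1 - s) =
    derive1 (fun s => chart_coord c (rev y s) 0 j) s.
  apply: filterS (near_rev H) => s [cs ds].
  by rewrite [RHS]derive1E; have [_ <-] := is_derive_rev ds.
apply: cont_eq E _; apply: continuousN.
apply: (@continuous_comp _ _ _ (fun s : R => 1 - s) (derive1 _)) cH.
by apply: continuousB; [exact: cst_continuous|exact: cvg_id].
Qed.

Lemma rev_speed y t : C1_at A y (1 - t) -> speed A g (rev y) t = speed A g y (1 - t).
Proof.
move=> yt; set c := chart_at A (y (1 - t)).
have Ac : charts A c := chart_at_charts MA _.
have cyt : chart_dom c (y (1 - t)) := chart_at_dom MA _.
rewrite /speed -/c -/(velocity c (rev y) t) -/(velocity c y (1 - t)).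
have -> : velocity c (rev y) t = - velocity c y (1 - t).
  apply/rowP => j; rewrite mxE [RHS]mxE [X in _ = - X]mxE derive1E.
  have [_ dj] := nbhs_singleton (C1_near yt Ac cyt).
  by have [_ ->] := is_derive_rev (dj j).
by rewrite linearN /= mulmxN !mulNmx opprK.
Qed.

Lemma joined_sym x z L : joined A g x z L -> joined A g z x L.
Proof.
elim=> [u|y u L' yC _ IH]; first exact: joined_refl.
rewrite addrC; apply: joined_trans IH _.
have rC t : 0 <= t <= 1 -> C1_at A (rev y) t.
  by move=> /andP[t0 t1]; apply: rev_C1; apply: yC; lra.
have -> : curve_length A g y = curve_length A g (rev y).
  apply: etrans (Rintegral_rev (speed_within yC)) _; apply: eq_Rintegral => t t01.
  apply/esym/rev_speed/yC; move: t01.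
  by rewrite inE /= in_itv /= => /andP[]; lra.
by have := joined_curve rC; rewrite /rev subr0 subrr.
Qed.

End Metric.

Lemma joined_scale g g' (mu : R) x z L : riemannian_metric A g -> riemannian_metric A g' ->
  0 <= mu ->
  (forall c (u : T) v, charts A c -> chart_dom c u ->
     sqnorm v (g' c (chart_coord c u)) <= mu * sqnorm v (g c (chart_coord c u))) ->
  joined A g x z L -> exists2 L', L' <= Num.sqrt mu * L & joined A g' x z L'.
Proof.
move=> gR gR' mu0 H; elim=> [u|y u L1 yC _ [L' L'L jL']].
  by exists 0; [rewrite mulr0|exact: joined_refl].
exists (curve_length A g' y + L'); last exact: joined_cons.
rewrite mulrDr lerD //; apply: le_Rintegral_scale; [exact: speed_integrable|exact: speed_integrable|].
move=> t _; rewrite /speed -sqrtrM //; apply: ler_wsqrtr; apply: H; [exact: chart_at_charts|exact: chart_at_dom].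
Qed.

Lemma derive_sum n' (f : 'rV[R]_n' -> R) (z e : 'rV[R]_n') : differentiable f z ->
  'D_e f z = \sum_i e 0 i * pder i f z.
Proof.
move=> df; rewrite deriveE // [X in 'd f _ X]row_sum_delta linear_sum; apply: eq_bigr => i _.
by rewrite linearZ /= -(deriveE _ df).
Qed.

Section Local.
Variable g : tensor2 (R := R) n T.
Hypothesis gR : riemannian_metric A g.

Lemma sqnorm_bound (S : 'M[R]_n) (b : 'I_n -> 'I_n -> R) v :
  (forall i j, `|S i j| <= b i j) -> sqnorm v S <= (\sum_i \sum_j b i j) * `|v| ^+ 2.
Proof.
move=> Sb; rewrite sqnormE mulr_suml; apply: ler_sum => i _; rewrite mulr_suml.
apply: ler_sum => j _; apply: le_trans (ler_norm _) _.
rewrite !normrM mulrAC mulrC; apply: ler_pM => //.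
by rewrite expr2; apply: ler_pM => //; exact: coord_le_norm.
Qed.

(** Straight segments in a chart are short, because the metric coefficients are bounded near its
    centre. The common bound 1 on the lengths is what lets compactness produce a finite diameter. *)
Lemma local_joined x : \forall y \near x, exists2 L, L <= 1 & joined A g x y L.
Proof.
set c := chart_at A x; set z0 := chart_coord c x.
have Ac : charts A c := chart_at_charts MA _.
have cx : chart_dom c x := chart_at_dom MA _.
pose b i j := `|g c z0 i j| + 1.
pose B := \sum_i \sum_j b i j.
have B0 : 0 <= B by do 2 (apply: sumr_ge0 => ? _); rewrite addr_ge0.
have ng : \forall z \near z0, forall i j, `|g c z i j| <= b i j.
  apply: near_fin => i; apply: near_fin => j.
  have cg := sg_continuous ((metric_covariant gR).1 c x i j Ac cx).
  apply: filterS (cont_dist ltr01 cg) => z h; rewrite /b.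
  rewrite -[g c z i j](subrK (g c z0 i j)) addrC (le_trans (ler_normD _ _)) // lerD2l.
  by rewrite distrC; exact: ltW.
have nc := near_chart MA Ac cx; rewrite -/z0 in nc.
have [d d0 dP] := (nbhs_rVP _ _).1 (near_join (near_and ng nc)).
(* The squared speed of the segment with displacement [e] is at most [B] times the square of [|e|],
   which is at most 1 when [|e|] is below [(B + 1)^-1]. Adding 1 to [B] keeps the inverse positive
   when [B = 0]. *)
pose rho := Num.min d (B + 1)^-1.
have B1 : 0 < B + 1 by rewrite ltr_wpDl.
have rho0 : 0 < rho by rewrite lt_min d0 invr_gt0.
have nz : \forall z \near z0, `|z - z0| < rho.
  by apply/nbhs_rVP; exists rho => // h; rewrite addrC addKr.
have ny := near_coord MA Ac cx nz.
apply: filterS2 ny (near_dom MA Ac cx) => y yrho cy.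
pose e := chart_coord c y - z0; rewrite -/e in yrho.
pose Z (s : R) := z0 + s *: e.
pose gam s := chart_param c (Z s).
have [ed eB] : `|e| < d /\ `|e| < (B + 1)^-1 by move: yrho; rewrite lt_min => /andP.
have cZ t : {for t, continuous Z}.
  apply: cont_mx => i j; rewrite (_ : (fun s => _) = (fun s => z0 i j + s * e i j)); last first.
    by apply/funext => s; rewrite !mxE.
  by apply: contD; [exact: cont_cst|apply: contM; [exact: cvg_id|exact: cont_cst]].
have ZP t : 0 <= t <= 1 -> \forall z \near Z t, (forall i j, `|g c z i j| <= b i j) /\
    (chart_dom c (chart_param c z) /\ chart_coord c (chart_param c z) = z).
  move=> /andP[t0 t1]; apply: dP; apply: le_lt_trans ed.
  by rewrite normrZ ger0_norm // ler_piMl.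
have nearZ t (Q : 'rV[R]_n -> Prop) : (\forall z \near Z t, Q z) -> \forall s \near t, Q (Z s).
  exact: (cZ t Q).
have derc t j : is_derive t (1 : R) (fun s => Z s 0 j) (e 0 j).
  have d1 : is_derive t (1 : R) (fun s : R => z0 0 j + s * e 0 j) (e 0 j).
    have D1 := is_deriveD (is_derive_cst (z0 0 j : R) t (1 : R))
      (is_deriveM (is_derive_id t (1 : R)) (is_derive_cst (e 0 j : R) t (1 : R))).
    by apply: (is_derive_eq D1); rewrite /GRing.scale /= mulr0 add0r mulr1 add0r.
  rewrite (_ : (fun s => _) = (fun s : R => z0 0 j + s * e 0 j)) //.
  by apply/funext => s; rewrite !mxE.
have gamC t : 0 <= t <= 1 -> C1_at A gam t.
  move=> t01 c' Ac' dt j.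
  have [_ [ct ctE]] := nbhs_singleton (ZP t t01).
  have sT := transition_smx MA Ac Ac' ct dt 0 j; rewrite ctE in sT.
  have nd := transition_dom MA Ac Ac' ct dt; rewrite ctE in nd.
  pose f v := (chart_coord c' \o chart_param c) v 0 j; rewrite -/f in sT.
  have D s : smooth_germ f (Z s) -> is_derive s (1 : R) (fun s => chart_coord c' (gam s) 0 j)
      (\sum_i e 0 i * pder i f (Z s)).
    move=> sf; have df := sg_differentiable sf.
    rewrite -derive_sum //; apply: (derive_lineP (f := f)).
    exact: diff_derivable.
  split.
    apply: filterS2 (nearZ t _ nd) (nearZ t _ (sg_near sT)) => s ds sf; split=> //.
    by have [] := D s sf.
  have E : \forall s \near t, \sum_i e 0 i * pder i f (Z s) =
      derive1 (fun s => chart_coord c' (gam s) 0 j) s.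
    by apply: filterS (nearZ t _ (sg_near sT)) => s /D[_ <-]; rewrite derive1E.
  apply: cont_eq E _; apply: cont_sum => i; apply: contM; first exact: cont_cst.
  apply: (@continuous_comp _ _ _ Z (pder i f)) (cZ t) _.
  exact: sg_continuous (sg_pder i sT).
exists (curve_length A g gam); last first.
  have J := joined_curve g gamC.
  have g0 : gam 0 = x by rewrite /gam /Z scale0r addr0 (chart_coordK MA).
  have g1 : gam 1 = y by rewrite /gam /Z scale1r addrC subrK (chart_coordK MA).
  by rewrite g0 g1 in J.
have sp t : 0 <= t <= 1 -> speed A g gam t <= 1 * 1.
  move=> t01; have dt : derivable_in c gam t.
    exact: nbhs_singleton (C1_near (gamC t t01) Ac (nbhs_singleton (ZP t t01)).2.1).
  have [bt [ct ctE]] := nbhs_singleton (ZP t t01).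
  rewrite (speed_chart gR Ac dt) ctE.
  have -> : velocity c gam t = e.
    apply/rowP => j; rewrite mxE derive1E.
    have E : \forall s \near t, Z s 0 j = chart_coord c (gam s) 0 j.
      by apply: filterS (nearZ t _ (ZP t t01)) => s [_ [_ h]]; rewrite /gam h.
    by rewrite -(near_eq_derive _ E); have [_ ->] := derc t j.
  rewrite mulr1 -[leRHS]sqrtr1; apply: ler_wsqrtr; apply: le_trans (sqnorm_bound _ bt) _.
  have e1 : `|e| * (B + 1) <= 1 by rewrite -ler_pdivlMr // mul1r ltW.
  have e0 : 0 <= `|e| by [].
  have aux (u w : R) : u * (w + 1) <= 1 -> 0 <= u -> 0 <= w -> w * u ^+ 2 <= 1.
    move=> h1 h2 h3; have h4 : 0 <= w * u by rewrite mulr_ge0.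
    have h5 : w * u * u <= 1 * u by rewrite ler_wpM2r //; lra.
    by rewrite expr2 mulrA; lra.
  exact: aux e1 e0 B0.
apply: le_trans (le_Rintegral_scale _ _ sp) _ => //.
- apply: continuous_compact_integrable; first exact: segment_compact.
  by apply: continuous_subspaceT => ?; exact: cst_continuous.
- exact: speed_integrable.
rewrite Rintegral_cst //= lebesgue_measure_itv /= lte_fin ltr01 -EFinB /= subr0.
by rewrite !mulr1.
Qed.

Hypotheses (cT : compact [set: T]) (chT : chained T).

(** Chaining shows that every point is joined to a base point by a curve of some finite length;
    since lengths change locally by at most 1, compactness bounds them uniformly, and twice that
    bound controls the diameter. *)
Lemma bounded_joined : exists D, forall x z, exists2 L, L <= D & joined A g x z L.
Proof.
case: (pselect (inhabited T)) => [[x0]|nT]; last by exists 0 => x; case: nT; exists.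
have all_joined : forall z, exists L, joined A g x0 z L.
  apply: (chT (r := fun x z => exists L, joined A g x z L)) => [x|x y [L]|x y z [L h] [L' h']|x].
  - by exists 0; exact: joined_refl.
  - by move=> /(joined_sym gR); exists L.
  - by exists (L + L'); exact: joined_trans h h'.
  - by apply: filterS (local_joined x) => y [L _]; exists L.
have : \forall D \near +oo, [set: T] `<=` (fun z => exists2 L, L <= D & joined A g x0 z L).
  apply: (compact_near_coveringP _).1 cT _ _ _ _ _ => z _.
  have [L0 h0] := all_joined z.
  exists ([set y | exists2 L, L <= 1 & joined A g z y L], [set D | L0 + 1 < D]).
    by split; [exact: local_joined|apply: nbhs_pinfty_gt; rewrite num_real].
  move=> [y D] [/= [L L1 h] LD]; exists (L0 + L); first by lra.
  exact: joined_trans h0 h.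
move=> [D0 [_ HD]]; exists ((D0 + 1) + (D0 + 1)) => x z.
have D01 : D0 < D0 + 1 by lra.
have [L1 h1 j1] := HD _ D01 x Logic.I; have [L2 h2 j2] := HD _ D01 z Logic.I.
exists (L1 + L2); first by rewrite lerD.
exact: joined_trans (joined_sym gR j1) j2.
Qed.

End Local.

(** * Gromov-Hausdorff distance to a point *)

Section GromovHausdorff.
Variable g : tensor2 (R := R) n T.
Hypothesis gR : riemannian_metric A g.
Variable D : R.
Hypothesis HD : forall x z, exists2 L, L <= D & joined A g x z L.

Let dist x z := fine (riemannian_dist A g x z).

Let dist_ge0 x z : (0 <= riemannian_dist A g x z)%E.
Proof. by apply: le_ereal_inf_tmp => _ [L jL <-]; rewrite lee_fin (joined_ge0 jL). Qed.

Let distE x z : (dist x z)%:E = riemannian_dist A g x z.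
Proof.
rewrite /dist fineK // ge0_fin_numE //; have [L _ jL] := HD x z.
by apply: (@le_lt_trans _ _ L%:E); [apply: ereal_inf_lbound; exists L|rewrite ltry].
Qed.

Let dist_le x z L : joined A g x z L -> dist x z <= L.
Proof. by move=> jL; rewrite -lee_fin distE; apply: ereal_inf_lbound; exists L. Qed.

Let dist_approx x z e : 0 < e -> exists2 L, L < dist x z + e & joined A g x z L.
Proof.
move=> e0; have : (riemannian_dist A g x z < (dist x z + e)%:E)%E.
  by rewrite -distE lte_fin ltrDl.
by move=> /ereal_inf_lt[_ [L jL <-]]; rewrite lte_fin; exists L.
Qed.

Lemma GH_dist_point_le (x0 : T) : (GH_dist (riemannian_dist A g) point_dist <= D%:E)%E.
Proof.
have le_D x z : dist x z <= D.
  by have [L LD jL] := HD x z; apply: le_trans LD; exact: dist_le.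
have d0 x z : 0 <= dist x z by rewrite fine_ge0.
have D0 : 0 <= D := le_trans (d0 x0 x0) (le_D x0 x0).
have dxx x : dist x x = 0.
  by apply/eqP; rewrite eq_le d0 andbT; apply: dist_le; exact: joined_refl.
have dsym x z : dist x z = dist z x.
  have le x' z' : dist x' z' <= dist z' x'.
    apply/ler_addgt0Pr => e /(dist_approx z' x')[L Le jL].
    by apply: le_trans (ltW Le); apply: dist_le; exact: joined_sym.
  by apply/eqP; rewrite eq_le !le.
have dtri (x y z : T) : dist x z <= dist x y + dist y z.
  apply/ler_addgt0Pr => e e0; have e2 : 0 < e / 2 by rewrite divr_gt0.
  have [L1 h1 j1] := dist_approx x y e2; have [L2 h2 j2] := dist_approx y z e2.
  by apply: le_trans (dist_le (joined_trans j1 j2)) _; lra.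
(* Every point of the manifold is put at distance [D] from the added point. The triangle inequality
   through that point holds because no distance in the manifold exceeds [D]; [x0] serves the clause
   asking that the added point be close to the manifold. *)
pose DD (p q : T + unit) := match p, q with
  | inl x, inl z => dist x z | inr _, inr _ => 0 | _, _ => D end.
apply: ereal_inf_lbound; exists D => //; split=> //; exists DD; split.
- split=> //.
  + by move=> [x|[]] /=.
  + by move=> [x|[]] [z|[]] /=.
  + move=> [x|[]] [y|[]] [z|[]] /=; rewrite ?addr0 ?add0r //.
    * by rewrite lerDr.
    * by apply: le_trans (le_D x z) _; rewrite lerDl.
    * by rewrite lerDl.
    * by rewrite addr_ge0.
- by move=> x; exists tt.
- by move=> []; exists x0.
Qed.

End GromovHausdorff.

Lemma GH_dist_ge0 (X Y : Type) (dX : X -> X -> \bar R) (dY : Y -> Y -> \bar R) :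
  (0 <= GH_dist dX dY)%E.
Proof. by apply: le_ereal_inf_tmp => _ [r [r0 _] <-]; rewrite lee_fin. Qed.

End Curves.

(** * Curvature bounds *)
Section CurvatureFamilies.
Context {R : realType}.

Lemma near_le_add1 (T : topologicalType) (f : T -> R) x :
  {for x, continuous f} -> \forall y \near x, f y <= f x + 1.
Proof.
move=> cf; apply: filterS (cont_dist (ltr01 : 0 < 1 :> R) cf) => y.
by rewrite distrC => /(le_lt_trans (ler_norm _)); lra.
Qed.

Lemma pder_slice m n (f : 'rV[R]_(m + n) -> R) (b : 'rV[R]_m) (z : 'rV[R]_n) i :
  pder i (fun z => f (row_mx b z)) z = pder (rshift m i) f (row_mx b z).
Proof.
rewrite /pder /derive.
rewrite (_ : (fun h : R => h^-1 *: (((fun z => f (row_mx b z)) \o shift z) (h *: delta_mx 0 i) -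
    f (row_mx b z))) = (fun h : R => h^-1 *: ((f \o shift (row_mx b z))
    (h *: delta_mx 0 (rshift m i)) - f (row_mx b z)))) //.
apply/funext => h /=; congr (_ *: (f _ - _)).
apply/rowP => k; rewrite mxE [RHS]mxE [X in _ = X + _]mxE [X in _ = _ * X + _]mxE eqxx /=.
case: (fintype.split k) (splitK k) => j <- /=.
  by rewrite [in RHS]row_mxEl eq_lrshift mulr0 add0r.
by rewrite [in RHS]row_mxEr mxE [X in X + _ = _]mxE mxE eqxx (inj_eq (@rshift_inj _ _)).
Qed.

Section Slice.
Context {m n : nat} (Gh : 'rV[R]_(m + n) -> 'M[R]_n).
Let e := @rshift m n.

(** The curvature formulas of this section are functions of all [m + n] variables but differentiate
    only in the last [n] directions; at [row_mx b z] they therefore give the curvature of the metric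
    with [b] frozen. *)
Definition christoffel_slice (k i j : 'I_n) (w : 'rV[R]_(m + n)) : R :=
  2^-1 * \sum_l invmx (Gh w) k l *
    (pder (e i) (fun y => Gh y j l) w + pder (e j) (fun y => Gh y i l) w
     - pder (e l) (fun y => Gh y i j) w).

Definition riemann_slice (l i j k : 'I_n) (w : 'rV[R]_(m + n)) : R :=
  pder (e i) (christoffel_slice l j k) w - pder (e j) (christoffel_slice l i k) w
  + \sum_h (christoffel_slice l i h w * christoffel_slice h j k w
            - christoffel_slice l j h w * christoffel_slice h i k w).

Definition riemann_low_slice (i j k l : 'I_n) (w : 'rV[R]_(m + n)) : R :=
  \sum_h riemann_slice h i j k w * Gh w h l.

Definition riemann_sq_slice (w : 'rV[R]_(m + n)) : R :=
  let H := invmx (Gh w) in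
  \sum_i \sum_j \sum_k \sum_l \sum_a \sum_b \sum_c \sum_d
    H i a * H j b * H k c * H l d *
    riemann_low_slice i j k l w * riemann_low_slice a b c d w.

Variable b : 'rV[R]_m.
Let G (z : 'rV[R]_n) := Gh (row_mx b z).

Lemma christoffel_sliceE k i j z : christoffel G k i j z = christoffel_slice k i j (row_mx b z).
Proof.
rewrite /christoffel /christoffel_slice; congr (_ * _); apply: eq_bigr => l _.
congr (_ * _).
by rewrite (pder_slice (fun y => Gh y j l)) (pder_slice (fun y => Gh y i l)) (pder_slice (fun y => Gh y i j)).
Qed.

Lemma riemann_sliceE l i j k z : riemann G l i j k z = riemann_slice l i j k (row_mx b z).
Proof.
have cg (a c d a' c' d' : R) : a = a' -> c = c' -> d = d' -> a - c + d = a' - c' + d'.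
  by move=> -> -> ->.
apply: cg.
- rewrite -pder_slice; congr (pder i _ z); apply/funext => y; exact: christoffel_sliceE.
- rewrite -pder_slice; congr (pder j _ z); apply/funext => y; exact: christoffel_sliceE.
- by apply: eq_bigr => h _; rewrite !christoffel_sliceE.
Qed.

Lemma riemann_norm_slice z : riemann_norm G z = Num.sqrt (riemann_sq_slice (row_mx b z)).
Proof.
have E i j k l : riemann_low G i j k l z = riemann_low_slice i j k l (row_mx b z).
  by apply: eq_bigr => h _; rewrite riemann_sliceE.
apply: (congr1 Num.sqrt).
by do 8 (apply: eq_bigr => ? _); rewrite !E.
Qed.

Lemma riemann_sq_smooth w : smx Gh w -> Gh w \in unitmx -> smooth_germ riemann_sq_slice w.
Proof.
move=> sG uG; have sI := smx_inv sG uG.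
have sC k i j : smooth_germ (christoffel_slice k i j) w.
  apply: sgM; first exact: sg_cst.
  apply: sg_sum => l; apply: sgM; first exact: (sI k l).
  by apply: sgB; [apply: sgD|]; apply: sg_pder; apply: sG.
have sRm l i j k : smooth_germ (riemann_slice l i j k) w.
  apply: sgD; first by apply: sgB; apply: sg_pder; exact: sC.
  by apply: sg_sum => h; apply: sgB; apply: sgM; exact: sC.
have sL i j k l : smooth_germ (riemann_low_slice i j k l) w.
  by apply: sg_sum => h; apply: sgM; [exact: sRm|exact: sG].
do 8 (apply: sg_sum => ?).
by do 2 (apply: sgM; last exact: sL); do 3 (apply: sgM; last exact: sI); exact: sI.
Qed.

End Slice.

Section Scaling.
Context {n : nat} (G : 'rV[R]_n -> 'M[R]_n) (x : 'rV[R]_n) (s : R).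
Hypotheses (sG : smx G x) (uG : G x \in unitmx) (s0 : 0 < s).

(** The coefficients [riemann] are unchanged by a constant factor. Lowering an index gives [s], so
    the square of the norm gains [s] twice from the two lowered tensors and loses it four times from
    the inverse metrics. *)
Lemma riemann_norm_scale : riemann_norm (fun y => s *: G y) x = s^-1 * riemann_norm G x.
Proof.
have sn0 : s != 0 by rewrite gt_eqF.
have us : s \is a GRing.unit by rewrite unitfE.
have CE : \forall y \near x, forall k i j,
    christoffel (fun y => s *: G y) k i j y = christoffel G k i j y.
  apply: filterS2 (smx_near sG) (smx_unit_near sG uG) => y sy uy k i j.
  rewrite /christoffel; congr (_ * _); apply: eq_bigr => l _.
  have P a b c : pder a (fun y => (s *: G y) b c) y = s * pder a (fun y => G y b c) y.
    by rewrite -!mderE mderZ // mxE.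
  have I1 : invmx (s *: G y) k l = s^-1 * invmx (G y) k l by rewrite invmxZ ?mxE // unitmxZ.
  by rewrite I1 !P -!mulrDr -mulrBr mulrACA mulVf // mul1r.
have RE l i j k : riemann (fun y => s *: G y) l i j k x = riemann G l i j k x.
  have C0 := nbhs_singleton CE.
  have cg (a c d a' c' d' : R) : a = a' -> c = c' -> d = d' -> a - c + d = a' - c' + d'.
    by move=> -> -> ->.
  apply: cg; last by apply: eq_bigr => h _; rewrite !C0.
  - by apply: pder_eq; apply: filterS CE => y.
  - by apply: pder_eq; apply: filterS CE => y.
have LE i j k l : riemann_low (fun y => s *: G y) i j k l x = s * riemann_low G i j k l x.
  by rewrite /riemann_low mulr_sumr; apply: eq_bigr => h _; rewrite RE mxE mulrCA.
have I1 i j : invmx (s *: G x) i j = s^-1 * invmx (G x) i j by rewrite invmxZ ?mxE // unitmxZ.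
have sqE (S : R) : s^-1 * Num.sqrt S = Num.sqrt (s ^- 2 * S).
  by rewrite sqrtrM -?exprVn ?sqrtr_sqr ?ger0_norm // ?exprn_ge0 // invr_ge0 ltW.
rewrite /riemann_norm sqE; apply: (congr1 Num.sqrt).
do 8 (rewrite mulr_sumr; apply: eq_bigr => ? _).
rewrite !LE !I1.
move: (invmx _ _ _) (invmx _ _ _) (invmx _ _ _) (invmx _ _ _) => ? ? ? ?.
by move: (riemann_low _ _ _ _ _ _) (riemann_low _ _ _ _ _ _) => ? ?; field.
Qed.

End Scaling.

(** [Rm_norm] changes chart with the point; this allows one chart to be used on a whole
    neighbourhood. *)
Lemma Rm_norm_chart n (T : topologicalType) (A : atlas (R := R) n T) (g : tensor2 (R := R) n T) c x :
  smooth_manifold A -> riemannian_metric A g -> charts A c -> chart_dom c x ->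
  Rm_norm A g x = riemann_norm (g c) (chart_coord c x).
Proof.
move=> MA gR Ac cx; rewrite /Rm_norm; set d := chart_at A x.
have Ad : charts A d := chart_at_charts MA _.
have dx : chart_dom d x := chart_at_dom MA _.
have psiE : (chart_coord d \o chart_param c) (chart_coord c x) = chart_coord d x.
  by rewrite /= (chart_coordK MA Ac cx).
rewrite -psiE; apply/esym; apply: natural_riemann_norm; rewrite ?psiE.
- exact: (transition_smx MA Ac Ad cx dx).
- by split=> j k; exact: (metric_covariant gR).1.
- by apply: filterS (near_chart MA Ad dx) => v [dv <-]; exact: (Defs.metric_sym gR).
- by apply: posdef_unit => v; exact: (metric_pos gR Ad dx).
- exact: (transition_unit MA Ac Ad cx dx).
- apply: filterS2 (near_chart MA Ac cx) (transition_dom MA Ac Ad cx dx) => v [cv vE] dv.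
  have := (metric_covariant gR).2 c d (chart_param c v) Ac Ad cv dv.
  by rewrite vE.
Qed.

End CurvatureFamilies.

Section BundleCurvature.
Context {R : realType} {m : nat} {n : 'I_m -> nat} {M : 'I_m -> topologicalType}.
Variable A : forall i, atlas (R := R) (n i + n i) (M i).
Hypothesis MA : forall i, smooth_manifold (A i).
Let N := (1 + \sum_i (n i + n i))%N.
Context {P : topologicalType} (AP : atlas (R := R) (1 + \sum_i (n i + n i)) P).
Variables (act : R -> P -> P) (proj : P -> prod_topology M).
Hypothesis P_bundle : principal_circle_bundle AP (product_atlas A) act proj.
Variable sigma : tensor1 (R := R) (1 + \sum_i (n i + n i)) P.
Hypothesis sigma_conn : principal_connection AP act sigma.
Unset Implicit Arguments.
Variable g : forall i, tensor2 (R := R) (n i + n i) (M i).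
Set Implicit Arguments.
Hypothesis g_metric : forall i, riemannian_metric (A i) (g i).
Let MP := pcb_manifold P_bundle.
Let G s t := bundle_metric A proj g sigma s t.

(* The parameters [b] become additional coordinates, so that joint continuity of
   the curvature in [b] and the point is continuity of a smooth germ. *)
Let family c (w : 'rV[R]_(m + N)) : 'M[R]_N :=
  (sigma c (rsubmx w))^T *m sigma c (rsubmx w) +
  \sum_i lsubmx w 0 i *: pullback (A i) (fun y => proj y i) (g i) c (rsubmx w).

Let familyE c (b : 'rV[R]_m) : G 1 (fun i => b 0 i) c = (fun z => family c (row_mx b z)).
Proof.
apply/funext => z; rewrite /family row_mxKr row_mxKl /G /bundle_metric scale1r.
by [].
Qed.

Let rsub_smx (w : 'rV[R]_(m + N)) : smx (fun w : 'rV[R]_(m + N) => rsubmx w) w.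
Proof. exact: (smx_linear (rsubmx : {linear 'rV[R]_(m + N) -> 'rV[R]_N})). Qed.

Let family_smx c x (b : 'rV[R]_m) : charts AP c -> chart_dom c x ->
  smx (family c) (row_mx b (chart_coord c x)).
Proof.
move=> Ac cx.
have comp k l (h : 'rV[R]_N -> 'M[R]_(k, l)) : smx h (chart_coord c x) ->
    smx (fun w : 'rV[R]_(m + N) => h (rsubmx w)) (row_mx b (chart_coord c x)).
  move=> sh; apply: (smx_comp (rsub_smx _)); by rewrite row_mxKr.
apply: smxD.
  have ss : smx (fun v => (sigma c v)^T *m sigma c v) (chart_coord c x).
    by apply: smxM; [apply: smx_tr|]; exact: (sigma_smx sigma_conn).
  exact: comp ss.
apply: smx_sum => i; apply: smx_scale.
  rewrite (_ : (fun w => _) = (fun w : 'rV[R]_(m + N) => w 0 (lshift N i))); first exact: sg_coord.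
  by apply/funext => w; rewrite mxE.
apply: comp; exact: (pullback_proj_smx MA P_bundle (metric_covariant (g_metric i))).
Qed.

Let bounded_near (b0 : 'rV[R]_m) (x0 : P) : (forall i, 0 < b0 0 i) ->
  exists B, \forall z \near (b0, x0), Rm_norm AP (G 1 (fun i => (z.1 : 'rV[R]_m) 0 i)) z.2 <= B.
Proof.
move=> b00; set c := chart_at AP x0.
have Ac : charts AP c := chart_at_charts MP _.
have cx : chart_dom c x0 := chart_at_dom MP _.
pose w0 : 'rV[R]_(m + N) := row_mx b0 (chart_coord c x0).
have uw : family c w0 \in unitmx.
  have := familyE c b0 => /(congr1 (fun f => f (chart_coord c x0))) <-.
  apply: posdef_unit => v.
  exact: (bundle_pos MA P_bundle sigma_conn g_metric ltr01 b00 Ac cx).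
have sq := riemann_sq_smooth (family_smx b0 Ac cx) uw.
have csq : {for w0, continuous (fun w => Num.sqrt (riemann_sq_slice (family c) w))}.
  apply: (@continuous_comp _ _ _ (riemann_sq_slice (family c)) Num.sqrt); last exact: sqrt_continuous.
  exact: sg_continuous sq.
exists (Num.sqrt (riemann_sq_slice (family c) w0) + 1).
have nw : \forall w \near w0, Num.sqrt (riemann_sq_slice (family c) w) <=
    Num.sqrt (riemann_sq_slice (family c) w0) + 1.
  exact: near_le_add1 csq.
have cw : {for (b0, x0), continuous (fun z : 'rV[R]_m * P => row_mx z.1 (chart_coord c z.2) : 'rV[R]_(m + N))}.
  apply: cont_mx => i j; rewrite ord1 -[j]splitK; case: (fintype.split j) => k /=.
    rewrite (_ : (fun y => _) = (fun z : 'rV[R]_m * P => z.1 0 k)); last first.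
      by apply/funext => y; rewrite row_mxEl.
    apply: (@continuous_comp _ _ _ fst (fun v : 'rV[R]_m => v 0 k)); first exact: cvg_fst.
    exact: coord_continuous.
  rewrite (_ : (fun y => _) = (fun z : 'rV[R]_m * P => chart_coord c z.2 0 k)); last first.
    by apply/funext => y; rewrite row_mxEr.
  apply: (cont_entry (F := fun z : 'rV[R]_m * P => chart_coord c z.2)).
  apply: (@continuous_comp _ _ _ snd (chart_coord c)); first exact: cvg_snd.
  exact: (chart_coord_continuous MP Ac cx).
have npos : \forall z \near (b0, x0), forall i, 0 < (z.1 : 'rV[R]_m) 0 i.
  apply: near_fin => i.
  have c1 : {for (b0, x0), continuous (fun z : 'rV[R]_m * P => z.1 0 i)}.
    apply: (@continuous_comp _ _ _ fst (fun v : 'rV[R]_m => v 0 i)); first exact: cvg_fst.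
    exact: coord_continuous.
  by apply: (c1 (fun u => 0 < u)); exact: lt_nbhsr.
have ndom : \forall z \near (b0, x0), chart_dom c z.2.
  by apply: (cvg_snd (near_dom MP Ac cx)).
have nw' : \forall z \near (b0, x0), Num.sqrt (riemann_sq_slice (family c) (row_mx z.1 (chart_coord c z.2))) <=
    Num.sqrt (riemann_sq_slice (family c) w0) + 1 by exact: (cw _ nw).
apply: filterS3 npos ndom nw' => -[b x] /= b1 cx'.
have gR := bundle_riemannian MA P_bundle sigma_conn g_metric ltr01 b1.
by rewrite (Rm_norm_chart MP gR Ac cx') -/(G 1 _) familyE riemann_norm_slice.
Qed.

Hypothesis cP : compact [set: P].

(** Two compactness arguments: for fixed coefficients the bound is made uniform over [P] together
    with nearby coefficients, and then over the box of coefficients, on which the supremum over [P]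
    is locally bounded. *)
Lemma Rm_norm_bounded (lo hi : 'I_m -> R) : (forall i, 0 < lo i) ->
  exists2 B, 0 < B & forall (b : 'I_m -> R) x, (forall i, lo i <= b i <= hi i) ->
    Rm_norm AP (G 1 b) x <= B.
Proof.
move=> lo0; pose Q := [set v : 'rV[R]_m | forall i, `[lo i, hi i]%classic (v ord0 i)].
have cQ : compact Q.
  by apply: (@rV_compact _ m (fun i => `[lo i, hi i]%classic)) => i; exact: segment_compact.
have H : forall v, Q v -> exists B, \forall w \near v, forall x : P, Rm_norm AP (G 1 (fun i => (w : 'rV[R]_m) 0 i)) x <= B.
  move=> v Qv; have v0 i : 0 < v 0 i.
    by have := Qv i; rewrite /= in_itv /= => /andP[h _]; exact: lt_le_trans h.
  have : \forall z \near (nbhs v, +oo), [set: P] `<=`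
      (fun x => Rm_norm AP (G 1 (fun i => (z.1 : 'rV[R]_m) 0 i)) x <= z.2).
    apply: ((compact_near_coveringP _).1 cP _ (filter_prod (nbhs v) +oo)
      (fun z x => Rm_norm AP (G 1 (fun i => (z.1 : 'rV[R]_m) 0 i)) x <= z.2)) => x _.
    have [B [[V W] /= [nV nW] VW]] := bounded_near x v0.
    exists (W, [set z : 'rV[R]_m * R | V z.1 /\ B < z.2]).
      split=> //=; exists (V, [set u | B < u]); last by move=> [? ?] [].
      by split=> //; apply: nbhs_pinfty_gt; rewrite num_real.
    by move=> [y [w u]] [/= Wy [Vw Bu]]; apply: le_trans (ltW Bu); exact: (VW (w, y)).
  move=> [[V W] /= [nV [B0 [_ nW]]] VW]; exists (B0 + 1).
  apply: filterS nV => w Vw x; apply: (VW (w, B0 + 1)) => //; split=> //=.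
  by apply: nW => /=; lra.
have [|B B0 HB] := @compact_locally_bounded R _ Q (fun v => sup [set Rm_norm AP (G 1 (fun i => v 0 i)) x | x in [set: P]]) cQ.
  (* The maximum with 0 covers an empty [P], for which the supremum is 0 by convention. *)
  move=> v /H[B nB]; exists (Num.max B 0); apply: filterS nB => w Hw.
  case: (pselect ([set: P] !=set0)) => [[x _]|nP]; last first.
    rewrite (_ : [set _ | _ in _] = set0) ?sup0 ?le_max ?lexx ?orbT //.
    by apply/seteqP; split=> [u [x _ _]|//]; case: nP; exists x.
  rewrite le_max; apply/orP; left; apply: ge_sup; first by exists (Rm_norm AP (G 1 (fun i => w 0 i)) x), x.
  by move=> _ [y _ <-].
exists B => // b x blh.
have Qb : Q (\row_i b i) by move=> i /=; rewrite mxE in_itv /=.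
have -> : b = (fun i => (\row_i b i) 0 i) by apply/funext => i; rewrite mxE.
apply: le_trans (HB _ Qb); apply: ub_le_sup; last by exists x.
have [B' /nbhs_singleton HB'] := H _ Qb; exists B' => _ [y _ <-]; exact: HB'.
Qed.

Lemma Rm_norm_scale s (b : 'I_m -> R) x : 0 < s -> (forall i, 0 < b i) ->
  Rm_norm AP (G s b) x = s^-1 * Rm_norm AP (G 1 (fun i => b i / s)) x.
Proof.
move=> s0 b0; rewrite /Rm_norm; set c := chart_at AP x.
have Ac : charts AP c := chart_at_charts MP _.
have cx : chart_dom c x := chart_at_dom MP _.
have -> : G s b c = (fun z => s *: G 1 (fun i => b i / s) c z).
  apply/funext => z; rewrite /G /bundle_metric scale1r scalerDr; congr (_ + _).
  rewrite scaler_sumr; apply: eq_bigr => i _; rewrite scalerA mulrCA divff ?mulr1 //.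
  by rewrite gt_eqF.
apply: riemann_norm_scale => //.
  exact: (bundle_smx MA P_bundle sigma_conn g_metric).
apply: posdef_unit => v; apply: (bundle_pos MA P_bundle sigma_conn g_metric) => //.
by move=> i; rewrite divr_gt0.
Qed.

End BundleCurvature.

(** * Collapse and the type I bound *)

Section Collapse.
Context {R : realType}.

(** An empty space has no singular simplices, so there every multiple of a cochain is cohomologous
    to zero, against the absence of torsion. This supplies the base point for the collapse. *)
Lemma integral_indivisible_inhabited n (T : topologicalType) (A : atlas (R := R) n T)
    (w : tensor2 (R := R) n T) : integral_indivisible A w -> exists x : T, True.
Proof.
move=> [c [_ _ nc _]]; apply: contrapT => nT.
have /nc[] : (1 : int) != 0 by [].
by exists (fun=> 0) => // f; case: nT; exists (f 0).
Qed.

Context {m : nat} {n : 'I_m -> nat} {M : 'I_m -> topologicalType}.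
Variable A : forall i, atlas (R := R) (n i + n i) (M i).
Hypothesis MA : forall i, smooth_manifold (A i).
Context {P : topologicalType} (AP : atlas (R := R) (1 + \sum_i (n i + n i)) P).
Variables (act : R -> P -> P) (proj : P -> prod_topology M).
Hypothesis P_bundle : principal_circle_bundle AP (product_atlas A) act proj.
Variable sigma : tensor1 (R := R) (1 + \sum_i (n i + n i)) P.
Hypothesis sigma_conn : principal_connection AP act sigma.
Unset Implicit Arguments.
Variable g : forall i, tensor2 (R := R) (n i + n i) (M i).
Set Implicit Arguments.
Hypothesis g_metric : forall i, riemannian_metric (A i) (g i).
Hypotheses (cM : forall i, compact [set: M i]) (coM : forall i, connected [set: M i]).
Let MP := pcb_manifold P_bundle.
Let G s t := bundle_metric A proj g sigma s t.
Let j0 : 'I_(1 + \sum_i (n i + n i)) := lshift _ ord0.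

(** The quadratic form is linear in the coefficients, with nonnegative values attached to each of
    them, so metrics of the family can be compared coefficient by coefficient. *)
Lemma bundle_sqnorm c (x : P) v : exists (u : R) (w : 'I_m -> R),
  [/\ 0 <= u, forall i, 0 <= w i & forall s t,
   sqnorm v (G s t c (chart_coord c x)) = s * u + \sum_i t i * w i].
Proof.
pose z := chart_coord c x.
exists (((v *m (sigma c z)^T) 0 0) ^+ 2), (fun i => sqnorm v (pullback (A i) (fun y => proj y i) (g i) c z)).
split=> [|i|s t]; first exact: sqr_ge0.
- rewrite /sqnorm /pullback.
  set J := 'J _ z; set y := proj _ i; set e := chart_at (A i) y.
  have -> : v *m (J *m g i e (chart_coord e y) *m J^T) *m v^T =
      (v *m J) *m g i e (chart_coord e y) *m (v *m J)^T by rewrite trmx_mul !mulmxA.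
  case: (eqVneq (v *m J) 0) => [->|vJ]; first by rewrite !mul0mx mxE.
  by apply/ltW/(metric_pos (g_metric i)) => //; [exact: chart_at_charts|exact: chart_at_dom].
- rewrite /sqnorm /G /bundle_metric mulmxDr mulmxDl mxE; congr (_ + _).
    rewrite -scalemxAr -scalemxAl mxE; congr (_ * _).
    have E (r w : 'rV[R]_(1 + \sum_i (n i + n i))) : r *m (w^T *m w) *m r^T = (r *m w^T) *m (r *m w^T)^T.
      by rewrite trmx_mul trmxK !mulmxA.
    by rewrite E [LHS]mxE big_ord1 [X in _ * X]mxE expr2.
  rewrite mulmx_sumr mulmx_suml summxE; apply: eq_bigr => i _.
  by rewrite -scalemxAr -scalemxAl mxE.
Qed.

Lemma bundle_collapse (b0 : prod_topology M) (F : set_system R) (FF : Filter F)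
    (a : R -> R) (b : R -> 'I_m -> R) :
  a t @[t --> F] --> (0 : R) -> (forall i, b t i @[t --> F] --> (0 : R)) ->
  (\forall t \near F, 0 < a t /\ forall i, 0 < b t i) ->
  GH_dist (riemannian_dist AP (G (a t) (b t))) point_dist @[t --> F] --> 0%:E.
Proof.
move=> a0 bl pos.
have R1 : riemannian_metric AP (G 1 (fun=> 1)) by exact: (bundle_riemannian MA P_bundle sigma_conn g_metric ltr01 (fun=> ltr01)).
have cP := bundle_compact MA P_bundle cM.
have hP := bundle_chained MA P_bundle coM.
have [D HD] := bounded_joined MP j0 R1 cP hP.
have [_ _ [s [_ [_ _]]]] := pcb_trivial P_bundle b0.
pose x0 := s b0.
pose mu t := a t + \sum_i b t i.
have muD : (Num.sqrt (mu t) * D)%:E @[t --> F] --> 0%:E.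
  apply: cvg_EFin; first by near=> t.
  rewrite [X in _ --> X](_ : _ = Num.sqrt (0 + \sum_(i < m) 0) * D); last first.
    by rewrite big1 // addr0 sqrtr0 mul0r.
  apply: cvgM; last exact: cvg_cst.
  have cmu : mu t @[t --> F] --> 0 + \sum_(i < m) 0.
    by apply: cvgD => //; exact: cvg_bigsum.
  exact: (cvg_comp _ _ cmu (@sqrt_continuous R _)).
apply: (squeeze_cvge _ (cvg_cst 0%:E) muD); near=> t.
have [at0 bt0] : 0 < a t /\ forall i, 0 < b t i by near: t.
rewrite GH_dist_ge0 /=; have Rt := bundle_riemannian MA P_bundle sigma_conn g_metric at0 bt0.
have sumb : 0 <= \sum_i b t i by apply: sumr_ge0 => i _; exact: ltW.
have mu0 : 0 <= mu t by apply: addr_ge0 => //; exact: ltW.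
apply: (GH_dist_point_le MP j0 Rt _ x0) => x z.
have [L LD jL] := HD x z.
have [|L' L'L jL'] := joined_scale MP j0 R1 Rt mu0 _ jL.
  move=> c y v _ _; have [u [w [u0 w0 E]]] := bundle_sqnorm c y v.
  rewrite !E mul1r mulrDr mulr_sumr.
  apply: lerD; first by rewrite ler_wpM2r // lerDl.
  apply: ler_sum => i _; rewrite mul1r ler_wpM2r // /mu (bigD1 i) //= addrCA lerDl.
  by apply: addr_ge0; [exact: ltW|apply: sumr_ge0 => k _; exact: ltW].
by exists L' => //; apply: le_trans L'L _; rewrite ler_wpM2l ?sqrtr_ge0.
Unshelve. all: by end_near. Qed.

Lemma bundle_type_I (T1 k : R) (lo hi : 'I_m -> R) (a : R -> R) (b : R -> 'I_m -> R) :
  0 <= k -> (forall i, 0 < lo i) ->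
  (forall t, - T1 < t <= 0 -> [/\ 0 < a t, (T1 + t) / a t <= k &
     forall i, 0 < b t i /\ lo i <= b t i / a t <= hi i]) ->
  exists C : R, 0 < C /\ forall t, - T1 < t <= 0 ->
    ((T1 + t)%:E * ereal_sup [set (Rm_norm AP (G (a t) (b t)) x)%:E | x in [set: P]] <= C%:E)%E.
Proof.
move=> k0 lo0 H.
have cP := bundle_compact MA P_bundle cM.
have [B B0 HB] := Rm_norm_bounded MA P_bundle sigma_conn g_metric cP hi lo0.
(* [B] bounds the curvature norm of the metrics with fibre coefficient 1, and [k] the time divided
   by [a t]; the summand 1 ensures a positive constant even if [k] is 0. *)
exists (k * B + 1); split=> [|t t01]; first by rewrite ltr_wpDl // mulr_ge0 // ltW.
have [at0 tk bt] := H t t01.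
have T0 : 0 <= T1 + t by move: t01 => /andP[]; lra.
have sup_le : (ereal_sup [set (Rm_norm AP (G (a t) (b t)) x)%:E | x in [set: P]] <= (B / a t)%:E)%E.
  apply: ge_ereal_sup => _ [x _ <-]; rewrite lee_fin.
  rewrite (Rm_norm_scale MA P_bundle sigma_conn g_metric) // => [|i]; last by have [] := bt i.
  rewrite mulrC; apply: ler_wpM2r; first by rewrite invr_ge0 ltW.
  by apply: HB => i; have [] := bt i.
apply: (@le_trans _ _ ((T1 + t)%:E * (B / a t)%:E)%E); first by rewrite lee_wpmul2l // lee_fin.
rewrite -EFinM lee_fin mulrA mulrAC.
apply: (@le_trans _ _ (k * B)); last by rewrite lerDl.
by rewrite ler_wpM2r // ltW.
Qed.

End Collapse.

Theorem theorem3p18 (R : realType) (m : nat)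
    (n p : 'I_m -> nat) (q : 'I_m -> int)
    (p_gt0 : forall i, (0 < p i)%N) (q_neq0 : forall i, q i != 0)
    (* the Kaehler-Einstein factors *)
    (M : 'I_m -> topologicalType)
    (A : forall i, atlas (R := R) (n i + n i) (M i))
    (g : forall i, tensor2 (R := R) (n i + n i) (M i))
    (M_KE : forall i, kahler_einstein (A i) (g i) (p i)%:R)
    (M_class : forall i, integral_indivisible (A i)
       (fun c v => (2 * pi)^-1 *: kahler_form (g i) c v))
    (* the circle bundle and its connection *)
    (P : topologicalType) (AP : atlas (R := R) (1 + \sum_i (n i + n i)) P)
    (act : R -> P -> P) (proj : P -> prod_topology M)
    (P_bundle : principal_circle_bundle AP (product_atlas A) act proj)
    (sigma : tensor1 (1 + \sum_i (n i + n i)) P)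
    (sigma_conn : principal_connection AP act sigma)
    (sigma_curv : connection_curvature A proj q g AP sigma)
    (* the solution Y(u) *)
    (xi : 'rV[R]_m)
    (xi_gt0 : forall i, 0 < xi 0 i)
    (xi_root : forall i, flowF n p q i xi = 0)
    (Y : R -> 'rV[R]_m)
    (Y_ode : forall (u : R) (i : 'I_m),
       is_derive u (1 : R) (fun s : R => Y s 0 i)
         (- Y u 0 i * flowF n p q i (Y u)))
    (Y_Omega : forall u, Omega_plus n p q (Y u) /\ Y u <> 0 /\ Y u <> xi)
    (Y_lim : Y u @[u --> -oo] --> xi)
    (* the corresponding metrics g_{a,b}(tau), -T1 < tau < +oo *)
    (a0 : R) (a0_gt0 : 0 < a0)
    (T1 : R) (T1_lim : tau_of n q a0 Y u @[u --> -oo] --> - T1)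
    (a : R -> R) (b : R -> 'I_m -> R)
    (a_def : forall u, a (tau_of n q a0 Y u) = a_of n q a0 Y u)
    (b_def : forall u i, b (tau_of n q a0 Y u) i = a_of n q a0 Y u / Y u 0 i) :
  let G (s : R) (t : 'I_m -> R) := bundle_metric A proj g sigma s t in
  let G_xi := G 1 (fun i => (xi 0 i)^-1) in
  let E_xi := flowE n q xi in
  [/\ (* (i) *)
      [/\ a t @[t --> (- T1)^'+] --> (0 : R),
          forall i, b t i @[t --> (- T1)^'+] --> (0 : R),
          forall i, (a t / b t i) @[t --> (- T1)^'+] --> xi 0 i,
          (a t / (T1 + t)) @[t --> (- T1)^'+] --> E_xi
        & GH_dist (riemannian_dist AP (G (a t) (b t))) point_dist
            @[t --> (- T1)^'+] --> 0%:E],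
      (* (ii) *)
      (exists C : R, 0 < C /\ forall t, - T1 < t <= 0 ->
         ((T1 + t)%:E *
          ereal_sup [set (Rm_norm AP (G (a t) (b t)) x)%:E | x in [set: P]]
          <= C%:E)%E)
    & (* (iii) *)
      [/\ smooth_cvg AP (- T1)^'+
            (fun t c v => (T1 + t)^-1 *: G (a t) (b t) c v)
            (fun c v => E_xi *: G_xi c v),
          riemannian_metric AP G_xi,
          einstein AP G_xi (E_xi / 2)
        & forall c x, charts AP c -> chart_dom c x ->
            scalar_curvature (G_xi c) (chart_coord c x) =
            2 * (\sum_i (n i)%:R * (p i)%:R * xi 0 i) - E_xi / 2]].

Proof.
move=> G G_xi E_xi.
have MA i : smooth_manifold (A i) := ke_manifold (M_KE i).
have gR i : riemannian_metric (A i) (g i) := ke_metric (M_KE i).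
have cM i : compact [set: M i] := ke_compact (M_KE i).
have coM i : connected [set: M i] := ke_connected (M_KE i).
(* A base point makes the bundle nonempty, as is necessary for a point to be its Gromov-Hausdorff
   limit. *)
have [b0] : exists b0 : prod_topology M, True.
  by exists (fun i => sval (cid (integral_indivisible_inhabited (M_class i)))).
move=> _.
have YO u : Omega_plus n p q (Y u) by have [] := Y_Omega u.
have al : a t @[t --> (- T1)^'+] --> (0 : R) by exact: (a_lim Y_ode a0_gt0 T1_lim a_def).
have bl i : b t i @[t --> (- T1)^'+] --> (0 : R).
  exact: (b_lim xi_gt0 Y_ode Y_lim a0_gt0 T1_lim a_def b_def).
have rl i : (a t / b t i) @[t --> (- T1)^'+] --> xi 0 i.
  exact: (ratio_lim Y_ode Y_lim a0_gt0 T1_lim a_def b_def).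
have ar : (a t / (T1 + t)) @[t --> (- T1)^'+] --> E_xi.
  exact: (a_rate xi_gt0 Y_ode YO Y_lim a0_gt0 T1_lim a_def).
have br i : (b t i / (T1 + t)) @[t --> (- T1)^'+] --> E_xi / xi 0 i.
  exact: (b_rate xi_gt0 Y_ode YO Y_lim a0_gt0 T1_lim a_def b_def).
have fb := @flow_bounds _ _ _ _ _ _ _ xi_gt0 Y_ode YO Y_lim _ _ a0_gt0 T1_lim _ _ a_def b_def.
have T1_0 := T1_gt0 Y_ode a0_gt0 T1_lim.
have E0 := flowE_gt0 xi_gt0 Y_ode YO Y_lim a0_gt0 T1_lim.
have xiV i : 0 < (xi 0 i)^-1 by rewrite invr_gt0.
split.
- split=> //; apply: (bundle_collapse MA P_bundle) => //.
  near=> t.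
  have t1 : - T1 < t by near: t; exact: nbhs_right_gt.
  (* Since [tau] vanishes at [u = 0] and exceeds [- T1], the number [T1] is positive; so times just
     after [- T1] are negative, where [flow_bounds] applies. *)
  have t0 : t <= 0 by near: t; apply: nbhs_right_le; rewrite oppr_lt0.
  by have [at0 _ bt] := fb t t1 t0; split=> // i; have [] := bt i.
- apply: (bundle_type_I MA P_bundle sigma_conn gR cM (k := (flowE n q (Y 0))^-1)
    (lo := fun i => (xi 0 i)^-1) (hi := fun i => (Y 0 0 i)^-1)) => //.
    by rewrite invr_ge0 ltW.
  by move=> t /andP[t1 t0]; exact: fb.
- split.
  + apply: (bundle_smooth_cvg MA P_bundle sigma_conn gR) => [|i].
      by apply: cvg_trans ar; apply: near_eq_cvg; near=> t; rewrite mulrC.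
    by apply: cvg_trans (br i); apply: near_eq_cvg; near=> t; rewrite mulrC.
  + exact: (bundle_riemannian MA P_bundle sigma_conn gR ltr01 xiV).
  + exact: (bundle_einstein MA P_bundle sigma_conn gR M_KE sigma_curv xi_gt0 xi_root).
  + exact: (bundle_scalar MA P_bundle sigma_conn gR M_KE sigma_curv xi_gt0 xi_root).
Unshelve. all: by end_near. Qed.
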